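(* Let $\widetilde{G}$ be a connected mixed graph with a cut vertex $v$ and without pendant vertices. Then $p(\widetilde{G})=2$ if and only if $\widetilde{G}$ is switching equivalent to one of the following mixed graphs: (i) $\widetilde{K}_{m_1,\dots,m_x}\bullet v\bullet\widetilde{K}_{m_1',\dots,m_y'}$, where neither $\widetilde{K}_{m_1,\dots,m_x}$ nor $\widetilde{K}_{m_1',\dots,m_y'}$ is a mixed star, and each of $\widetilde{K}_{m_1,\dots,m_x}$ and $\widetilde{K}_{m_1',\dots,m_y'}$ is positive or switching equivalent to some $\overrightarrow{C_3}(t_1,t_2,t_3)$; (ii) $K(q_1,\dots,q_r;n_1,\dots,n_k;p)$ with $r\ge2$, $k\ge2$, $p\ge1$, satisfying one of: (1) $p=1$ and either ($n_1=1$ and $k-p\ge2$) or $n_1\ge2$; (2) $p\ge2$ and $k-p\le1$; (3) $p\ge2$, $k-p\ge2$ and $\frac1r+\frac1p+\frac1{k-p-1}\ge1$; (iii) $K(q_1,\dots,q_r;n_1,\dots,n_k;a^i,b^{-i},0^{1},0^{-1},s)$ with $r\ge2$, $k\ge2$, $a\ge b\ge1$, $s=k-a-b$, satisfying $a=b=1$ and $r=2$; (iv) $K(q_1,\dots,q_r;n_1,\dots,n_k;a^i,0^{-i},c^{1},0^{-1},s)$ with $r\ge2$, $k\ge2$, $a\ge c\ge1$, $s=k-a-c$, satisfying one of: (1) $a=c=1$ and $s\in\{0,1\}$; (2) $a=c=1$, $s=2$ and $r\in\{3,4\}$; (3) $a=c=1$, $s=3$, $r=3$; (4) $a=c=1$,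 $s\ge2$, $r=2$; (5) $a=c=2$, $s=0$, $2\le r\le4$; (6) $a=c=2$, $s=1$, $r=2$; (7) $a=3$, $s=0$, $r=c=2$; (8) $a=4$, $c=r=2$, $s=0$; (9) $a\ge2$, $c=1$ and $\frac{as-1}{a+s}\le\frac1{r-1}$.
   Context: A mixed graph $\widetilde{G}$ is obtained from a simple graph $G$ (its underlying graph) by orienting some edges (arcs); the rest stay undirected. A simple graph is regarded as a mixed graph with no arcs. With $V(G)=\{v_1,\dots,v_n\}$, the Hermitian adjacency matrix $H(\widetilde{G})=(h_{st})$ has $h_{st}=1$ for an undirected edge $v_sv_t$, $h_{st}=i$ for an arc from $v_s$ to $v_t$, $h_{st}=-i$ for an arc from $v_t$ to $v_s$, $h_{st}=0$ otherwise. $p(\widetilde{G})$ is the number of positive eigenvalues of $H(\widetilde{G})$ with multiplicity. Pendant vertex: degree one in the underlying graph; cut vertex: a cut vertex of the underlying graph. A mixed star, mixed complete multipartite graph $\widetilde{K}_{m_1,\dots,m_x}$, etc., is a mixed graph whose underlying graph is a star, the complete multipartite graph $K_{m_1,\dots,m_x}$, etc. The value of a mixed cycle $u_1u_2\cdots u_nu_1$ is $h_{u_1u_2}h_{u_2u_3}\cdots h_{u_nu_1}$; a mixed graph is positive if all its mixed cycles have value $1$. The converse of a mixed graph reverses all arcs. Two mixed graphs are switching equivalent if (after a suitable identification of vertex sets) there is a diagonal matrix $Q$ with diagonal entries in $\{\pm1,\pm i\}$ with $H(\widetilde{G_2})=Q^{-1}H(\widetilde{G_1})Q$ or $H(\widetilde{G_2})^{\top}=Q^{-1}H(\widetilde{G_1})Q$.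 For positive integers $t_1,t_2,t_3$, $\overrightarrow{C_3}(t_1,t_2,t_3)$ is the mixed complete tripartite graph with parts $A,B,C$ of sizes $t_1,t_2,t_3$ in which all edges between $A,B$ are arcs from $A$ to $B$, between $B,C$ arcs from $B$ to $C$, and between $C,A$ arcs from $C$ to $A$. For mixed graphs $\widetilde{G_1},\widetilde{G_2}$, $\widetilde{G_1}\bullet v\bullet\widetilde{G_2}$ is obtained from their disjoint union by identifying a vertex of $\widetilde{G_1}$ with a vertex of $\widetilde{G_2}$; the new vertex is $v$. For positive integers $q_1,\dots,q_r,n_1,\dots,n_k$ and $1\le p\le k$, $K(q_1,\dots,q_r;n_1,\dots,n_k;p)$ is the simple graph obtained from disjoint copies of $K_{q_1,\dots,q_r}$ and $K_{n_1,\dots,n_k}$ (the latter with partition classes $V_1,\dots,V_k$, $|V_j|=n_j$) by adding a new vertex $v$ adjacent to all vertices of $K_{q_1,\dots,q_r}$ and to all vertices of $V_1\cup\dots\cup V_p$. For nonnegative integers $a,b,c$ with $1\le a+b+c\le k$, $K(q_1,\dots,q_r;n_1,\dots,n_k;a^i,b^{-i},c^1,0^{-1},k-a-b-c)$ is the mixed graph with underlying graph $K(q_1,\dots,q_r;n_1,\dots,n_k;a+b+c)$ in which the edges from $v$ to the vertices of $V_1\cup\dots\cup V_a$ are arcs directed from $v$, the edges from $v$ to the vertices of $V_{a+1}\cup\dots\cup V_{a+b}$ are arcs directed towards $v$, and all other edges (including those from $v$ to $V_{a+b+1}\cup\dots\cup V_{a+b+c}$ and to $K_{q_1,\dots,q_r}$)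 are undirected. *)

(* Defs.v *)
From HB Require Import structures.
From mathcomp Require Import all_boot all_order all_algebra all_field.

Set Implicit Arguments.
Unset Strict Implicit.
Unset Printing Implicit Defensive.

Import Order.TTheory GRing.Theory Num.Theory.

Record sgraph (T : finType) := SGraph {
  adj : rel T;
  adj_sym : symmetric adj;
  adj_irr : irreflexive adj }.

(* [arc G x y] means that the edge xy is oriented from x to y. *)
Record mixed_graph (T : finType) := MixedGraph {
  underlying :> sgraph T;
  arc : rel T;
  arc_adj : forall x y, arc x y -> adj underlying x y;
  arc_asym : forall x y, arc x y -> ~~ arc y x }.

Definition mixed_of_simple (T : finType) (G : sgraph T) : mixed_graph T.
Proof. by exists G (fun _ _ => false). Defined.

Definition degree (T : finType) (G : sgraph T) (x : T) : nat := #|adj G x|.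

Definition pendant (T : finType) (G : sgraph T) (x : T) : Prop :=
  degree G x = 1%N.

Definition connected (T : finType) (G : sgraph T) : Prop :=
  forall x y, connect (adj G) x y.

Definition adj_del (T : finType) (G : sgraph T) (v : T) : rel T :=
  [rel x y | [&& x != v, y != v & adj G x y]].

(* v separates two other vertices of the same component. *)
Definition cut_vertex (T : finType) (G : sgraph T) (v : T) : Prop :=
  exists x y, [/\ x != v, y != v, connect (adj G) x y
                & ~~ connect (adj_del G v) x y].

Section Hermitian.
Local Open Scope ring_scope.

Definition hentry (T : finType) (G : mixed_graph T) (x y : T) : algC :=
  if arc G x y then 'i else if arc G y x then - 'i
  else if adj G x y then 1 else 0.

Definition hermitian_adj (T : finType) (G : mixed_graph T) : 'M[algC]_#|T| :=
  \matrix_(s, t) hentry G (enum_val s) (enum_val t).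

(* The eigenvalues of A, listed with algebraic multiplicity. *)
Definition eigenvalues (n : nat) (A : 'M[algC]_n) : seq algC :=
  sval (closed_field_poly_normal (char_poly A)).

(* On algC, [0 < x] holds exactly for the positive reals. *)
Definition pos_inertia (T : finType) (G : mixed_graph T) : nat :=
  count (fun x : algC => 0 < x) (eigenvalues (hermitian_adj G)).

Definition mixed_cycle (T : finType) (G : sgraph T) (c : seq T) : bool :=
  (2 < size c)%N && ucycleb (adj G) c.

Definition cycle_value (T : finType) (G : mixed_graph T) (c : seq T) : algC :=
  \prod_(x <- c) hentry G x (next c x).

Definition positive (T : finType) (G : mixed_graph T) : Prop :=
  forall c : seq T, mixed_cycle G c -> cycle_value G c = 1.

End Hermitian.

Definition pullback_simple (T1 T2 : finType) (f : T1 -> T2) (G : sgraph T2) :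
  sgraph T1.
Proof.
exists (fun x y => adj G (f x) (f y)).
- by move=> x y; apply: adj_sym.
- by move=> x; apply: adj_irr.
Defined.

Definition pullback (T1 T2 : finType) (f : T1 -> T2) (G : mixed_graph T2) :
  mixed_graph T1.
Proof.
exists (pullback_simple f G) (fun x y => arc G (f x) (f y)).
- by move=> x y; apply: arc_adj.
- by move=> x y; apply: arc_asym.
Defined.

(* f is the identification of the two vertex sets. *)
Definition switching_equivalent (T1 T2 : finType)
    (G1 : mixed_graph T1) (G2 : mixed_graph T2) : Prop :=
  exists (f : T1 -> T2) (q : 'rV[algC]_#|T1|),
    [/\ bijective f,
        forall j, (q 0 j \in [:: 1; -1; 'i; - 'i])%R
      & let Q := diag_mx q in
        let H1 := hermitian_adj G1 in
        let H2 := hermitian_adj (pullback f G2) in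
        (H2 = invmx Q *m H1 *m Q \/ H2^T = invmx Q *m H1 *m Q)%R].

(* Vertices of K_{m_1,...,m_x}; classes are numbered from 0, so V_j is the set
   of the z such that [tag z] is j - 1. *)
Definition multipart (ms : seq nat) : finType :=
  {j : 'I_(size ms) & 'I_(nth 0 ms j)}.

Definition complete_multipartite (ms : seq nat) : sgraph (multipart ms).
Proof.
exists (fun x y => tag x != tag y).
- by move=> x y; rewrite eq_sym.
- by move=> x; rewrite eqxx.
Defined.

Definition pos_parts (ms : seq nat) : bool := all (leq 1) ms.

Definition same_graph (T : finType) (G1 G2 : sgraph T) : Prop :=
  adj G1 =2 adj G2.

Definition star (T : finType) (G : sgraph T) : Prop :=
  exists (m : nat) (f : T -> multipart [:: 1; m]),
    [/\ 0 < m, bijective f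
      & same_graph G (pullback_simple f (complete_multipartite [:: 1; m]))].

(* The classes A, B, C have tags 0, 1, 2. *)
Definition C3 (t1 t2 t3 : nat) : mixed_graph (multipart [:: t1; t2; t3]).
Proof.
exists (complete_multipartite [:: t1; t2; t3])
       (fun x y : multipart _ => tag y == (tag x).+1 %% 3 :> nat).
- by move=> [[[|[|[|//]]] ?] ?] [[[|[|[|//]]] ?] ?].
- by move=> [[[|[|[|//]]] ?] ?] [[[|[|[|//]]] ?] ?].
Defined.

Section Coalescence.
Variables (T1 T2 : finType) (u1 : T1) (u2 : T2).

(* [None] is the vertex obtained by identifying u1 with u2. *)
Definition coal_vertex : finType :=
  option ({x : T1 | x != u1} + {y : T2 | y != u2})%type.

Definition coal_left (z : coal_vertex) : option T1 :=
  match z with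
  | None => Some u1
  | Some (inl x) => Some (val x)
  | Some (inr _) => None
  end.

Definition coal_right (z : coal_vertex) : option T2 :=
  match z with
  | None => Some u2
  | Some (inl _) => None
  | Some (inr y) => Some (val y)
  end.

Definition orel (T : Type) (r : rel T) (a b : option T) : bool :=
  if a is Some x then if b is Some y then r x y else false else false.

Definition coal_rel (r1 : rel T1) (r2 : rel T2) : rel coal_vertex :=
  fun z w => orel r1 (coal_left z) (coal_left w)
          || orel r2 (coal_right z) (coal_right w).

Definition coalescence_simple (G1 : sgraph T1) (G2 : sgraph T2) :
  sgraph coal_vertex.
Proof.
exists (coal_rel (adj G1) (adj G2)).
- by move=> [[x|x]|] [[y|y]|]; rewrite /coal_rel /= 1?adj_sym // ?orbF;
    rewrite ?adj_irr // adj_sym.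
- by move=> [[x|x]|]; rewrite /coal_rel /= ?adj_irr.
Defined.

Lemma arc_irr (T : finType) (G : mixed_graph T) : irreflexive (arc G).
Proof. by move=> x; apply/negP => /[dup] /arc_asym /negP. Qed.

Definition coalescence (G1 : mixed_graph T1) (G2 : mixed_graph T2) :
  mixed_graph coal_vertex.
Proof.
exists (coalescence_simple G1 G2) (coal_rel (arc G1) (arc G2)).
- by move=> z w /orP[] h; apply/orP; [left|right]; move: h;
    [case: (coal_left z) (coal_left w) => [x|] [y|] //=
    |case: (coal_right z) (coal_right w) => [x|] [y|] //=]; apply: arc_adj.
- by move=> [[x|x]|] [[y|y]|]; rewrite /coal_rel /= ?orbF ?arc_irr //;
    apply: arc_asym.
Defined.

End Coalescence.

Section Kgraph.
Variables (qs ns : seq nat).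

(* [None] is the new vertex v. *)
Definition Kvertex : finType := option (multipart qs + multipart ns)%type.

Definition Kadj (p : nat) : rel Kvertex := fun z w =>
  match z, w with
  | None, None => false
  | None, Some (inl _) | Some (inl _), None => true
  | None, Some (inr y) | Some (inr y), None => tag y < p
  | Some (inl x), Some (inl y) => adj (complete_multipartite qs) x y
  | Some (inr x), Some (inr y) => adj (complete_multipartite ns) x y
  | _, _ => false
  end.

Definition Karc (a b : nat) : rel Kvertex := fun z w =>
  match z, w with
  | None, Some (inr y) => tag y < a
  | Some (inr y), None => a <= tag y < a + b
  | _, _ => false
  end.

(* K(q_1,...,q_r; n_1,...,n_k; p) *)
Definition Kgraph (p : nat) : sgraph Kvertex.
Proof.
exists (Kadj p).
- by move=> [[x|x]|] [[y|y]|] //=; rewrite eq_sym.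
- by move=> [[x|x]|] //=; rewrite eqxx.
Defined.

(* K(q_1,...,q_r; n_1,...,n_k; a^i, b^{-i}, c^1, 0^{-1}, k - a - b - c) *)
Definition Kmixed (a b c : nat) : mixed_graph Kvertex.
Proof.
exists (Kgraph (a + b + c)) (Karc a b).
- move=> [[x|x]|] [[y|y]|] //=.
  + by case/andP=> _ h; apply: leq_trans h _; apply: leq_addr.
  + by move=> h; apply: leq_trans h _; rewrite -addnA leq_addr.
- move=> [[x|x]|] [[y|y]|] //=.
  + by case/andP=> h _; rewrite -leqNgt.
  + by move=> h; rewrite negb_and -ltnNge h.
Defined.

End Kgraph.

(* Main.v *)
Require Import Defs.
From HB Require Import structures.
From mathcomp Require Import all_boot all_order all_algebra all_field.
From mathcomp Require Import spectral sesquilinear ring zify.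

(** Deleting the cut vertex [v] leaves at least two components, each with an edge
    and so each with a positive eigenvalue; hence there are exactly two sides [A]
    and [B], and each carries a form with one positive eigenvalue.  Such a form is,
    up to switching, the blow-up of a complete graph or of the directed triangle:
    any other configuration contains an isotropic vector which is orthogonal to a
    positive one without being null, hence a second positive direction.

    The same argument applied to [v] shows that [v] sees the parts of each side
    through constants [b j], so that [v] has orthogonal projections onto both
    sides.  The residual [z] of [v] is orthogonal to everything else, and [p = 2]
    if and only if [form z z <= 0], that is [f A + f B >= 0], where for a side with
    [k] parts [f = |sum_j b j|^2 / (k - 1) - sum_j |b j|^2].  If both [f] are
    nonnegative, both sides together with [v] again have one positive eigenvalue,
    which is (i).  Otherwise one of them is positive; this forces all its [b j] to
    coincide, its value is then [r / (r - 1)], and the remaining inequality on the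
    numbers of parts seen through 1, -1, i and -i unfolds into (ii), (iii), (iv). *)

Set Implicit Arguments.
Unset Strict Implicit.
Unset Printing Implicit Defensive.

Import Order.TTheory GRing.Theory Num.Theory.
Local Open Scope ring_scope.

(** * Positive families of a Hermitian form *)

(** Eigenvalues enter only through Sylvester's law: [p >= k] means that there are [k] pairwise
    orthogonal positive vectors ([Pge]), and [p <= k] follows from a subspace of codimension [k] on
    which the form is nonpositive ([codim_le]). Both notions refer to vectors supported on a set of
    vertices, so no submatrix is formed, and sides are merged, or enlarged by [v], by manipulating
    supports.

    The obstacle is degeneracy: the form on a side may be singular, so an orthogonal projection need
    not exist. Degeneracy is turned into a tool: every vector of the radical of a side must be
    orthogonal to [v]. This forces [v] to see each part with one switched weight, and makes the
    projection exist. That the entries are fourth roots of unity matters wherever three of them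
    would have to sum to 0.

    The [k - 1] in [f] comes from the inverse of J - I of order [k], which is J / (k - 1) - I. The
    matrix of the directed triangle is singular instead, and there [f] is 0. *)

Section HermitianForm.
Variables (T : finType) (h : T -> T -> algC).
Hypothesis hC : forall x y, h y x = (h x y)^*.

Notation V := {ffun T -> algC^o}.
Implicit Types (S : {set T}) (u w n : V).

Definition hform u w : algC := \sum_x \sum_y u x * h x y * (w y)^*.

Definition ev (x : T) : V := [ffun y => (y == x)%:R].

Definition supp S u := forall x, x \notin S -> u x = 0.

Lemma formDl u1 u2 w : hform (u1 + u2) w = hform u1 w + hform u2 w.
Proof.
rewrite /hform -big_split; apply: eq_bigr => x _.
rewrite -big_split; apply: eq_bigr => y _.
by rewrite ffunE !mulrDl.
Qed.

Lemma formZl a u w : hform (a *: u) w = a * hform u w.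
Proof.
rewrite /hform mulr_sumr; apply: eq_bigr => x _.
rewrite mulr_sumr; apply: eq_bigr => y _.
by rewrite ffunE !mulrA.
Qed.

Lemma formC u w : hform w u = (hform u w)^*.
Proof.
rewrite /hform rmorph_sum exchange_big; apply: eq_bigr => x _.
rewrite rmorph_sum; apply: eq_bigr => y _.
by rewrite !rmorphM /= conjCK -hC; ring.
Qed.

Lemma formDr u w1 w2 : hform u (w1 + w2) = hform u w1 + hform u w2.
Proof. by rewrite formC formDl rmorphD /= -!formC. Qed.

Lemma formZr a u w : hform u (a *: w) = a^* * hform u w.
Proof. by rewrite formC formZl rmorphM /= -formC. Qed.

Lemma form0l w : hform 0 w = 0.
Proof. by rewrite -(scale0r (0 : V)) formZl mul0r. Qed.

Lemma formNl u w : hform (- u) w = - hform u w.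
Proof. by rewrite -scaleN1r formZl mulN1r. Qed.

Lemma formNr u w : hform u (- w) = - hform u w.
Proof. by rewrite formC formNl rmorphN /= -formC. Qed.

Lemma form_suml (I : Type) (r : seq I) (P : pred I) (F : I -> V) w :
  hform (\sum_(i <- r | P i) F i) w = \sum_(i <- r | P i) hform (F i) w.
Proof.
by apply: (big_morph (fun u => hform u w)) => [u1 u2|]; rewrite ?formDl ?form0l.
Qed.

Lemma form_sumr (I : Type) (r : seq I) (P : pred I) u (F : I -> V) :
  hform u (\sum_(i <- r | P i) F i) = \sum_(i <- r | P i) hform u (F i).
Proof.
by rewrite formC form_suml rmorph_sum; apply: eq_bigr => i _; rewrite /= -formC.
Qed.

Lemma form_real u : hform u u \is Num.real.
Proof. by apply/CrealP; rewrite -formC. Qed.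

Lemma ev_sum u : u = \sum_x u x *: ev x.
Proof.
apply/ffunP => y; rewrite sum_ffunE (bigD1 y) //= big1 ?addr0.
  by rewrite !ffunE eqxx /GRing.scale /= mulr1.
by move=> x nxy; rewrite !ffunE eq_sym (negPf nxy) /GRing.scale /= mulr0.
Qed.

Lemma form_evr u y : hform u (ev y) = \sum_x u x * h x y.
Proof.
rewrite /hform; apply: eq_bigr => x _.
rewrite (bigD1 y) //= big1 ?addr0 ?ffunE ?eqxx ?conjC1 ?mulr1 //.
by move=> z nzy; rewrite ffunE (negPf nzy) conjC0 mulr0.
Qed.

Lemma form_ev x y : hform (ev x) (ev y) = h x y.
Proof.
rewrite form_evr (bigD1 x) //= big1 ?addr0 ?ffunE ?eqxx ?mul1r //.
by move=> z nzx; rewrite ffunE (negPf nzx) mul0r.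
Qed.

Lemma supp_sum S u : supp S u -> u = \sum_(x in S) u x *: ev x.
Proof.
move=> uS; rewrite {1}[u]ev_sum (bigID (mem S)) /= [X in _ + X]big1 ?addr0 //.
by move=> x /uS ->; rewrite scale0r.
Qed.

Lemma orth_supp S u w :
  supp S w -> (forall x, x \in S -> hform u (ev x) = 0) -> hform u w = 0.
Proof.
move=> /supp_sum -> orth; rewrite form_sumr big1 // => x xS.
by rewrite formZr orth ?mulr0.
Qed.

Lemma supp_ev S x : x \in S -> supp S (ev x).
Proof.
by move=> xS y; rewrite ffunE; case: eqP => // -> /negP.
Qed.

Lemma suppD S u w : supp S u -> supp S w -> supp S (u + w).
Proof. by move=> uS wS x xS; rewrite ffunE uS ?wS ?addr0. Qed.

Lemma suppZ S a u : supp S u -> supp S (a *: u).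
Proof. by move=> uS x xS; rewrite ffunE uS ?scaler0. Qed.

Lemma suppN S u : supp S u -> supp S (- u).
Proof. by move=> uS x xS; rewrite ffunE uS ?oppr0. Qed.

Lemma suppS S S' u : S \subset S' -> supp S u -> supp S' u.
Proof. by move=> /subsetP sS uS x xS'; apply: uS; apply: contra xS'; apply: sS. Qed.

Lemma supp_setT u : supp [set: T] u.
Proof. by move=> x; rewrite inE. Qed.

Definition orthopos S (us : seq V) : Prop :=
  (forall u, u \in us -> supp S u /\ 0 < hform u u) /\
  pairwise (fun u w => hform u w == 0) us.

(** For [S] the full vertex set this says that at least [k] eigenvalues are positive, see
    [sylvester]. *)
Definition Pge S k := exists2 us, size us = k & orthopos S us.

Lemma Pge_sub S S' k : S \subset S' -> Pge S k -> Pge S' k.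
Proof.
move=> sS [us su [us1 us2]]; exists us => //; split=> // u /us1[uS up].
by split=> //; apply: suppS uS.
Qed.

Lemma Pge_le S k k' : (k' <= k)%N -> Pge S k -> Pge S k'.
Proof.
move=> lek [us su [us1 us2]]; exists (take k' us); first by rewrite size_takel ?su.
split=> [u /mem_take/us1 //|].
by move: us2; rewrite -{1}(cat_take_drop k' us) pairwise_cat => /and3P[].
Qed.

Lemma orthopos_cat S us1 us2 :
  orthopos S us1 -> orthopos S us2 ->
  (forall u w, u \in us1 -> w \in us2 -> hform u w = 0) ->
  orthopos S (us1 ++ us2).
Proof.
move=> [p1 o1] [p2 o2] o12; split=> [u|].
  by rewrite mem_cat => /orP[/p1|/p2].
rewrite pairwise_cat o1 o2 !andbT; apply/allrelP => u w uS wS.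
by apply/eqP; apply: o12.
Qed.

(* An isotropic vector orthogonal to a positive family, but not to everything,
   spans with any witness a hyperbolic plane splitting off from the family. *)
Lemma Pge_hyperbolic S us n w :
  orthopos S us -> supp S n -> supp S w -> hform n n = 0 ->
  (forall u, u \in us -> hform u n = 0) -> hform w n != 0 ->
  Pge S (size us).+1.
Proof.
move=> [us1 us2] nS wS nn un wn.
have nw : hform n w != 0 by rewrite formC conjC_eq0.
(* Shifting along [n] makes the family orthogonal to [w]; no value of the form on it changes,
   because [n] is isotropic and orthogonal to the family. *)
pose g u := u - (hform u w / hform n w) *: n.
have gE u u' : u \in us -> u' \in us -> hform (g u) (g u') = hform u u'.
  move=> uus u'us; rewrite /g formDl !formDr formNl !formNr formZl !formZr un //.
  by rewrite formNl formZl nn [hform n u']formC un // conjC0 ?(mulr0, oppr0, subr0, addr0).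
have gn u : u \in us -> hform (g u) n = 0.
  by move=> uus; rewrite /g formDl formNl formZl nn mulr0 un // subr0.
have gw u : hform (g u) w = 0.
  by rewrite /g formDl formNl formZl mulfVK // subrr.
(* Adding the multiple of [n] below raises the form at [w] by [2 * tau], so [tau] is chosen to make
   it 1. *)
pose tau := (1 - hform w w) / 2.
pose w' := w + (tau / hform n w) *: n.
have taur : tau^* = tau.
  apply/CrealP; rewrite /tau; apply: realM; last by rewrite realV realn.
  by apply: realB; rewrite ?real1 ?form_real.
have w'w' : hform w' w' = 1.
  rewrite /w' formDl !formDr formZl !formZr formZl nn !mulr0 addr0 mulfVK //.
  rewrite rmorphM /= fmorphV /= taur -formC mulfVK // -addrA /tau -splitr.
  by rewrite addrC subrK.
exists (w' :: map g us); first by rewrite /= size_map.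
split=> [u|].
  rewrite inE => /orP[/eqP->|/mapP[u' u'us ->]].
    by rewrite w'w' ltr01; split=> //; apply: suppD => //; apply: suppZ.
  have [u'S u'p] := us1 _ u'us.
  rewrite gE //; split=> //.
  by apply: suppD => //; apply: suppN; apply: suppZ.
rewrite /=; apply/andP; split.
  apply/allP => _ /mapP[u uus ->]; rewrite formC conjC_eq0.
  by rewrite formDr formZr gw gn // mulr0 addr0.
rewrite pairwise_map; apply: (sub_in_pairwise (P := mem us)) (allss us) us2.
by move=> u u' uus u'us; rewrite /= gE.
Qed.

Lemma Pge_disjoint S1 S2 k1 k2 :
  (forall x y, x \in S1 -> y \in S2 -> h x y = 0) ->
  Pge S1 k1 -> Pge S2 k2 -> Pge (S1 :|: S2) (k1 + k2).
Proof.
move=> h0 [us1 <- o1] [us2 <- o2]; exists (us1 ++ us2); first by rewrite size_cat.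
have sub S us : orthopos S us -> S \subset S1 :|: S2 -> orthopos (S1 :|: S2) us.
  by move=> [p o] sS; split=> // u /p[uS up]; split=> //; apply: suppS uS.
apply: orthopos_cat; [exact: sub o1 (subsetUl _ _)|exact: sub o2 (subsetUr _ _)|].
move=> u w /o1.1[uS _] /o2.1[wS _].
apply: (orth_supp wS) => y yS; rewrite form_evr big1 // => x _.
have [xS|/uS ->] := boolP (x \in S1); last by rewrite mul0r.
by rewrite h0 // mulr0.
Qed.

(* A subspace of codimension at most [k] on which the form is nonpositive meets
   the span of any orthogonal positive family of more than [k] vectors. *)
Lemma orthopos_codim S k (l : 'I_k -> V) us :
  (forall u, supp S u -> (forall j, \sum_x l j x * u x = 0) -> hform u u <= 0) ->
  orthopos S us -> (size us <= k)%N.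
Proof.
move=> neg [us1 us2]; rewrite leqNgt; apply/negP => lek.
(* More rows than columns: a left kernel vector gives a nontrivial combination of the family killed
   by all the functionals. *)
pose M := \matrix_(i < size us, j < k) \sum_x l j x * us`_i x.
have kN0 : kermx M != 0.
  rewrite -mxrank_eq0 mxrank_ker -lt0n subn_gt0.
  exact: leq_ltn_trans (rank_leq_col _) lek.
have [c /sub_kermxP cM rN0] := rowV0Pn kN0.
pose u := \sum_i c 0 i *: us`_i.
have uS : supp S u.
  move=> x xS; rewrite sum_ffunE big1 // => j _.
  by rewrite ffunE (us1 _ (mem_nth 0 (ltn_ord j))).1 ?scaler0.
have /(neg _ uS) : forall j, \sum_x l j x * u x = 0.
  move=> j; move/matrixP: cM => /(_ 0 j); rewrite !mxE => cM.
  rewrite -[RHS]cM.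
  under [RHS]eq_bigr do rewrite mxE mulr_sumr.
  rewrite exchange_big; apply: eq_bigr => x _ /=.
  rewrite sum_ffunE mulr_sumr; apply: eq_bigr => m _.
  by rewrite ffunE /GRing.scale /= mulrCA.
apply/negP; rewrite lt_geF // /u form_suml.
have eqF m : hform (c 0 m *: us`_m) (\sum_i c 0 i *: us`_i) = `|c 0 m| ^+ 2 * hform us`_m us`_m.
  rewrite formZl form_sumr (bigD1 m) //= big1 ?addr0.
    by rewrite formZr mulrA normCK.
  move=> m' nm; rewrite formZr; suff -> : hform us`_m us`_m' = 0 by rewrite mulr0.
  move/(pairwiseP 0): us2 => us2.
  case: (ltngtP m m') nm => [ltm|ltm|/ord_inj -> /eqP//] _.
    by apply/eqP; apply: us2; rewrite ?inE.
  by apply/eqP; rewrite formC conjC_eq0; apply: us2; rewrite ?inE.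
under eq_bigr do rewrite eqF.
have [m cm] : exists m, c 0 m != 0.
  apply/existsP; apply: contraNT rN0 => /existsPn c0; apply/eqP/rowP => m.
  by rewrite [RHS]mxE; apply/eqP; rewrite -[_ == _]negbK c0.
have pos (j : 'I_(size us)) : 0 < hform us`_j us`_j by exact: (us1 _ (mem_nth 0 (ltn_ord j))).2.
rewrite (bigD1 m) //= ltr_pwDl //; first by rewrite mulr_gt0 // exprn_gt0 // normr_gt0.
by apply: sumr_ge0 => j _; rewrite mulr_ge0 ?exprn_ge0 // ltW.
Qed.

End HermitianForm.

(** * Sylvester's law of inertia *)

Lemma char_poly_conj (R : comUnitRingType) (n : nat) (P A : 'M[R]_n) :
  P \in unitmx -> char_poly (invmx P *m A *m P) = char_poly A.
Proof.
move=> uP; rewrite /char_poly /char_poly_mx.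
have -> : 'X%:M - map_mx polyC (invmx P *m A *m P) =
  map_mx polyC (invmx P) *m ('X%:M - map_mx polyC A) *m map_mx polyC P :> 'M[{poly R}]_n.
  rewrite mulmxBr mulmxBl !map_mxM; congr (_ - _).
  by rewrite scalar_mxC -mulmxA -map_mxM mulVmx // map_mx1 mulmx1.
rewrite !det_mulmx mulrAC -det_mulmx -map_mxM mulVmx // map_mx1 det1.
by rewrite mul1r.
Qed.

Section Sylvester.
Variables (T : finType) (h : T -> T -> algC).
Hypothesis hC : forall x y, h y x = (h x y)^*.

Notation V := {ffun T -> algC^o}.
Local Open Scope sesquilinear_scope.

Let H : 'M[algC]_#|T| := \matrix_(s, t) h (enum_val s) (enum_val t).
Let P := spectralmx H.
Let d := spectral_diag H.

Let herm : H \is hermsymmx.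
Proof.
by apply/is_hermitianmxP; rewrite expr0 scale1r; apply/matrixP => s t; rewrite !mxE hC.
Qed.

Let HE : H = P^t* *m diag_mx d *m P.
Proof.
rewrite -invmx_unitary ?spectral_unitarymx //.
exact/orthomx_spectralP/hermitian_normalmx.
Qed.

Let row_of (u : V) : 'rV[algC]_#|T| := \row_s u (enum_val s).

Let form_spectral (u w : V) : hform h u w =
  \sum_i (row_of u *m P^t* ) 0 i * d 0 i * ((row_of w *m P^t* ) 0 i)^*.
Proof.
transitivity ((row_of u *m H *m (row_of w)^t* ) 0 0).
  rewrite !mxE /hform exchange_big (reindex (@enum_val T T)) /=; last first.
    exact/onW_bij/enum_val_bij.
  apply: eq_bigr => t _; rewrite !mxE mulr_suml.
  rewrite (reindex (@enum_val T T)) /=; last exact/onW_bij/enum_val_bij.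
  by apply: eq_bigr => s _; rewrite !mxE.
rewrite HE !mulmxA.
have -> : row_of u *m P^t* *m diag_mx d *m P *m (row_of w)^t* =
          row_of u *m P^t* *m diag_mx d *m (row_of w *m P^t* )^t*.
  by rewrite -[in LHS]mulmxA trmx_mul map_mxM /= trmxCK.
rewrite [LHS]mxE; apply: eq_bigr => i _.
rewrite [X in X * _ = _]mxE [X in _ * X = _]mxE [X in (X)^*]mxE; congr (_ * _).
rewrite (bigD1 i) //= big1 ?addr0; first by rewrite !mxE eqxx mulr1n.
by move=> j nji; rewrite [diag_mx _ _ _]mxE (negPf nji) mulr0n mulr0.
Qed.

Let count_pos : count (fun x : algC => 0 < x) (eigenvalues H) = #|[pred i | 0 < d 0 i]|.
Proof.
have pE : perm_eq (eigenvalues H) [seq d 0 i | i <- enum 'I_#|T|].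
  rewrite /eigenvalues; case: closed_field_poly_normal => r /= rE.
  apply: prod_XsubC_eq; rewrite (monicP (char_poly_monic _)) scale1r in rE.
  rewrite -rE HE -invmx_unitary ?spectral_unitarymx //.
  rewrite char_poly_conj ?spectral_unit // char_poly_trig ?diag_mx_is_trig //.
  rewrite big_map big_enum; apply: eq_bigr => i _.
  by rewrite mxE eqxx mulr1n.
rewrite (permP pE) count_map [RHS]cardE -size_filter.
by rewrite /enum_mem -filter_predI; congr size; apply: eq_filter => i; rewrite !inE /= andbT.
Qed.

(** The eigenvectors of the positive eigenvalues form a positive family. Conversely, where the
    coordinates along them vanish only nonpositive eigenvalues contribute, so [orthopos_codim]
    bounds every positive family by their number. *)
Theorem sylvester k :
  (k <= count (fun x : algC => 0 < x)%R (eigenvalues H))%N <-> Pge h [set: T] k.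
Proof.
rewrite count_pos; set pos := [pred i | _]; split=> [lek|[us <- ous]]; last first.
  (* [l j] reads off the coordinate along the [j]-th positive eigenvector. *)
  pose l (j : 'I_#|pos|) : V := [ffun x => P^t* (enum_rank x) (enum_val j)].
  apply: (orthopos_codim hC (l := l)) ous => u _ l0.
  rewrite form_spectral; apply: sumr_le0 => i _.
  have [ipos|ineg] := boolP (i \in pos).
    suff -> : (row_of u *m P^t* ) 0 i = 0 by rewrite !mul0r.
    rewrite mxE -[RHS](l0 (enum_rank_in ipos i)).
    rewrite [RHS](reindex (@enum_val T T)) /=; last exact/onW_bij/enum_val_bij.
    by apply: eq_bigr => s _; rewrite [in RHS]ffunE [row_of _ _ _]mxE enum_valK enum_rankK_in //
      mulrC.
  rewrite mulrAC -normCK mulr_ge0_le0 ?exprn_ge0 //.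
  have dr : d 0 i \is Num.real by exact/mxOverP/hermitian_spectral_diag_real/herm.
  by move: ineg; rewrite inE -real_leNgt ?real0.
pose g i : V := [ffun x => P i (enum_rank x)].
have gE i j : hform h (g i) (g j) = d 0 i *+ (i == j).
  have rg m : row_of (g m) *m P^t* = row m 1%:M.
    have -> : row_of (g m) = row m P by apply/rowP => s; rewrite !mxE ffunE enum_valK.
    by rewrite -row_mul (unitarymxP (spectral_unitarymx H)).
  rewrite form_spectral !rg (bigD1 i) //= big1 ?addr0.
    by rewrite !mxE eqxx mul1r rmorph_nat eq_sym mulr_natr.
  by move=> m nmi; rewrite !mxE eq_sym (negPf nmi) !mul0r.
apply: (Pge_le lek); exists [seq g i | i <- enum pos]; first by rewrite size_map -cardE.
split=> [_ /mapP[i ipos ->]|].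
  by split; [exact: supp_setT|rewrite gE eqxx mulr1n; rewrite mem_enum in ipos].
rewrite pairwise_map; have := enum_uniq pos; rewrite uniq_pairwise.
by apply: sub_pairwise => i j /= nij; rewrite gE (negPf nij) mulr0n.
Qed.

End Sylvester.

(** * Fourth roots of unity *)

Definition unit4 (u : algC) : bool := u ^+ 4 == 1.

Lemma unit4_mem (u : algC) : unit4 u = (u \in [:: 1; -1; 'i; - 'i]).
Proof.
rewrite /unit4 -subr_eq0.
have -> : u ^+ 4 - 1 = (u - 1) * (u + 1) * (u - 'i) * (u + 'i).
  have i2 := sqrCi algC; have -> : u ^+ 4 - 1 = (u - 1) * (u + 1) * (u ^+ 2 - 'i ^+ 2).
    by rewrite i2; ring.
  by ring.
by rewrite !mulf_eq0 !subr_eq0 !addr_eq0 !inE !orbA.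
Qed.

Lemma unit4P (u : algC) : unit4 u -> [\/ u = 1, u = -1, u = 'i | u = - 'i].
Proof.
rewrite unit4_mem !inE => /or4P[] /eqP ->;
  [exact: Or41|exact: Or42|exact: Or43|exact: Or44].
Qed.

Lemma unit4_1 : unit4 1. Proof. by rewrite /unit4 expr1n. Qed.

Lemma unit4_i : unit4 'i. Proof. by rewrite unit4_mem !inE eqxx !orbT. Qed.

Lemma unit4N u : unit4 u -> unit4 (- u).
Proof. by rewrite /unit4 exprNn -signr_odd mul1r. Qed.

Lemma unit4M u w : unit4 u -> unit4 w -> unit4 (u * w).
Proof. by rewrite /unit4 exprMn => /eqP -> /eqP ->; rewrite mul1r. Qed.

Lemma unit4_neq0 u : unit4 u -> u != 0.
Proof. by apply: contraTneq => ->; rewrite /unit4 expr0n /= eq_sym oner_eq0. Qed.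

Lemma unit4V u : unit4 u -> unit4 u^-1.
Proof. by rewrite /unit4 exprVn => /eqP ->; rewrite invr1. Qed.

Lemma unit4_conj u : unit4 u -> u^* = u^-1.
Proof.
move=> uu; have u0 := unit4_neq0 uu; apply: (mulfI u0).
rewrite -normCK mulfV //; have : `|u| ^+ 4 = 1 by rewrite -normrX (eqP uu) normr1.
by move/eqP; rewrite pexpr_eq1 // => /eqP ->; rewrite expr1n.
Qed.

Lemma unit4C u : unit4 u -> unit4 u^*.
Proof. by move=> uu; rewrite unit4_conj // unit4V. Qed.

Lemma unit4_mulC u : unit4 u -> u * u^* = 1.
Proof. by move=> uu; rewrite unit4_conj // mulfV // unit4_neq0. Qed.

(** Two unit numbers have a unit sum only if their ratio is a primitive cube root of unity, which is
    not a fourth root of unity. *)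
Lemma unit4_sum3 (u v w : algC) : unit4 u -> unit4 v -> unit4 w -> u + v + w != 0.
Proof.
move=> uu uv uw; apply/eqP => s0.
have u0 := unit4_neq0 uu; have v0 := unit4_neq0 uv; have w0 := unit4_neq0 uw.
have ut : unit4 (v * w^*) by rewrite unit4M // unit4C.
have vw : v + w = - u by apply/eqP; rewrite -addr_eq0 addrC addrA s0.
have : (v + w) * (v + w)^* = 1 by rewrite vw rmorphN /= mulrNN unit4_mulC.
rewrite rmorphD /= mulrDl !mulrDr !unit4_mulC //.
have -> : w * v^* = (v * w^*)^* by rewrite rmorphM /= conjCK mulrC.
move=> E; have {}E : 1 + v * w^* + (v * w^*)^* = 0 by apply: (addIr 1); rewrite add0r -[RHS]E; ring.
move: E; case/unit4P: ut => ->; rewrite ?rmorphN /= ?conjC1 ?conjCi.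
- by have -> : 1 + 1 + 1 = 3 :> algC by [ring]; move/eqP; rewrite pnatr_eq0.
- by rewrite subrr add0r => /eqP; rewrite oppr_eq0 oner_eq0.
- by rewrite addrK => /eqP; rewrite oner_eq0.
- by rewrite opprK subrK => /eqP; rewrite oner_eq0.
Qed.

(** * Local obstructions to a single positive eigenvalue *)

Section Classification.
Variables (T : finType) (h : T -> T -> algC).
Hypothesis hC : forall x y, h y x = (h x y)^*.
Hypothesis hD : forall x, h x x = 0.
Hypothesis hU : forall x y, h x y != 0 -> unit4 (h x y).

Notation V := {ffun T -> algC^o}.
Notation form := (hform h).
Implicit Types (S : {set T}).

Let hsym x y : (h y x == 0) = (h x y == 0).
Proof. by rewrite hC conjC_eq0. Qed.

Let formDl := @formDl T h.
Let formZl := @formZl T h.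
Let formDr := @formDr T h hC.
Let formZr := @formZr T h hC.
Let formNl := @formNl T h.
Let formNr := @formNr T h hC.
Let formE := (formDl, formNl, formZl, formDr, formNr, formZr, form_ev).

(** For an edge [xy], the left eigenvector for the eigenvalue 1 of its 2-by-2 block. *)
Definition edge_vec x y : V := ev x + h x y *: ev y.

Lemma orthopos_edge S x y : x \in S -> y \in S -> h x y != 0 -> orthopos h S [:: edge_vec x y].
Proof.
move=> xS yS hxy; split=> // u; rewrite inE => /eqP ->; split.
  by apply: suppD; [|apply: suppZ]; apply: supp_ev.
rewrite /edge_vec !formE !hD [h y x]hC unit4_conj ?hU //.
by rewrite [X in 0 < X](_ : _ = 2) ?ltr0n //; field.
Qed.

Lemma Pge_edge S x y : x \in S -> y \in S -> h x y != 0 -> Pge h S 1.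
Proof. by move=> xS yS hxy; exists [:: edge_vec x y] => //; apply: orthopos_edge. Qed.

Lemma edge_vec_orth x y n : form n (ev x) = 0 -> form n (ev y) = 0 -> form (edge_vec x y) n = 0.
Proof.
move=> nx ny; rewrite (formC hC) formDr formZr nx ny mulr0 addr0.
exact: conjC0.
Qed.

(** The form in which [Pge_hyperbolic] is applied below: an isotropic vector orthogonal to both ends
    of an edge is orthogonal to its positive vector [edge_vec]. *)
Lemma Pge2_hyperbolic S x y n w :
  x \in S -> y \in S -> h x y != 0 -> supp S n -> w \in S -> form n n = 0 ->
  form n (ev x) = 0 -> form n (ev y) = 0 -> form n (ev w) != 0 -> Pge h S 2.
Proof.
move=> xS yS hxy nS wS nn nx ny nw.
apply: (Pge_hyperbolic hC (orthopos_edge xS yS hxy) nS (supp_ev wS) nn).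
  by move=> u; rewrite inE => /eqP ->; apply: edge_vec_orth.
by rewrite (formC hC) conjC_eq0.
Qed.

Section OnePositive.
Variable S : {set T}.
Hypothesis noiso : forall x, x \in S -> exists2 y, y \in S & h x y != 0.
Hypothesis P1 : ~ Pge h S 2.

(** If [xz] were an edge, [ev y] would be isotropic and orthogonal to that edge, but not to a
    neighbour of [y]. Hence nonadjacency is an equivalence relation on [S] and the underlying graph
    is complete multipartite there. *)
Lemma nonadj_trans x y z : x \in S -> y \in S -> z \in S ->
  h x y = 0 -> h y z = 0 -> h x z = 0.
Proof.
move=> xS yS zS xy yz; apply/eqP; apply: contra_notT P1 => hxz.
have [w wS hyw] := noiso yS.
apply: (Pge2_hyperbolic xS zS hxz (supp_ev yS) wS); rewrite ?form_ev //.
by rewrite hC xy conjC0.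
Qed.

(** The combination of [ev x] and [ev x'] that is orthogonal to [y] is isotropic and orthogonal to
    the edge [xy]. It must therefore be orthogonal to [y'] too, which makes the 2-by-2 minor
    vanish. *)
Lemma twin_minor x x' y y' : x \in S -> x' \in S -> y \in S -> y' \in S ->
  h x x' = 0 -> h x y * h x' y' = h x' y * h x y'.
Proof.
move=> xS x'S yS y'S xx'.
have x'x : h x' x = 0 by rewrite hC xx' conjC0.
have [xy|xy] := eqVneq (h x y) 0.
  by rewrite (nonadj_trans x'S xS yS x'x xy) xy !mul0r.
apply/eqP; apply: contra_notT P1 => neq.
pose n := h x' y *: ev x - h x y *: ev x'.
apply: (Pge2_hyperbolic xS yS xy (n := n) _ y'S); rewrite /n ?formE ?hD ?xx' ?x'x.
- by apply: suppD; [|apply: suppN]; apply: suppZ; apply: supp_ev.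
- by rewrite !(mulr0, subr0, oppr0).
- by rewrite !(mulr0, subr0).
- by rewrite mulrC subrr.
- by rewrite subr_eq0 eq_sym.
Qed.

Lemma twin x x' : x \in S -> x' \in S -> h x x' = 0 ->
  exists2 l, unit4 l & forall y, y \in S -> h x y = l * h x' y.
Proof.
move=> xS x'S xx'; have [y yS x'y] := noiso x'S.
have xy : h x y != 0.
  apply: contra x'y => /eqP; have x'x : h x' x = 0 by rewrite hC xx' conjC0.
  by move/(nonadj_trans x'S xS yS x'x) ->.
exists (h x y / h x' y) => [|y' y'S]; first by rewrite unit4M ?unit4V ?hU.
by rewrite mulrAC (twin_minor xS x'S yS y'S xx') mulrAC mulfV ?mul1r.
Qed.

Section Triangle.
Variables (x y z : T).
Hypotheses (xS : x \in S) (yS : y \in S) (zS : z \in S).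
Hypotheses (xy : h x y != 0) (yz : h y z != 0) (zx : h z x != 0).
Let tau := h x y * h y z * h z x.

Let ut : unit4 tau.
Proof. by rewrite !unit4M ?hU. Qed.

Let yxE : h y x = (h x y)^-1. Proof. by rewrite hC unit4_conj ?hU. Qed.
Let zyE : h z y = (h y z)^-1. Proof. by rewrite hC unit4_conj ?hU. Qed.
Let xzE : h x z = (h z x)^-1. Proof. by rewrite hC unit4_conj ?hU. Qed.

(** Up to switching, a triangle of value -1 has the matrix I - J, with eigenvalues 1, 1, -2. The
    vectors [u1] and [u2] are the switched (1, -1, 0) and (1, 1, -2), on which the form takes the
    values 2 and 6. *)
Lemma triangle_neqN1 : tau != -1.
Proof.
apply/eqP => tE; apply: P1.
have hzx : h z x = - (h x y * h y z)^-1.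
  by rewrite -[LHS](mulKf (mulf_neq0 xy yz)) -/tau tE mulrN1.
pose a := - h x y; pose b := - (h z x)^-1.
have aC : a^* = - (h x y)^-1 by rewrite rmorphN /= unit4_conj ?hU.
have bC : b^* = - h z x by rewrite rmorphN /= unit4_conj ?unit4V ?hU // invrK.
pose u1 : V := ev x - a *: ev y.
pose u2 : V := ev x + a *: ev y - 2 *: (b *: ev z).
have two : (2 : algC)^* = 2 by rewrite rmorph_nat.
exists [:: u1; u2] => //; split; last first.
  rewrite /= !andbT /u1 /u2 ?formE aC bC !hD ?yxE ?zyE ?xzE two ?hzx /a /b ?hzx.
  by apply/eqP; field; rewrite xy yz.
move=> u; rewrite !inE => /orP[] /eqP ->; split.
- by apply: suppD; [|apply: suppN; apply: suppZ]; apply: supp_ev.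
- rewrite /u1 ?formE aC !hD yxE /a [X in 0 < X](_ : _ = 2) ?ltr0n //.
  by field; rewrite xy.
- apply: suppD; last by apply: suppN; do 2! apply: suppZ; apply: supp_ev.
  by apply: suppD; [|apply: suppZ]; apply: supp_ev.
- rewrite /u2 ?formE aC bC !hD ?yxE ?zyE ?xzE two ?hzx /a /b ?hzx [X in 0 < X](_ : _ = 6) ?ltr0n //.
  by field; rewrite xy yz.
Qed.

(* A triangle of value [+-i] has determinant 0; its null vector is orthogonal to
   a common neighbour only if three fourth roots of unity sum to 0. *)
Lemma imaginary_triangle_nonadj w : w \in S -> tau != 1 ->
  [|| h w x == 0, h w y == 0 | h w z == 0].
Proof.
move=> wS t1; apply: contra_notT P1; rewrite !negb_or => /and3P[wx wy wz].
have xw : h x w != 0 by rewrite hsym.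
have yw : h y w != 0 by rewrite hsym.
have zw : h z w != 0 by rewrite hsym.
have tC : tau^* = - tau.
  case/unit4P: ut t1 triangle_neqN1 => ->; rewrite ?eqxx ?rmorphN //= conjCi //.
have t0 : tau != 0 by rewrite unit4_neq0.
have hzx : h z x = tau * (h x y * h y z)^-1 by rewrite /tau mulrAC mulfV ?mul1r // mulf_neq0.
have tV : tau^-1 = - tau by rewrite -unit4_conj.
have t2 : tau * tau = -1.
  by apply: (mulfI t0); rewrite mulrN1 -[RHS]tV; apply: (mulfI t0);
    rewrite mulfV // mulrA -expr2 -exprD (eqP ut).
pose n := - tau *: ev x + h x y *: ev y - (h z x)^-1 *: ev z : V.
have nS : supp S n.
  apply: suppD; last by apply: suppN; apply: suppZ; apply: supp_ev.
  by apply: suppD; apply: suppZ; apply: supp_ev.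
have nx : form n (ev x) = 0.
  by rewrite ?formE hD yxE mulr0 add0r mulfV // mulVf // subrr.
have ny : form n (ev y) = 0.
  rewrite ?formE hD zyE hzx mulr0 addr0 invfM invrK tV; field.
  by rewrite yz.
have nz : form n (ev z) = 0.
  rewrite ?formE hD xzE hzx mulr0 subr0 invfM invrK tV mulrA mulNr mulrN opprK t2.
  by ring.
apply: (Pge2_hyperbolic xS yS xy nS wS _ nx ny); last first.
  rewrite ?formE; apply: unit4_sum3; rewrite -?mulNr unit4M ?unit4N ?unit4V ?hU //.
  by rewrite !mulNr unit4N.
apply: (orth_supp hC (S := [set x; y; z])) => [v|v]; rewrite !inE.
  by rewrite !negb_or => /andP[/andP[vx vy] vz];
    rewrite !ffunE (negPf vx) (negPf vy) (negPf vz) !scaler0 subr0 addr0.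
by move=> /orP[/orP[]|] /eqP ->.
Qed.

End Triangle.
End OnePositive.
End Classification.

(** * Blow-ups and subspaces on which the form is nonpositive *)

Definition Kval k (i j : 'I_k) : algC := (i != j)%:R.

Definition C3val (i j : 'I_3) : algC :=
  if (j == i.+1 %% 3 :> nat)%N then 'i else if (i == j.+1 %% 3 :> nat)%N then - 'i else 0.

Lemma C3valC i j : C3val j i = (C3val i j)^*.
Proof.
rewrite /C3val.
by case: i j => [[|[|[|//]]] ?] [[|[|[|//]]] ?] /=; rewrite ?rmorphN /= ?conjC0 ?conjCi ?opprK.
Qed.

Section Blowup.
Variables (T : finType) (h : T -> T -> algC).
Hypothesis hC : forall x y, h y x = (h x y)^*.
Notation V := {ffun T -> algC^o}.
Notation form := (hform h).
Implicit Types (S : {set T}).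

(* On [S], [h] is the blow-up of the matrix [m] along the colouring [c], switched
   by [q]; [r] picks one vertex of each colour. *)
Definition blowup S k (m : 'I_k -> 'I_k -> algC) (q : T -> algC) (c : T -> 'I_k)
    (r : 'I_k -> T) : Prop :=
  [/\ forall x, unit4 (q x),
      forall x y, x \in S -> y \in S -> h x y = q x * (q y)^* * m (c x) (c y)
    & forall j, r j \in S /\ c (r j) = j].

(* The form is nonpositive on a subspace of codimension [k] of the functions
   supported on [S]. *)
Definition codim_le S k := exists l : 'I_k -> V,
  forall u, supp S u -> (forall j, \sum_x l j x * u x = 0) -> form u u <= 0.

Lemma codim_le_Pge S k : codim_le S k -> ~ Pge h S k.+1.
Proof.
move=> [l lP] [us su ous]; have := orthopos_codim hC lP ous.
by rewrite su ltnn.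
Qed.

Definition restr S (u : V) : V := [ffun x => if x \in S then u x else 0].

Lemma supp_restr S u : supp S (restr S u).
Proof. by move=> x /negPf xS; rewrite ffunE xS. Qed.

Lemma sum_restr S (l u : V) : \sum_x l x * restr S u x = \sum_x restr S l x * u x.
Proof. by apply: eq_bigr => x _; rewrite !ffunE; case: ifP; rewrite ?mulr0 ?mul0r. Qed.

Lemma form_supp0 S1 S2 u w : supp S1 u -> supp S2 w ->
  (forall x y, x \in S1 -> y \in S2 -> h x y = 0) -> form u w = 0.
Proof.
move=> uS wS h0; apply: (orth_supp hC wS) => y yS; rewrite form_evr big1 // => x _.
by have [xS|/uS ->] := boolP (x \in S1); rewrite ?mul0r // h0 // mulr0.
Qed.

(** Splitting [u] into [u1], [u0], [u2] over the differences and the intersection, the form at [u]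
    is the sum of the forms at [u1 + u0] and [u0 + u2]: the pair [u1], [u2] does not interact, and
    counting [u0] twice adds 0. *)
Lemma codim_le_union S1 S2 k1 k2 :
  (forall x y, x \in S1 :\: S2 -> y \in S2 :\: S1 -> h x y = 0) ->
  (forall x y, x \in S1 :&: S2 -> y \in S1 :&: S2 -> h x y = 0) ->
  codim_le S1 k1 -> codim_le S2 k2 -> codim_le (S1 :|: S2) (k1 + k2).
Proof.
move=> h12 h0 [l1 lP1] [l2 lP2].
exists (fun j => match split j with inl i => restr S1 (l1 i) | inr i => restr S2 (l2 i) end).
move=> u uS l0.
pose u1 := restr (S1 :\: S2) u; pose u0 := restr (S1 :&: S2) u; pose u2 := restr (S2 :\: S1) u.
have uE : u = u1 + u0 + u2.
  apply/ffunP => x; rewrite !ffunE !inE; have := uS x; rewrite inE.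
  by case: (x \in S1); case: (x \in S2) => /= H; rewrite ?addr0 ?add0r // H.
have u10 : u1 + u0 = restr S1 u.
  by apply/ffunP => x; rewrite !ffunE !inE; case: (x \in S1); case: (x \in S2);
    rewrite /= ?addr0 ?add0r.
have u02 : u0 + u2 = restr S2 u.
  by apply/ffunP => x; rewrite !ffunE !inE; case: (x \in S1); case: (x \in S2);
    rewrite /= ?addr0 ?add0r.
have f12 : form u1 u2 = 0 by apply: form_supp0 h12; apply: supp_restr.
have f00 : form u0 u0 = 0 by apply: form_supp0 h0; apply: supp_restr.
have f21 : form u2 u1 = 0 by rewrite (formC hC) f12 conjC0.
have -> : form u u = form (u1 + u0) (u1 + u0) + form (u0 + u2) (u0 + u2).
  rewrite {1 2}uE !(formDl, formDr hC) f12 f21 f00; ring.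
rewrite u10 u02 -[leRHS]addr0 lerD //.
- apply: lP1; first exact: supp_restr.
  move=> j; rewrite sum_restr; have := l0 (lshift _ j).
  by case: (split_ordP (lshift k2 j)) => i => [/lshift_inj <-|/eqP]; rewrite ?eq_lrshift.
- apply: lP2; first exact: supp_restr.
  move=> j; rewrite sum_restr; have := l0 (rshift _ j).
  by case: (split_ordP (rshift k1 j)) => i => [/eqP|/rshift_inj <-]; rewrite ?eq_rlshift.
Qed.

(* [z] spans a complement of the functions supported on [W], orthogonal to them. *)
Lemma codim_le_ext (W : {set T}) v (z : V) k : v \notin W -> supp (v |: W) z -> z v = 1 ->
  (forall x, x \in W -> form z (ev x) = 0) -> form z z <= 0 ->
  codim_le W k -> codim_le (v |: W) k.
Proof.
move=> vW zS zv zW zz [l lP].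
(* This is [l j] applied to the component [u - u v *: z] of [u] in [W], written as a functional of
   [u]. *)
exists (fun j => restr W (l j) - (\sum_x l j x * restr W z x) *: ev v) => u uS l0.
pose w := u - u v *: z.
have wS : supp W w.
  move=> x xW; rewrite !ffunE; have [->|xv] := eqVneq x v.
    by rewrite zv /GRing.scale /= mulr1 subrr.
  have xS : x \notin v |: W by rewrite !inE negb_or xv.
  by rewrite (uS x xS) (zS x xS) scaler0 subr0.
have uE : u = w + u v *: z by rewrite /w subrK.
have zw : form z w = 0 by apply: (orth_supp hC wS).
have wz : form w z = 0 by rewrite (formC hC) zw conjC0.
have -> : form u u = form w w + `|u v| ^+ 2 * form z z.
  have E (a : algC) (s t : V) : form s t = 0 -> form t s = 0 ->
      form (s + a *: t) (s + a *: t) = form s s + `|a| ^+ 2 * form t t.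
    by move=> st ts; rewrite !(formDl, formDr hC, formZl, formZr hC) st ts normCK; ring.
  by rewrite {1 2}uE E.
rewrite -[leRHS]addr0 lerD //; last by rewrite mulr_ge0_le0 ?exprn_ge0.
apply: lP => // j; rewrite -[RHS](l0 j).
have -> : \sum_x l j x * w x = \sum_x l j x * restr W w x.
  apply: eq_bigr => x _; rewrite [restr _ _ _]ffunE; case: ifP => // /negbT xW.
  by rewrite wS.
under eq_bigr => x _ do rewrite [restr _ _ _]ffunE.
under [RHS]eq_bigr => x _.
  rewrite ffunE [restr _ _ _]ffunE [(- _ : V) x]ffunE [(_ *: _ : V) x]ffunE mulrBl.
  over.
rewrite /= sumrB [X in _ = _ - X](bigD1 v) //= [X in _ = _ - (_ + X)]big1 ?addr0; last first.
  by move=> x xv; rewrite !ffunE (negPf xv) scaler0 mul0r.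
rewrite ffunE eqxx [_ *: _]mulr1 mulr_suml -sumrB; apply: eq_bigr => x _.
rewrite !ffunE /GRing.scale /=; case: ifP => _; first by ring.
by rewrite !mulr0 !mul0r subr0.
Qed.

Section Form.
Variables (S : {set T}) (k : nat) (m : 'I_k -> 'I_k -> algC).
Variables (q : T -> algC) (c : T -> 'I_k) (r : 'I_k -> T).
Hypothesis B : blowup S m q c r.

Definition colsum (u : V) (i : 'I_k) : algC := \sum_(x | c x == i) u x * q x.

Lemma form_blowup u : supp S u ->
  form u u = \sum_i \sum_j colsum u i * (colsum u j)^* * m i j.
Proof.
move=> uS; case: B => _ hE _.
have -> : form u u = \sum_x \sum_y u x * q x * (u y * q y)^* * m (c x) (c y).
  apply: eq_bigr => x _; apply: eq_bigr => y _; rewrite rmorphM /=.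
  have [xS|/uS ->] := boolP (x \in S); last by rewrite !mul0r.
  have [yS|/uS ->] := boolP (y \in S); last by rewrite conjC0 !(mul0r, mulr0).
  by rewrite hE //; ring.
rewrite (partition_big c xpredT) //=; apply: eq_bigr => i _.
transitivity (\sum_j \sum_(x | c x == i) \sum_(y | c y == j) u x * q x * (u y * q y)^* * m i j).
  rewrite [RHS]exchange_big; apply: eq_bigr => x /eqP cx.
  rewrite (partition_big c xpredT) //=; apply: eq_bigr => j _.
  by apply: eq_bigr => y /eqP cy; rewrite cx cy.
apply: eq_bigr => j _; rewrite /colsum rmorph_sum !mulr_suml; apply: eq_bigr => x _.
by rewrite mulr_sumr mulr_suml.
Qed.

Lemma sum_colsum (u : V) : \sum_i colsum u i = \sum_x q x * u x.
Proof.
rewrite [RHS](partition_big c xpredT) //=; apply: eq_bigr => i _.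
by apply: eq_bigr => x _; rewrite mulrC.
Qed.

End Form.

(** On the hyperplane where the colour sums add up to 0, the matrix J - I acts as -I. *)
Lemma codim_le_pos S k q c r : @blowup S k (@Kval k) q c r -> codim_le S 1.
Proof.
move=> B; exists (fun _ => [ffun x => q x]) => u uS l0.
have s0 : \sum_i colsum q c u i = 0.
  rewrite sum_colsum -[RHS](l0 0); apply: eq_bigr => x _.
  by rewrite ffunE.
rewrite (form_blowup B uS) (_ : \sum_i _ = \sum_i (- `|colsum q c u i| ^+ 2)).
  by apply: sumr_le0 => i _; rewrite oppr_le0 exprn_ge0.
apply: eq_bigr => i _; rewrite normCK -mulrN.
have -> : - (colsum q c u i)^* = \sum_(j | j != i) (colsum q c u j)^*.
  have : \sum_j (colsum q c u j)^* = 0 by rewrite -rmorph_sum /= s0 conjC0.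
  by rewrite (bigD1 i) //= => /eqP; rewrite addr_eq0 => /eqP ->; rewrite opprK.
rewrite mulr_sumr [RHS]big_mkcond; apply: eq_bigr => j _.
by rewrite /Kval eq_sym; case: eqP; rewrite ?mulr0 ?mulr1.
Qed.

(* [S1 = S2] is a hyperplane containing the null vector [(1,1,1)] and the
   isotropic vector [(1,0,0)] of [C3val]. *)
Lemma codim_le_C3 S q c r : @blowup S 3 C3val q c r -> codim_le S 1.
Proof.
pose o1 : 'I_3 := inord 1; pose o2 : 'I_3 := inord 2.
move=> B; exists (fun _ => [ffun x => q x * ((c x == o1)%:R - (c x == o2)%:R)]) => u uS l0.
have E : colsum q c u o1 = colsum q c u o2.
  apply/eqP; rewrite -subr_eq0 /colsum big_mkcond [X in _ - X]big_mkcond -sumrB.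
  rewrite -[X in _ == X](l0 0); apply/eqP; apply: eq_bigr => x _; rewrite ffunE.
  by case: eqP; case: eqP => /= _ _; ring.
rewrite (form_blowup B uS) !big_ord_recl !big_ord0.
set a0 := colsum q c u 0; move: E; set a1 := colsum q c u o1 => E.
have -> : lift 0 (0 : 'I_2) = o1 by apply: val_inj; rewrite /= inordK.
have -> : lift 0 (lift 0 (0 : 'I_1)) = o2 by apply: val_inj; rewrite /= inordK.
rewrite -E -/a1 /C3val /= !inordK //= [X in X <= 0](_ : _ = 0) //; ring.
Qed.

End Blowup.

(** * Forms with one positive eigenvalue *)

Lemma colouring (T : finType) (S : {set T}) (e : rel T) (x0 : T) : x0 \in S ->
  (forall x, x \in S -> e x x) ->
  (forall x y, x \in S -> y \in S -> e x y -> e y x) ->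
  (forall x y z, x \in S -> y \in S -> z \in S -> e x y -> e y z -> e x z) ->
  exists k (c : T -> 'I_k) (r : 'I_k -> T),
    (forall j, r j \in S /\ c (r j) = j) /\
    (forall x y, x \in S -> y \in S -> (c x == c y) = e x y).
Proof.
move=> x0S er es et.
(* The pick depends only on the class of [x], so the chosen elements represent the classes and their
   ranks serve as colours; [x0] is only a default. *)
pose rep x := odflt x0 [pick y in S | e x y].
have repP x : x \in S -> rep x \in S /\ e x (rep x).
  move=> xS; rewrite /rep; case: pickP => [y /andP[yS xy] //|/(_ x)].
  by rewrite xS er.
have repE x y : x \in S -> y \in S -> e x y -> rep x = rep y.
  move=> xS yS xy; rewrite /rep; congr odflt; apply: eq_pick => z /=.
  have [zS|//] := boolP (z \in S); apply/idP/idP; apply: et => //; exact: es.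
have repK x : x \in S -> rep (rep x) = rep x.
  by move=> xS; have [rS xr] := repP x xS; apply/esym/repE.
pose R := rep @: S.
have R0 : rep x0 \in R by apply: imset_f.
exists #|R|, (fun x => enum_rank_in R0 (rep x)), (fun j => enum_val j); split.
  move=> j; have /imsetP[x xS E] := enum_valP j; rewrite E.
  by split; [have [] := repP x xS|rewrite repK // -E enum_valK_in].
move=> x y xS yS; apply/eqP/idP => [E|/repE -> //].
have rxy : rep x = rep y by apply: (can_in_inj (enum_rankK_in R0)) E; apply: imset_f.
have [rxS xr] := repP x xS; have [ryS yr] := repP y yS.
by apply: (et x (rep x) y) => //; apply: es => //; rewrite rxy.
Qed.

Lemma ord_neq_gt1 k (i j : 'I_k) : i != j -> (1 < k)%N.
Proof. by case: k i j => [|[|k]] [i ?] [j ?] //; rewrite -val_eqE /=; lia. Qed.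

Section Classify.
Variables (T : finType) (h : T -> T -> algC).
Hypothesis hC : forall x y, h y x = (h x y)^*.
Hypothesis hD : forall x, h x x = 0.
Hypothesis hU : forall x y, h x y != 0 -> unit4 (h x y).
Notation V := {ffun T -> algC^o}.
Notation form := (hform h).

Let hsym x y : (h y x == 0) = (h x y == 0).
Proof. by rewrite hC conjC_eq0. Qed.

Section OnePositive.
Variables (S : {set T}) (x0 : T).
Hypothesis x0S : x0 \in S.
Hypothesis noiso : forall x, x \in S -> exists2 y, y \in S & h x y != 0.
Hypothesis P1 : ~ Pge h S 2.

(** By [imaginary_triangle_nonadj] each vertex of [S] misses a corner of the triangle, and by [twin]
    its row is then proportional to the row of that corner. The value of the cycle 0, 1, 2 in
    [C3val] is the cube of the imaginary unit, hence the hypothesis on the value. *)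
Lemma classify_triangle x y z : x \in S -> y \in S -> z \in S ->
  h x y != 0 -> h y z != 0 -> h z x != 0 -> h x y * h y z * h z x = - 'i ->
  exists q c r, @blowup T h S 3 C3val q c r.
Proof.
move=> xS yS zS xy yz zx tE.
pose t (j : 'I_3) := nth x [:: x; y; z] j.
(* The first corner gets 1, and the edges [xy] and [zx] determine the other two factors; the edge
   [yz] then agrees because the triangle has the right value. *)
pose q0 (j : 'I_3) : algC := nth 0 [:: 1; 'i * (h x y)^*; - 'i * h z x] j.
have tS j : t j \in S by case: j => [[|[|[|//]]] ?].
have u0 j : unit4 (q0 j).
  by case: j => [[|[|[|//]]] ?]; rewrite /q0 /= ?unit4_1 // unit4M ?unit4N ?unit4_i ?unit4C ?hU.
have i2 : 'i * 'i = -1 :> algC by rewrite -expr2 sqrCi.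
have hyz : h y z = - 'i * (h x y * h z x)^-1.
  by rewrite -tE; field; rewrite xy zx.
have h0le (i j : 'I_3) : (i <= j)%N -> h (t i) (t j) = q0 i * (q0 j)^* * C3val i j.
  case: i j => [[|[|[|//]]] ?] [[|[|[|//]]] ?] //= _; rewrite /t /q0 /C3val /=;
  rewrite ?hD ?mulr0 ?rmorphM ?rmorphN /= ?conjCK ?conjCi ?conjC1 ?opprK //.
  - by rewrite mul1r mulrAC mulNr i2 opprK mul1r.
  - by rewrite [h x z]hC mul1r mulrAC mulrN i2 opprK mul1r.
  - rewrite hyz !(unit4_conj (hU _)) // invfM.
    have -> : 'i / h x y * ('i / h z x) * 'i = 'i * 'i * 'i / h x y / h z x by ring.
    by rewrite i2 mulN1r mulrA.
have h0 i j : h (t i) (t j) = q0 i * (q0 j)^* * C3val i j.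
  case: (leqP i j) => [/h0le //|/ltnW/h0le E].
  by rewrite hC E !rmorphM /= conjCK -C3valC; ring.
(* [F w] consists of the corner that [w] copies and the factor between the two rows. Outside [S] the
   pair (0, 1) keeps the switching a unit everywhere. *)
have [F FP] : exists F : T -> 'I_3 * algC, forall w, unit4 (F w).2 /\
    (w \in S -> forall s, s \in S -> h w s = (F w).2 * h (t (F w).1) s).
  apply: (@fin_all_exists T (fun=> 'I_3 * algC)%type (fun w jl => unit4 jl.2 /\
    (w \in S -> forall s, s \in S -> h w s = jl.2 * h (t jl.1) s))) => w.
  have [wS|] := boolP (w \in S); last by exists (0, 1); split=> //; apply: unit4_1.
  have [j wj] : exists j, h w (t j) = 0.
    have tn1 : h x y * h y z * h z x != 1.
      rewrite tE; apply/eqP => E; have : (- 'i) * (- 'i) = 1 :> algC by rewrite E mulr1.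
      by rewrite mulrNN i2 => /eqP; rewrite -subr_eq0 -opprD oppr_eq0 (pnatr_eq0 _ 2).
    have := imaginary_triangle_nonadj hC hD hU P1 xS yS zS xy yz zx wS tn1.
    by case/or3P => /eqP E; [exists 0|exists (inord 1)|exists (inord 2)]; rewrite /t ?inordK.
  have [l ul lP] := twin hC hD hU noiso P1 wS (tS j) wj.
  by exists (j, l); split.
exists (fun w => (F w).2 * q0 (F w).1), (fun w => (F w).1), t; split.
- by move=> w; rewrite unit4M //; have [] := FP w.
- move=> w w' wS w'S.
  rewrite (FP w).2 // hC (FP w').2 // rmorphM /= -hC h0 rmorphM /=; ring.
(* A corner assigned to another corner would have a nonzero diagonal entry. *)
- move=> j; split=> //; apply/eqP; apply/negPn/negP => neq.
  have /eqP := (FP (t j)).2 (tS j) (t j) (tS j); rewrite hD h0 eq_sym.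
  have [uF _] := FP (t j); apply/negP; rewrite !mulf_neq0 ?conjC_eq0 ?unit4_neq0 //.
  move: (F (t j)).1 neq {uF} => i; case: i j => [[|[|[|//]]] ?] [[|[|[|//]]] ?] //= _;
  by rewrite /C3val /= ?unit4N ?unit4_i.
Qed.

(** Switching by the column of [x0] turns the edges at [x0] into 1, and triangles of value 1 through
    [x0] do the same for edges between its neighbours. A vertex not adjacent to [x0] is switched by
    the factor between its row and that of [x0]. *)
Lemma classify_positive :
  (forall x y z, x \in S -> y \in S -> z \in S ->
     h x y != 0 -> h y z != 0 -> h z x != 0 -> h x y * h y z * h z x = 1) ->
  exists k q c r, (1 < k)%N /\ @blowup T h S k (@Kval k) q c r.
Proof.
move=> tri.
have [q qP] : exists q : T -> algC, forall y, unit4 (q y) /\ (y \in S ->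
    (h y x0 != 0 -> q y = h y x0) /\
    (h y x0 = 0 -> forall w, w \in S -> h y w = q y * h x0 w)).
  apply: (@fin_all_exists T (fun=> algC) (fun y q => unit4 q /\ (y \in S ->
    (h y x0 != 0 -> q = h y x0) /\
    (h y x0 = 0 -> forall w, w \in S -> h y w = q * h x0 w)))) => y.
  have [yS|] := boolP (y \in S); last by exists 1; split=> //; apply: unit4_1.
  have [y0|y0] := eqVneq (h y x0) 0; last first.
    by exists (h y x0); split=> [|_]; [exact: hU|split=> // E; rewrite E eqxx in y0].
  by have [l ul lP] := twin hC hD hU noiso P1 yS x0S y0; exists l; split=> // _; split=> //;
    rewrite eqxx.
have nt x y z := nonadj_trans hC hD hU noiso P1 (x := x) (y := y) (z := z).
have [k [c [r [rP cP]]]] : exists k (c : T -> 'I_k) (r : 'I_k -> T),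
    (forall j, r j \in S /\ c (r j) = j) /\
    (forall x y, x \in S -> y \in S -> (c x == c y) = (h x y == 0)).
  apply: (colouring x0S) => [x _|x y _ _|x y z xS yS zS /eqP xy /eqP yz].
  - by rewrite hD.
  - by rewrite hsym.
  - by apply/eqP; apply: nt yz.
have x0N w : w \in S -> (h x0 w == 0) = (h w x0 == 0) by rewrite hsym.
exists k, q, c, r; split.
  have [y yS x0y] := noiso x0S; apply: (@ord_neq_gt1 _ (c x0) (c y)).
  by rewrite cP.
split=> // [y|x y xS yS]; first by have [] := qP y.
rewrite /Kval cP //; have [->|xy] := eqVneq (h x y) 0; first by rewrite mulr0.
rewrite mulr1; have [_ /(_ xS)[qx1 qx0]] := qP x; have [_ /(_ yS)[qy1 qy0]] := qP y.
have [x00|x01] := eqVneq (h x x0) 0.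
  have [y00|y01] := eqVneq (h y x0) 0.
    by case/eqP: xy; apply: (nt x x0 y) => //; rewrite hC y00 conjC0.
  by rewrite qx0 // qy1 // -hC.
have [y00|y01] := eqVneq (h y x0) 0.
  by rewrite hC qy0 // qx1 // rmorphM /= -hC mulrC.
have := tri x y x0 xS yS x0S xy y01; rewrite hsym => /(_ x01) E.
rewrite qx1 // qy1 // !(unit4_conj (hU _)) //.
have x0xE : h x0 x = (h x x0)^-1 by rewrite hC unit4_conj ?hU.
rewrite x0xE in E; apply: (mulIf y01); rewrite mulfVK //.
by apply: (mulIf (invr_neq0 x01)); rewrite E mulfV.
Qed.

(** A triangle whose value is not 1 has an imaginary value, and traversing it backwards conjugates
    that value, so it may be taken to be the one required by [classify_triangle]. *)
Theorem classify :
  (exists k q c r, (1 < k)%N /\ @blowup T h S k (@Kval k) q c r) \/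
  (exists q c r, @blowup T h S 3 C3val q c r).
Proof.
pose P x y z := [&& x \in S, y \in S, z \in S, h x y != 0, h y z != 0, h z x != 0
                & h x y * h y z * h z x != 1].
case: (boolP [exists x, exists y, exists z, P x y z]); last first.
  move/existsPn => nP; left; apply: classify_positive => x y z xS yS zS xy yz zx.
  have /existsPn/(_ y)/existsPn/(_ z) := nP x.
  by rewrite /P xS yS zS xy yz zx /= negbK => /eqP.
case/existsP=> x /existsP[y /existsP[z /and5P[xS yS zS xy /and3P[yz zx t1]]]]; right.
have tN := triangle_neqN1 hC hD hU P1 xS yS zS xy yz zx.
have ut : unit4 (h x y * h y z * h z x) by rewrite !unit4M ?hU.
case/unit4P: (ut) => E; [by rewrite E eqxx in t1|by rewrite E eqxx in tN| |exact:
  classify_triangle E].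
apply: (@classify_triangle x z y); rewrite ?(hsym z x, hsym y z, hsym x y) //.
rewrite [h x z]hC [h z y]hC [h y x]hC -!rmorphM /= -conjCi; congr (_^*).
by rewrite -E; ring.
Qed.

End OnePositive.
End Classify.

(** * The cut vertex *)

Section CutVertex.
Variables (T : finType) (h : T -> T -> algC).
Hypothesis hC : forall x y, h y x = (h x y)^*.
Hypothesis hD : forall x, h x x = 0.
Hypothesis hU : forall x y, h x y != 0 -> unit4 (h x y).
Notation V := {ffun T -> algC^o}.
Notation form := (hform h).

(* [y] is the orthogonal projection of [v] onto the functions supported on [A]. *)
Definition proj_on (A : {set T}) (v : T) (y : V) : Prop :=
  supp A y /\ forall x, x \in A -> form y (ev x) = h v x.

Lemma proj_on_form A v y : proj_on A v y -> form y (ev v) = form y y.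
Proof.
move=> [yA yP]; have : form (ev v - y) y = 0.
  apply: (orth_supp hC yA) => x xA.
  by rewrite formDl formNl form_ev yP // subrr.
move/eqP; rewrite formDl formNl subr_eq0 => /eqP E.
by rewrite (formC hC) E -(formC hC).
Qed.

Lemma proj_on_real A v y : proj_on A v y -> form y (ev v) \is Num.real.
Proof. by move/proj_on_form ->; apply: form_real. Qed.

Section Projection.
Variables (A : {set T}) (v : T) (k : nat) (q : T -> algC) (c : T -> 'I_k) (r : 'I_k -> T).
Hypothesis k1 : (1 < k)%N.
Hypothesis bl : blowup h A (@Kval k) q c r.
Variable b : 'I_k -> algC.
Hypothesis hb : forall x, x \in A -> h v x = b (c x) * (q x)^*.

(* The value of the form at the projection of [v], see [proj_on_pos]. *)
Definition fval k (b : 'I_k -> algC) : algC :=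
  `|\sum_j b j| ^+ 2 / (k.-1)%:R - \sum_j `|b j| ^+ 2.

(** As J - I has the inverse J / (k - 1) - I, the coefficients of the projection are
    [Y j = s / (k - 1) - b j]. One representative per part carries them, since vertices of a part
    act alike up to switching. *)
Lemma proj_on_pos : exists2 y, proj_on A v y & form y (ev v) = fval b.
Proof.
case: bl => uq hE rP; set s := \sum_j b j.
have k0 : (k.-1)%:R != 0 :> algC by rewrite pnatr_eq0; case: (k) k1 => [|[]].
pose Y j := s / (k.-1)%:R - b j.
have sY : \sum_j Y j = s / (k.-1)%:R.
  rewrite sumrB sumr_const card_ord -/s -[X in _ *+ X](prednK (ltnW k1)) mulrSr.
  by rewrite -[X in X + _ - _]mulr_natr mulfVK // addrAC subrr add0r.
exists (\sum_j (Y j * (q (r j))^*) *: ev (r j)).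
  split=> [x xA|x xA].
    rewrite sum_ffunE big1 // => j _; rewrite !ffunE.
    case: eqP => [E|_]; last by rewrite scaler0.
    by rewrite E (rP j).1 in xA.
  rewrite form_suml (hb xA).
  transitivity ((\sum_(j | j != c x) Y j) * (q x)^*).
    rewrite mulr_suml [RHS]big_mkcond; apply: eq_bigr => j _.
    rewrite formZl form_ev hE ?(rP j).1 // (rP j).2 /Kval; case: eqP => _; last first.
      have := unit4_mulC (uq (r j)); rewrite mulrC => qq.
      by rewrite mulr1 -mulrA [_^* * _]mulrA qq mul1r.
    by rewrite !mulr0.
  congr (_ * _); apply: (addrI (Y (c x))).
  by rewrite [RHS]subrK -[RHS]sY [RHS](bigD1 (c x)).
rewrite form_suml /fval -/s normCK.
transitivity (\sum_j Y j * (b j)^*).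
  apply: eq_bigr => j _; rewrite formZl form_ev hC hb ?(rP j).1 // (rP j).2 rmorphM /= conjCK.
  rewrite -mulrA; congr (_ * _).
  by rewrite mulrCA [_^* * q _]mulrC unit4_mulC ?mulr1.
under eq_bigr => j _ do rewrite mulrBl -normCK.
by rewrite sumrB -mulr_sumr -rmorph_sum /= mulrAC.
Qed.

(** The residual [ev v - y] is orthogonal to [A] and the form at it is [- fval b], so adjoining it
    adds no positive direction. *)
Lemma codim_le_proj : v \notin A -> 0 <= fval b -> codim_le h (v |: A) 1.
Proof.
move=> vA f0; have [y yP yE] := proj_on_pos; have [yA yx] := yP.
have yv : y v = 0 by apply: yA.
apply: (codim_le_ext hC vA (z := ev v - y)); last exact: codim_le_pos bl.
- apply: suppD; first by apply: supp_ev; rewrite !inE eqxx.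
  by apply/suppN/(suppS _ yA); apply: subsetUr.
- by rewrite !ffunE eqxx yv subr0.
- by move=> x xA; rewrite formDl formNl form_ev yx // subrr.
- have orth : form (ev v - y) y = 0.
    by apply: (orth_supp hC yA) => x xA; rewrite formDl formNl form_ev yx // subrr.
  rewrite (formDr hC) (formNr hC) orth oppr0 addr0 formDl formNl form_ev hD yE.
  by rewrite add0r oppr_le0.
Qed.

End Projection.

Section TwoSides.
Variables (A B : {set T}) (v : T).
Hypothesis AB : forall x y, x \in A -> y \in B -> h x y = 0.

Let BA x y : x \in B -> y \in A -> h x y = 0.
Proof. by move=> xB yA'; rewrite hC AB // conjC0. Qed.

Section Edges.
Variables (a1 a2 b1 b2 : T).
Hypotheses (a1A : a1 \in A) (a2A : a2 \in A) (a12 : h a1 a2 != 0).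
Hypotheses (b1B : b1 \in B) (b2B : b2 \in B) (b12 : h b1 b2 != 0).

Let us := [:: edge_vec h a1 a2; edge_vec h b1 b2].

Lemma orthopos_edges : orthopos h [set: T] us.
Proof.
have o1 := orthopos_edge hC hD hU a1A a2A a12.
have o2 := orthopos_edge hC hD hU b1B b2B b12.
have sA := (o1.1 _ (mem_head _ _)).1; have sB := (o2.1 _ (mem_head _ _)).1.
apply: (@orthopos_cat _ _ _ [:: _] [:: _]).
- by apply: orthopos_edge; rewrite ?inE.
- by apply: orthopos_edge; rewrite ?inE.
- by move=> u w; rewrite !inE => /eqP -> /eqP ->; apply: (form_supp0 hC sA sB AB).
Qed.

Lemma side_Pge2 : Pge h A 2 -> Pge h [set: T] 3.
Proof.
move=> PA; apply: (Pge_sub (subsetT (A :|: B))).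
exact: (Pge_disjoint hC (k2 := 1) AB PA (Pge_edge hC hD hU b1B b2B b12)).
Qed.

(** Such an [n] is isotropic and orthogonal to a positive edge vector on each side. If it were not
    orthogonal to [v], [Pge_hyperbolic] would produce a third positive direction. *)
Lemma null_orth_cut n : ~ Pge h [set: T] 3 -> supp A n ->
  (forall x, x \in A -> form n (ev x) = 0) -> form n (ev v) = 0.
Proof.
move=> P3 nA n0; apply/eqP; apply: contra_notT P3 => nv.
apply: (Pge_hyperbolic hC orthopos_edges (supp_setT n) (supp_setT (ev v))).
- exact: (orth_supp hC nA).
- move=> u; rewrite !inE => /orP[] /eqP ->; apply: edge_vec_orth => //; try exact: n0.
    exact: (form_supp0 hC nA (supp_ev b1B)).
  exact: (form_supp0 hC nA (supp_ev b2B)).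
- by rewrite (formC hC) conjC_eq0.
Qed.

End Edges.

Variables (yA yB : V).
Hypotheses (pA : proj_on A v yA) (pB : proj_on B v yB).
Hypotheses (vA : v \notin A) (vB : v \notin B).
Let z : V := ev v - yA - yB.

Let zx x : x \in A :|: B -> form z (ev x) = 0.
Proof.
case: pA pB => sA eA [sB eB]; rewrite inE /z !formDl !formNl form_ev => /orP[xA|xB].
  by rewrite eA // subrr add0r (form_supp0 hC sB (supp_ev xA)) ?oppr0.
by rewrite eB // (form_supp0 hC sA (supp_ev xB)) // subr0 subrr.
Qed.

Let zz : form z z = - (form yA (ev v) + form yB (ev v)).
Proof.
case: (pA) (pB) => sA eA [sB eB].
have zA : form z yA = 0 by apply: (orth_supp hC sA) => x xA; rewrite zx // inE xA.
have zB : form z yB = 0 by apply: (orth_supp hC sB) => x xB; rewrite zx // inE xB orbT.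
rewrite {2}/z !(formDr hC) !(formNr hC) zA zB !subr0 /z !formDl !formNl form_ev hD.
by ring.
Qed.

Lemma cut_codim_le : 0 <= form yA (ev v) + form yB (ev v) ->
  codim_le h A 1 -> codim_le h B 1 -> codim_le h (v |: (A :|: B)) 2.
Proof.
move=> f0 cA cB; case: (pA) (pB) => sA eA [sB eB].
apply: (codim_le_ext hC (z := z)) zx _ _.
- by rewrite inE negb_or vA.
- apply: suppD; first apply: suppD.
  + by apply: supp_ev; rewrite !inE eqxx.
  + by apply/suppN/(suppS _ sA)/subsetP => x xA; rewrite !inE xA orbT.
  + by apply/suppN/(suppS _ sB)/subsetP => x xB; rewrite !inE xB !orbT.
- by rewrite !ffunE eqxx (sA v vA) (sB v vB) !subr0.
- by rewrite zz oppr_le0.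
- apply: (codim_le_union hC (k1 := 1) (k2 := 1)) cA cB => x y; rewrite !inE.
    by move=> /andP[_ xA] /andP[_ yB']; apply: AB.
  by move=> /andP[xA _] /andP[_ yB']; apply: AB.
Qed.

Lemma cut_ge0 (a1 a2 b1 b2 : T) : a1 \in A -> a2 \in A -> h a1 a2 != 0 ->
  b1 \in B -> b2 \in B -> h b1 b2 != 0 -> ~ Pge h [set: T] 3 ->
  0 <= form yA (ev v) + form yB (ev v).
Proof.
move=> a1A a2A a12 b1B b2B b12 P3.
rewrite real_leNgt ?real0 ?realD ?(proj_on_real pA) ?(proj_on_real pB) //.
apply: contra_notN P3 => f0; exists [:: z; edge_vec h a1 a2; edge_vec h b1 b2] => //.
have oe := orthopos_edges a1A a2A a12 b1B b2B b12.
apply: (@orthopos_cat _ _ _ [:: _]) oe _; first split=> // u.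
  rewrite inE => /eqP ->; split; first exact: supp_setT.
  by rewrite zz oppr_gt0.
move=> u w; rewrite !inE => /eqP -> /orP[] /eqP ->; rewrite (formC hC) edge_vec_orth ?conjC0 //;
  by rewrite zx // inE ?a1A ?a2A ?b1B ?b2B ?orbT.
Qed.

End TwoSides.
End CutVertex.

(** By [unit4_sum3] some entry is 0. The other two are then opposite and nonzero, as in the row of
    [C3val] indexed by the colour of the zero entry. *)
Lemma C3_vector (b : 'I_3 -> algC) : (forall j, b j != 0 -> unit4 (b j)) ->
  \sum_j b j = 0 -> (exists j, b j != 0) ->
  exists j0 m, unit4 m /\ forall j, b j = m * C3val j0 j.
Proof.
move=> bu; pose o1 : 'I_3 := inord 1; pose o2 : 'I_3 := inord 2.
have E1 : lift 0 (0 : 'I_2) = o1 by apply: val_inj; rewrite /= inordK.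
have E2 : lift 0 (lift 0 (0 : 'I_1)) = o2 by apply: val_inj; rewrite /= inordK.
rewrite !big_ord_recl big_ord0 addr0 E1 E2 addrA => s0 bN0.
have o3 (P : 'I_3 -> Prop) : P 0 -> P o1 -> P o2 -> forall j, P j.
  by move=> P0 P1 P2 [[|[|[|//]]] j3];
    [move: P0|move: P1|move: P2]; congr P; apply: val_inj; rewrite /= ?inordK.
have i2 : 'i * 'i = -1 :> algC by rewrite -expr2 sqrCi.
have key j0 j1 j2 : C3val j0 j0 = 0 -> C3val j0 j1 = 'i -> C3val j0 j2 = - 'i ->
   (forall P : 'I_3 -> Prop, P j0 -> P j1 -> P j2 -> forall j, P j) ->
   b j0 = 0 -> b j1 + b j2 = 0 -> exists j0 m, unit4 m /\ forall j, b j = m * C3val j0 j.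
  move=> v0 v1 v2 PP b0 b12; have b2 : b j2 = - b j1 by apply/eqP; rewrite -addr_eq0 addrC b12.
  have b1 : b j1 != 0.
    case: bN0 => j; apply: contraNneq => b10; apply/eqP; move: j.
    by apply: PP; rewrite ?b0 ?b2 ?b10 ?oppr0.
  (* The factor is [b j1] divided by the entry [C3val j0 j1], the imaginary unit. *)
  exists j0, (- 'i * b j1); split; first by rewrite unit4M ?unit4N ?unit4_i ?bu.
  apply: PP; rewrite ?v0 ?v1 ?v2 ?b2 ?mulr0 //.
    by rewrite mulrAC mulNr i2 opprK mul1r.
  by rewrite mulrAC mulrNN i2 mulN1r.
have [b0|/bu u0] := eqVneq (b 0) 0.
  by apply: (key 0 o1 o2); rewrite /C3val ?inordK //= ?b0 // -s0 b0 add0r.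
have [b1|/bu u1] := eqVneq (b o1) 0.
  apply: (key o1 o2 0); rewrite /C3val ?inordK //=;
    by [move=> P ? ? ?; apply: o3|rewrite -s0 b1 addr0 addrC].
have [b2|/bu u2] := eqVneq (b o2) 0.
  apply: (key o2 0 o1); rewrite /C3val ?inordK //=;
    by [move=> P ? ? ?; apply: o3|rewrite -s0 b2 addr0].
by case/eqP: (unit4_sum3 u0 u1 u2).
Qed.

Section Side.
Variables (T : finType) (h : T -> T -> algC).
Hypothesis hC : forall x y, h y x = (h x y)^*.
Hypothesis hD : forall x, h x x = 0.
Hypothesis hU : forall x y, h x y != 0 -> unit4 (h x y).
Notation V := {ffun T -> algC^o}.
Notation form := (hform h).
Variables (A B : {set T}) (v : T).
Hypothesis AB : forall x y, x \in A -> y \in B -> h x y = 0.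
Hypotheses (vA : v \notin A).
Hypothesis noisoA : forall x, x \in A -> exists2 y, y \in A & h x y != 0.
Hypothesis noisoB : forall x, x \in B -> exists2 y, y \in B & h x y != 0.
Hypothesis vnA : exists2 x, x \in A & h v x != 0.
Hypothesis BN0 : exists x, x \in B.
Hypothesis P3 : ~ Pge h [set: T] 3.

Lemma null_orth n : supp A n ->
  (forall x, x \in A -> form n (ev x) = 0) -> form n (ev v) = 0.
Proof.
case: vnA => a1 a1A _; have [a2 a2A a12] := noisoA a1A.
case: BN0 => b1 b1B; have [b2 b2B b12] := noisoB b1B.
exact: (null_orth_cut hC hD hU v AB a1A a2A a12 b1B b2B b12 P3).
Qed.

(** The switched difference of two vertices of one colour lies in the radical of [A], and
    [null_orth] makes it orthogonal to [v]. *)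
Lemma blowup_cut k (m : 'I_k -> 'I_k -> algC) q c r : blowup h A m q c r ->
  forall x, x \in A -> h v x = h v (r (c x)) * q (r (c x)) * (q x)^*.
Proof.
case=> uq hE rP x xA; have [rA cr] := rP (c x); set t := r (c x) in rA cr *.
pose n := (q x)^* *: ev x - (q t)^* *: ev t : V.
have nA : supp A n by apply: suppD; [|apply: suppN]; apply: suppZ; apply: supp_ev.
have : form n (ev v) = 0.
  apply: (null_orth nA) => y yA; rewrite formDl formNl !formZl !form_ev !hE // cr.
  have qq s : (q s)^* * q s = 1 by rewrite mulrC unit4_mulC.
  by rewrite !mulrA !qq !mul1r subrr.
rewrite formDl formNl !formZl !form_ev => /eqP; rewrite subr_eq0 => /eqP E.
have {}E := congr1 (fun a => a^*) E; rewrite !rmorphM /= !conjCK -!hC in E.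
rewrite [_ * q t]mulrC -E mulrAC unit4_mulC ?mul1r //.
Qed.

Lemma blowup_cut_val k (m : 'I_k -> 'I_k -> algC) q c r : blowup h A m q c r ->
  forall j, h v (r j) * q (r j) != 0 -> unit4 (h v (r j) * q (r j)).
Proof.
by move=> [uq _ _] j; rewrite mulf_eq0 negb_or => /andP[/hU hvj _]; rewrite unit4M.
Qed.

Lemma blowup_cut_neq0 k (m : 'I_k -> 'I_k -> algC) q c r : blowup h A m q c r ->
  exists j, h v (r j) * q (r j) != 0.
Proof.
move=> B'; have [x xA hvx] := vnA; exists (c x).
by move: hvx; rewrite (blowup_cut B' xA) mulf_eq0 negb_or => /andP[].
Qed.

(** The switched all-ones vector lies in the radical of [A], so the weights at [v] sum to 0 and
    [C3_vector] makes them a multiple of a row of [C3val]. Thus [v] joins the colour class [j0], and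
    a multiple of a vertex of this class, which is isotropic, is its projection. *)
Lemma C3_side q c r : @blowup T h A 3 C3val q c r ->
  (exists q c r, @blowup T h (v |: A) 3 C3val q c r) /\
  exists2 y, proj_on h A v y & form y (ev v) = 0.
Proof.
move=> B'; have [uq hE rP] := B'; pose b j := h v (r j) * q (r j).
have hb x : x \in A -> h v x = b (c x) * (q x)^* by exact: (blowup_cut B').
have s0 : \sum_j b j = 0.
  pose n := \sum_j (q (r j))^* *: ev (r j) : V.
  have nA : supp A n.
    move=> x xA; rewrite sum_ffunE big1 // => j _; rewrite !ffunE.
    case: eqP => [E|_]; last by rewrite scaler0.
    by rewrite E (rP j).1 in xA.
  have : form n (ev v) = 0.
    apply: (null_orth nA) => y yA; rewrite form_suml.
    transitivity ((\sum_j C3val j (c y)) * (q y)^*).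
      rewrite mulr_suml; apply: eq_bigr => j _; rewrite formZl form_ev hE ?(rP j).1 // (rP j).2.
      by rewrite !mulrA [_^* * q _]mulrC unit4_mulC // mul1r mulrC.
    rewrite !big_ord_recl big_ord0 /C3val /=.
    by case: (c y) => [[|[|[|//]]] ?]; rewrite /= ?(addr0, add0r, subrr, addNr) mul0r.
  rewrite form_suml => E; rewrite -[LHS]conjCK -[RHS]conjC0; congr (_^*).
  rewrite rmorph_sum /= -[RHS]E; apply: eq_bigr => j _.
  by rewrite formZl form_ev rmorphM /= -hC mulrC.
have [j0 [m [um mE]]] := C3_vector (blowup_cut_val B') s0 (blowup_cut_neq0 B').
have hvE x : x \in A -> h v x = m * (q x)^* * C3val j0 (c x).
  by move=> xA; rewrite hb // /b mE mulrAC.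
split.
  exists (fun x => if x == v then m else q x), (fun x => if x == v then j0 else c x), r.
  split=> [x|x y|j]; first by case: ifP.
    rewrite !inE; have [->|xv] /= := eqVneq x v; have [->|yv] /= := eqVneq y v => xA yA.
    - by rewrite hD /C3val /=; case: (j0) => [[|[|[|//]]] ?]; rewrite /= mulr0.
    - by rewrite hvE.
    - by rewrite hC hvE // !rmorphM /= conjCK -C3valC [_^* * _]mulrC.
    - by rewrite hE.
  have [rA crj] := rP j; rewrite !inE rA orbT; split=> //.
  by case: eqP => // E; case/negP: vA; rewrite -E.
have [tA ct] := rP j0; exists (m * (q (r j0))^* *: ev (r j0)); first split.
- by apply: suppZ; apply: supp_ev.
- move=> x xA; rewrite formZl form_ev hE // ct hvE //.
  by rewrite !mulrA -[m * _ * q _]mulrA [_^* * q _]mulrC unit4_mulC // mulr1.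
- rewrite formZl form_ev hC hvE // ct (_ : C3val j0 j0 = 0) ?mulr0 ?conjC0 ?mulr0 //.
  by rewrite /C3val; case: (j0) => [[|[|[|//]]] ?].
Qed.

(* [A] together with [v] again has one positive eigenvalue. *)
Definition good := (exists k q c r, (1 < k)%N /\ @blowup T h (v |: A) k (@Kval k) q c r) \/
  (exists q c r, @blowup T h (v |: A) 3 C3val q c r).

(* [k] parts switched to weight 1, the cut vertex being joined with weight
   [b j] to the part [j]. *)
Definition Kside k q c r (b : 'I_k -> algC) :=
  [/\ (1 < k)%N, @blowup T h A k (@Kval k) q c r,
      forall x, x \in A -> h v x = b (c x) * (q x)^*,
      forall j, b j != 0 -> unit4 (b j) & exists j, b j != 0].

(** When [fval b] is nonnegative no blow-up of [v |: A] is built by hand: [codim_le_proj] leaves it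
    one positive direction, and [classify] applies to the larger set. *)
Lemma side_cases :
  (good /\ exists2 y, proj_on h A v y & form y (ev v) = 0) \/
  exists k q c r b, @Kside k q c r b /\ (fval b < 0 \/ good).
Proof.
have nP2 : ~ Pge h A 2.
  case: BN0 => b1 b1B; have [b2 b2B b12] := noisoB b1B.
  by move=> PA; apply: P3; apply: (side_Pge2 hC hD hU AB b1B b2B b12).
have [a1 a1A hva] := vnA.
have [[k [q [c [r [k1 B']]]]]|[q [c [r B']]]] := classify hC hD hU a1A noisoA nP2; last first.
  by have [gA pr] := C3_side B'; left; split=> //; right.
right; pose b j := h v (r j) * q (r j).
have K : Kside q c r b.
  split=> //; [exact: (blowup_cut B')|exact: blowup_cut_val B'|exact: blowup_cut_neq0 B'].
have [_ _ hb _ _] := K; have [y py fy] := proj_on_pos hC k1 B' hb.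
have fr : fval b \is Num.real by rewrite -fy; apply: proj_on_real py.
case: (real_leP (real0 _) fr) => [f0|f0]; last first.
  by exists k, q, c, r, b; split=> //; left.
exists k, q, c, r, b; split=> //; right.
have cd := codim_le_proj hC hD k1 B' hb vA f0.
have vv : v \in v |: A by rewrite !inE eqxx.
apply: (classify hC hD hU vv); last exact: codim_le_Pge cd.
move=> x; rewrite !inE => /orP[/eqP ->|xA].
  by exists a1 => //; rewrite !inE a1A orbT.
by have [y' y'A xy'] := noisoA xA; exists y' => //; rewrite !inE y'A orbT.
Qed.

End Side.

(** * The inequality in terms of counts *)

Definition cnt k (b : 'I_k -> algC) (u : algC) : nat := #|[set j | b j == u]|.

Arguments cnt k b u%_ring_scope.

(** The squared difference within the natural numbers: at least one of the truncated subtractions is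
    0. *)
Definition dist2 (m n : nat) : nat := ((m - n) + (n - m)) ^ 2.

Lemma dist2E (R : comNzRingType) m n : (dist2 m n)%:R = (m%:R - n%:R) ^+ 2 :> R.
Proof.
rewrite /dist2 natrX natrD; case: (leqP m n) => mn.
  by rewrite (eqP mn) natrB // add0r -sqrrN opprB.
by have /eqP -> : (n - m == 0)%N by [rewrite subn_eq0 ltnW]; rewrite natrB 1?ltnW // addr0.
Qed.

Section NatCounts.
Local Open Scope nat_scope.

Lemma dist2D m n : dist2 m n + 4 * (m * n) = (m + n) * (m + n).
Proof.
rewrite /dist2 -mulnn; have [mn|/ltnW mn] := leqP m n.
  by have -> : m - n = 0 by [lia]; rewrite -(subnKC mn) addKn; lia.
by have -> : n - m = 0 by [lia]; rewrite -(subnKC mn) addKn; lia.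
Qed.
Lemma mul2_le m n : (0 < m -> 0 < n -> m + n <= 2 * (m * n))%N.
Proof. by nia. Qed.
Lemma dist2n0 m : dist2 m 0 = m * m. Proof. by rewrite /dist2 subn0 sub0n addn0 mulnn. Qed.
Lemma dist20n m : dist2 0 m = m * m. Proof. by rewrite /dist2 subn0 sub0n mulnn. Qed.
(** The hypothesis gives 2PQ + 4 n1 n3 + 4 n2 n4 < P + Q. As a product of positive numbers is at
    least half their sum, only one count [n] is nonzero, and (k - 1) n < n^2 then forces [n = k]. *)
Lemma dominant_count (n1 n2 n3 n4 n0 k : nat) : (n1 + n3 + n2 + n4 + n0 = k)%N ->
  (k.-1 * (n1 + n3 + n2 + n4) < dist2 n1 n3 + dist2 n2 n4)%N ->
  [\/ n1 = k, n3 = k, n2 = k | n4 = k].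
Proof.
move=> kE lt.
have single n m : k.-1 * n < m -> m = n * n -> n <= k -> n = k.
  by move=> lt1 mE; rewrite mE ltn_mul2r in lt1; case/andP: lt1; lia.
pose P := n1 + n3; pose Q := n2 + n4.
have m1 : 2 * (P * Q) + 4 * (n1 * n3) + 4 * (n2 * n4) < P + Q.
  have EX := dist2D n1 n3; have EY := dist2D n2 n4.
  have : (P + Q).-1 * (P + Q) <= k.-1 * (P + Q) by rewrite leq_mul2r; lia.
  have : (P + Q).-1 * (P + Q) + (P + Q) = (P + Q) * (P + Q).
    by case: (P + Q) => // m; rewrite -mulSnr.
  move: lt; have -> : n1 + n3 + n2 + n4 = P + Q by rewrite /P /Q; lia.
  by move: EX EY; rewrite -/P -/Q; lia.
have [P0|P0] := posnP P; have [Q0|Q0] := posnP Q.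
- by rewrite P0 Q0 in m1; lia.
- have [E1 E3] : n1 = 0 /\ n3 = 0 by lia.
  move: lt; rewrite E1 E3 dist2n0 !add0n; have [Z|n2p] := posnP n2; have [Z'|n4p] := posnP n4.
  + by lia.
  + by rewrite Z dist20n add0n => lt; apply: Or44; apply: single lt _ _; lia.
  + by rewrite Z' dist2n0 addn0 => lt; apply: Or43; apply: single lt _ _; lia.
  + by have := mul2_le n2p n4p; lia.
- have [E2 E4] : n2 = 0 /\ n4 = 0 by lia.
  move: lt; rewrite E2 E4 dist2n0 !addn0; have [Z|n1p] := posnP n1; have [Z'|n3p] := posnP n3.
  + by lia.
  + by rewrite Z dist20n add0n => lt; apply: Or42; apply: single lt _ _; lia.
  + by rewrite Z' dist2n0 addn0 => lt; apply: Or41; apply: single lt _ _; lia.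
  + by have := mul2_le n1p n3p; lia.
- by have := mul2_le P0 Q0; lia.
Qed.

End NatCounts.

Lemma i_neq : [/\ 'i != 1 :> algC, 'i != -1 :> algC & 'i != - 'i :> algC].
Proof.
have N1 : -1 != 1 :> algC by rewrite lt_eqF // (lt_trans (ltrN10 _)) ?ltr01.
have i2 := sqrCi algC; have i0 : 'i != 0 :> algC by rewrite neq0Ci.
split.
- by apply: contraNneq N1 => i1; rewrite -i2 i1 expr1n.
- by apply: contraNneq N1 => i1; rewrite -i2 i1 sqrrN expr1n.
- by rewrite -addr_eq0 -mulr2n -mulr_natl mulf_neq0 ?pnatr_eq0.
Qed.

(** Indicators of the four units turn sums over the colours into the counts [cnt]. *)
Lemma unit4_ext (b : algC) : (b != 0 -> unit4 b) ->
  b = ((b == 1)%:R - (b == -1)%:R) + 'i * ((b == 'i)%:R - (b == - 'i)%:R)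
  /\ `|b| ^+ 2 = ((b == 1)%R + (b == -1)%R + (b == 'i)%R + (b == - 'i)%R)%N%:R.
Proof.
have [i1 iN iNi] := i_neq.
have N1 : -1 != 1 :> algC by rewrite lt_eqF // (lt_trans (ltrN10 _)) ?ltr01.
have Ni1 : - 'i != 1 :> algC by rewrite eqr_oppLR.
have NiN : - 'i != -1 :> algC by rewrite eqr_opp.
have [->|_ /(_ isT)] := eqVneq b 0.
  rewrite [0 == 1]eq_sym oner_eq0 [0 == -1]eq_sym oppr_eq0 oner_eq0.
  rewrite [0 == 'i]eq_sym (negPf (neq0Ci _)) [0 == - _]eq_sym oppr_eq0 (negPf (neq0Ci _)) /=.
  by rewrite normr0 expr0n !subrr mulr0 addr0.
have E := ((negPf N1, negPf i1, negPf iN, negPf iNi), (negPf Ni1, negPf NiN)).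
have E' : ((1 == -1 :> algC) = false) * ((1 == 'i :> algC) = false) *
    ((1 == - 'i :> algC) = false) * ((-1 == 'i :> algC) = false) *
    ((-1 == - 'i :> algC) = false) * ((- 'i == 'i :> algC) = false).
  by do !split; rewrite eq_sym E.
move=> ub; rewrite normCK unit4_mulC //.
by case/unit4P: ub => ->; rewrite !eqxx !(E, E') /=; split=> //; ring.
Qed.

Section Counts.
Variables (k : nat) (b : 'I_k -> algC).
Hypothesis bu : forall j, b j != 0 -> unit4 (b j).

Definition nonzeros := (cnt b 1 + cnt b (-1) + cnt b 'i + cnt b (- 'i))%N.

Definition sqsum := (dist2 (cnt b 1) (cnt b (-1)) + dist2 (cnt b 'i) (cnt b (- 'i)))%N.

Lemma sum_cnt (R : pzSemiRingType) u : \sum_j (b j == u)%:R = (cnt b u)%:R :> R.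
Proof.
rewrite /cnt -sum1_card natr_sum [RHS]big_mkcond; apply: eq_bigr => j _.
by rewrite inE; case: eqP.
Qed.

Lemma fvalE : fval b = sqsum%:R / (k.-1)%:R - nonzeros%:R.
Proof.
rewrite /fval; congr (_ / _ - _).
  rewrite (eq_bigr (fun j => ((b j == 1)%:R - (b j == -1)%:R) +
     'i * ((b j == 'i)%:R - (b j == - 'i)%:R))); last by move=> j _; have [] := unit4_ext (@bu j).
  rewrite big_split /= -mulr_sumr !sumrB !sum_cnt normC2_rect ?realB ?realn //.
  by rewrite /sqsum natrD !dist2E.
under eq_bigr => j _ do rewrite (unit4_ext (@bu j)).2 !natrD.
by rewrite !big_split /= !sum_cnt -!natrD.
Qed.

Lemma nonzeros_le : (nonzeros + cnt b 0 = k)%N.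
Proof.
apply/eqP; rewrite -(eqr_nat algC) /nonzeros !natrD -!sum_cnt -!big_split /=.
rewrite -[X in _ == X%:R]card_ord -sum1_card natr_sum; apply/eqP; apply: eq_bigr => j _.
have [_] := unit4_ext (@bu j); rewrite !natrD => <-.
have [->|bj] := eqVneq (b j) 0; first by rewrite normr0 expr0n /= add0r.
by rewrite normCK unit4_mulC ?bu // addr0.
Qed.

Lemma cnt_gt0 u : (0 < cnt b u)%N = [exists j, b j == u].
Proof.
apply/card_gt0P/existsP => -[j]; rewrite ?inE => bj; exists j => //.
by rewrite inE.
Qed.

Lemma fval_ge r : (1 < k)%N -> (1 < r)%N ->
  (0 <= fval b + r%:R / (r.-1)%:R) =
  (nonzeros * k.-1 * r.-1 <= sqsum * r.-1 + r * k.-1)%N.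
Proof.
move=> k1 r1; have k0 : (0 < k.-1)%N by lia. have r0 : (0 < r.-1)%N by lia.
have P : 0 < (k.-1 * r.-1)%N%:R :> algC by rewrite ltr0n muln_gt0 k0.
rewrite -(pmulr_rge0 _ P) fvalE.
have -> : (k.-1 * r.-1)%N%:R * (sqsum%:R / k.-1%:R - nonzeros%:R + r%:R / r.-1%:R) =
   (sqsum * r.-1 + r * k.-1)%N%:R - (nonzeros * k.-1 * r.-1)%N%:R :> algC.
  by rewrite !(natrD, natrM); field; rewrite !pnatr_eq0 -!lt0n k0 r0.
by rewrite subr_ge0 ler_nat.
Qed.

Lemma fval_gt0 : (1 < k)%N -> 0 < fval b -> exists2 u, unit4 u & forall j, b j = u.
Proof.
move=> k1; have k0 : (0 < k.-1)%N by lia.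
have P : 0 < (k.-1)%:R :> algC by rewrite ltr0n.
rewrite -(pmulr_rgt0 _ P) fvalE.
have -> : k.-1%:R * (sqsum%:R / k.-1%:R - nonzeros%:R) = sqsum%:R - (k.-1 * nonzeros)%N%:R :> algC.
  by rewrite natrM; field; rewrite pnatr_eq0 -lt0n.
rewrite subr_gt0 ltr_nat => lt.
have full u : cnt b u = k -> unit4 u -> exists2 u, unit4 u & forall j, b j = u.
  move=> cu uu; exists u => // j; apply/eqP.
  have /eqP/setP/(_ j) : [set j | b j == u] == setT.
    by rewrite eqEcard subsetT /= cardsT card_ord -[X in (X <= _)%N]cu leqnn.
  by rewrite !inE.
have := nonzeros_le; move: lt; rewrite /sqsum /nonzeros.
have [f1 fN1 fi fNi] := And4 (full 1) (full (-1)) (full 'i) (full (- 'i)).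
move: (cnt b 1) (cnt b (-1)) (cnt b 'i) (cnt b (- 'i)) (cnt b 0) f1 fN1 fi fNi.
move=> n1 n3 n2 n4 n0 f1 fN1 fi fNi lt kE.
suff [E|E|E|E] : [\/ n1 = k, n3 = k, n2 = k | n4 = k].
- exact: f1 unit4_1.
- exact: fN1 (unit4N unit4_1).
- exact: fi unit4_i.
- exact: fNi (unit4N unit4_i).
exact: dominant_count kE lt.
Qed.

End Counts.

Lemma fval_const k (b : 'I_k -> algC) u : (1 < k)%N -> unit4 u ->
  (forall j, b j = u) -> fval b = k%:R / (k.-1)%:R.
Proof.
move=> k1 uu bE; have uu1 : `|u| ^+ 2 = 1 by rewrite normCK unit4_mulC.
have kE : k%:R = k.-1%:R + 1 :> algC by rewrite natr1 prednK // ltnW.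
have k0 : k.-1%:R != 0 :> algC by rewrite pnatr_eq0; case: (k) k1 => [|[]].
rewrite /fval (eq_bigr (fun=> u)) // sumr_const card_ord -[u *+ k]mulr_natl normrM exprMn uu1 mulr1.
rewrite (eq_bigr (fun=> 1)); last by move=> j _; rewrite bE.
rewrite sumr_const card_ord normr_nat -natrX natrX kE; field.
by rewrite k0.
Qed.

Section Structure.
Variables (T : finType) (h : T -> T -> algC).
Hypothesis hC : forall x y, h y x = (h x y)^*.
Hypothesis hD : forall x, h x x = 0.
Hypothesis hU : forall x y, h x y != 0 -> unit4 (h x y).

(* Shape (ii)-(iv): [v] is joined with weight 1 to all of the switched [B]. *)
Definition Kshape (A B : {set T}) (v : T) : Prop :=
  exists k q c r (b : 'I_k -> algC) k' q' c' r',
    [/\ Kside h A v q c r b, (1 < k')%N, @blowup T h B k' (@Kval k') q' c' r',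
        forall x, x \in B -> h v x = (q' x)^*
      & 0 <= fval b + k'%:R / k'.-1%:R].

Record cut_data (A B : {set T}) (v : T) : Prop := CutData {
  cut_AB : forall x y, x \in A -> y \in B -> h x y = 0;
  cut_vA : v \notin A;
  cut_vB : v \notin B;
  cut_noisoA : forall x, x \in A -> exists2 y, y \in A & h x y != 0;
  cut_noisoB : forall x, x \in B -> exists2 y, y \in B & h x y != 0;
  cut_vnA : exists2 x, x \in A & h v x != 0;
  cut_vnB : exists2 x, x \in B & h v x != 0 }.

Lemma cut_data_sym A B v : cut_data A B v -> cut_data B A v.
Proof. by case=> AB *; split=> // x y xB yA; rewrite hC AB // conjC0. Qed.

Lemma Kshape_neg A B v : ~ Pge h [set: T] 3 -> cut_data A B v ->
  forall k q c r (b : 'I_k -> algC), Kside h A v q c r b -> fval b < 0 -> Kshape A B v.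
Proof.
move=> P3 D k q c r b KA f0; have [AB vA vB nA nB vnA vnB] := D.
have [k1 BA hb _ _] := KA.
have [yA pA fA] := proj_on_pos hC k1 BA hb.
have [a1 a1A _] := vnA; have [a2 a2A a12] := nA _ a1A.
have [b1 b1B _] := vnB; have [b2 b2B b12] := nB _ b1B.
have ge0 yB (pB : proj_on h B v yB) : 0 <= fval b + hform h yB (ev v).
  by rewrite -fA; apply: (cut_ge0 hC hD hU AB pA pB) a12 _ _ b12 P3.
have BA' x y : x \in B -> y \in A -> h x y = 0 by move=> xB yA'; rewrite hC AB // conjC0.
have AN0 : exists x, x \in A by exists a1.
have := side_cases hC hD hU BA' vB nB nA vnB AN0 P3.
case=> [[_ [yB pB fB]]|[k' [q' [c' [r' [b' [KB _]]]]]]].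
  by have := ge0 _ pB; rewrite fB addr0 (lt_geF f0).
have [k1' BB hb' bu' _] := KB.
have [yB pB fB] := proj_on_pos hC k1' BB hb'.
have f01 := ge0 _ pB; rewrite fB in f01.
have f0' : 0 < fval b'.
  by apply: (lt_le_trans _ (_ : - fval b <= _)); rewrite ?oppr_gt0 // -subr_ge0 opprK addrC.
have [u uu bE] := fval_gt0 bu' k1' f0'.
(* The constant weight [u] is absorbed into the switching of [B], whose vertices are then all seen
   with weight 1. *)
exists k, q, c, r, b, k', (fun x => q' x * u^*), c', r'.
have [uq' hE' rP'] := BB.
split=> //; last by rewrite -(fval_const k1' uu bE).
- split=> // [x|x y xB yB']; first by rewrite unit4M ?unit4C.
  rewrite hE' // rmorphM /= conjCK; congr (_ * _).
  by rewrite mulrACA [u^* * u]mulrC unit4_mulC // mulr1.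
- by move=> x xB; rewrite hb' // bE rmorphM /= conjCK mulrC.
Qed.

Theorem cut_structure A B v : ~ Pge h [set: T] 3 -> cut_data A B v ->
  [\/ good h A v /\ good h B v, Kshape A B v | Kshape B A v].
Proof.
move=> P3 D; have D' := cut_data_sym D.
have [AB vA vB nA nB vnA vnB] := D; have [BA _ _ _ _ _ _] := D'.
have AN0 : exists x, x \in A by case: vnA => x; exists x.
have BN0 : exists x, x \in B by case: vnB => x; exists x.
have sA := side_cases hC hD hU AB vA nA nB vnA BN0 P3.
have sB := side_cases hC hD hU BA vB nB nA vnB AN0 P3.
case: sA => [[gA _]|[k [q [c [r [b [KA [f0|gA]]]]]]]].
- case: sB => [[gB _]|[k [q [c [r [b [KB [f0|gB]]]]]]]]; try by apply: Or31.
  by apply: Or33; apply: Kshape_neg KB f0.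
- by apply: Or32; apply: Kshape_neg KA f0.
- case: sB => [[gB _]|[k2 [q2 [c2 [r2 [b2 [KB [f0|gB]]]]]]]]; try by apply: Or31.
  by apply: Or33; apply: Kshape_neg KB f0.
Qed.

End Structure.

(** * Arithmetic of the conditions in (ii), (iii) and (iv) *)

Definition cond4 (a c s r : nat) : Prop :=
  (a = 1%N /\ c = 1%N /\ (s = 0%N \/ s = 1%N)) \/
  (a = 1%N /\ c = 1%N /\ s = 2%N /\ (r = 3%N \/ r = 4%N)) \/
  (a = 1%N /\ c = 1%N /\ s = 3%N /\ r = 3%N) \/
  (a = 1%N /\ c = 1%N /\ (2 <= s)%N /\ r = 2%N) \/
  (a = 2%N /\ c = 2%N /\ s = 0%N /\ (2 <= r <= 4)%N) \/
  (a = 2%N /\ c = 2%N /\ s = 1%N /\ r = 2%N) \/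
  (a = 3%N /\ s = 0%N /\ r = 2%N /\ c = 2%N) \/
  (a = 4%N /\ c = 2%N /\ r = 2%N /\ s = 0%N) \/
  ((2 <= a)%N /\ c = 1%N /\
   (((a * s)%:R - 1) / (a + s)%:R <= 1 / (r - 1)%:R :> rat)%R).

Lemma rat_cond9 a s r : (1 < r)%N -> (1 < a)%N ->
  (((a * s)%:R - 1) / (a + s)%:R <= 1 / (r - 1)%:R :> rat) =
  (a * s * (r - 1) <= a + s + (r - 1))%N.
Proof.
move=> r1 a1; have P1 : 0 < (a + s)%:R :> rat by rewrite ltr0n; lia.
have P2 : 0 < (r - 1)%:R :> rat by rewrite ltr0n; lia.
rewrite ler_pdivrMr // mulrAC ler_pdivlMr // mul1r mulrBl mul1r lerBlDr.
by rewrite -natrM -natrD ler_nat.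
Qed.

Lemma rat_cond3 r p t : (0 < r)%N -> (0 < p)%N -> (0 < t)%N ->
  (1 <= 1 / r%:R + 1 / p%:R + 1 / t%:R :> rat) =
  (r * p * t <= p * t + r * t + r * p)%N.
Proof.
move=> r0 p0 t0; have P : 0 < (r * p * t)%:R :> rat by rewrite ltr0n !muln_gt0 r0 p0.
rewrite -(ler_pM2l P) mulr1.
have -> : (r * p * t)%:R * (1 / r%:R + 1 / p%:R + 1 / t%:R) = (p * t + r * t + r * p)%:R :> rat.
  by rewrite !(natrD, natrM); field; rewrite !pnatr_eq0 -!lt0n r0 p0 t0.
by rewrite ler_nat.
Qed.

(** The left side is the inequality of [fval_ge] for [p] weights equal to 1 and [s] weights equal to
    0; the right side is that of [rat_cond3] with [t = s - 1]. *)
Lemma cond2E p s r : (1 < r)%N -> (1 < p)%N -> (1 < s)%N ->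
  (p * (p + s).-1 * r.-1 <= p ^ 2 * r.-1 + r * (p + s).-1)%N =
  (r * p * (s - 1) <= p * (s - 1) + r * (s - 1) + r * p)%N.
Proof.
case: r p s => [|[|r]] // [|[|p]] // [|[|s]] // _ _ _.
by rewrite !subSS !subn0 /= addSn /=; apply/idP/idP; lia.
Qed.

(** The inequality of [fval_ge] for [a] weights equal to one unit, [c] weights equal to a
    perpendicular one and [s] zeros: the sum of the weights has squared modulus a^2 + c^2. *)
Lemma cond4E a c s r : (1 < r)%N -> (0 < c <= a)%N -> (1 < a + c + s)%N ->
  ((a + c) * (a + c + s).-1 * r.-1 <= (a ^ 2 + c ^ 2) * r.-1 + r * (a + c + s).-1)%N <->
  cond4 a c s r.
Proof.
move=> r1 /andP[c0 ca] k1; split; last first.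
  rewrite /cond4; case=> [[-> [-> [->|->]]]|]; try by case: r r1 => [|[|r]] //= _; lia.
  case=> [[-> [-> [-> [->|->]]]]|] //.
  case=> [[-> [-> [-> ->]]]|] //.
  case=> [[-> [-> [s2 ->]]]|]; first by rewrite /=; lia.
  case=> [[-> [-> [-> /andP[r2 r4]]]]|]; first by case: r r1 r2 r4 => [|[|[|[|[|r]]]]].
  case=> [[-> [-> [-> ->]]]|] //.
  case=> [[-> [-> [-> ->]]]|] //.
  case=> [[-> [-> [-> ->]]]|] //.
  case=> a2 [-> ]; rewrite rat_cond9 //.
  by case: r r1 => [|[|r]] // _; rewrite addn1 /= subSS subn0; lia.
case: r r1 => [//|R] /=; rewrite ltnS => R0.
(* From here on [a] and [c] stand for the original values minus 1, and [R] for [r - 1]. *)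
case: a c c0 ca k1 => [|a] [|c] // _; rewrite ltnS => ca _.
have -> : ((a.+1 + c.+1 + s).-1 = a + c + 1 + s)%N by lia.
set K := (a + c + 1 + s)%N => H.
(* This eliminates [R] in [H2]; then [K >= a + c + 1] eliminates [s] in [H3], which leaves finitely
   many [a] unless the original [c] is 1. *)
have KR : (K <= K * R)%N by rewrite leq_pmulr.
have H1 : ((a + c + 1) * K * R <= (a.+1 ^ 2 + c.+1 ^ 2) * R + K)%N by lia.
have H2 : ((a + c) * K <= a.+1 ^ 2 + c.+1 ^ 2)%N.
  rewrite -(leq_add2r K) -(leq_pmul2r R0); lia.
have H3 : (2 * (a * c) <= a + c + 2)%N.
  have : ((a + c) * (a + c + 1) <= (a + c) * K)%N by rewrite leq_mul2l; lia.
  by lia.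
have c1 : (c <= 1)%N.
  rewrite leqNgt; apply/negP => c2.
  by have : (a * 2 <= a * c)%N; [rewrite leq_mul2l c2 orbT|lia].
rewrite /cond4; case: c c1 ca @K H KR H1 H2 H3 => [|[|//]] _ ca K H KR H1 H2 H3.
  case: a ca @K H KR H1 H2 H3 => [|a] ca K H KR H1 H2 H3; last first.
    do 8! right; split=> //; split=> //; rewrite rat_cond9 // subn1 /=.
    by rewrite /K in H1; lia.
  have H4 : ((1 + s) * R <= 2 * R + (1 + s))%N by rewrite /K in H1; lia.
  case: s {K H KR H1 H2} H4 => [|[|[|[|s]]]] H4; [by left; auto|by left; auto| | |].
  - by case: R R0 H4 => [|[|[|[|R]]]] // _ H4; [do 3! right; left|right; left|right; left|lia];
    auto.
  - case: R R0 H4 => [|[|[|R]]] // _ H4; [do 3! right; left|do 2! right; left|lia]; auto.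
  - suff -> : R = 1%N by do 3! right; left; auto.
    case: R R0 H4 => [|[|R]] // _ H4.
    by have : (2 * (4 + s) <= (4 + s) * R.+2)%N; [rewrite mulnC leq_mul2l|]; lia.
have a3 : (a <= 3)%N by lia.
case: a a3 ca @K H KR H1 H2 H3 => [|[|[|[|//]]]] // _ _ K H KR H1 H2 _; rewrite /K in H1 H2.
- case: s {K H KR} H1 H2 => [|[|s]] H1 H2; last by lia.
    by do 4! right; left; do 3! split=> //; lia.
  by do 5! right; left; do 3! split=> //; lia.
- case: s {K H KR} H1 H2 => [|s] H1 H2; last by lia.
  by do 6! right; left; do 3! split=> //; lia.
- case: s {K H KR} H1 H2 => [|s] H1 H2; last by lia.
  by do 7! right; left; do 3! split=> //; lia.
Qed.

(* [n1] is the largest of the four counts, of the value 1 after a switching at the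
   cut vertex; [n2], [n3], [n4] count the values [i], [-1], [-i]. *)
Lemma cond_cases n1 n2 n3 n4 s r (k := (n1 + n3 + n2 + n4 + s)%N) :
  (1 < r)%N -> (1 < k)%N -> (0 < n1)%N -> (n2 <= n1)%N -> (n3 <= n1)%N -> (n4 <= n1)%N ->
  ((n1 + n3 + n2 + n4) * k.-1 * r.-1 <=
     (dist2 n1 n3 + dist2 n2 n4) * r.-1 + r * k.-1)%N ->
  [\/ [/\ n2 = 0, n3 = 0 & n4 = 0]%N,
      [/\ n2 = 0, n4 = 0, n1 = 1, n3 = 1 & r = 2]%N |
      [/\ n3 = 0, 0 < n2 + n4, n2 = 0 \/ n4 = 0 & cond4 n1 (n2 + n4) s r]%N].
Proof.
move=> r1 k1 n1p n21 n31 n41.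
case: r r1 => [//|R] /=; rewrite ltnS => R0 H.
pose P := (n1 + n3)%N; pose Q := (n2 + n4)%N; pose K := k.-1.
have mE : (n1 + n3 + n2 + n4 = P + Q)%N by rewrite /P /Q; lia.
have KE : (K + 1 = P + Q + s)%N by rewrite /K /P /Q /k; lia.
rewrite mE -/K in H.
have X1 := dist2D n1 n3; have X2 := dist2D n2 n4; rewrite -/P in X1; rewrite -/Q in X2.
have KR : (K <= K * R)%N by rewrite leq_pmulr.
have H2 : ((P + Q) * K <= dist2 n1 n3 + dist2 n2 n4 + 2 * K)%N.
  by rewrite -(leq_pmul2r R0); lia.
(* When P + Q >= 2, [K] may be replaced by its lower bound P + Q - 1; the squares then cancel and
   only products of counts remain on the left. *)
have H3 : (2 * (P * Q) + 4 * (n1 * n3) + 4 * (n2 * n4) + 2 <= 3 * (P + Q))%N.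
  have [m2|m2] := leqP 2 (P + Q); last first.
    rewrite /P /Q in m2 *; have [-> -> -> ->] : [/\ n1 = 1, n2 = 0, n3 = 0 & n4 = 0]%N by split;
      lia.
    by [].
  have : ((P + Q - 2) * (P + Q - 1) <= (P + Q - 2) * K)%N by rewrite leq_mul2l; lia.
  have [t tE] : exists t, (P + Q = t + 2)%N by exists (P + Q - 2)%N; lia.
  have sq : ((P + Q) * (P + Q) = (t + 2) * (t + 2))%N by rewrite tE.
  by rewrite tE addnK in H2 *; have -> : (t + 2 - 1 = t + 1)%N by [lia]; lia.
(* A product of positive counts is at least half their sum, so opposite weights leave no room for
   perpendicular ones and occur once each. *)
have [n30|n3p] := posnP n3; last first.
  have PP : (P <= 2 * (n1 * n3))%N by apply: mul2_le.
  have [Q0|Qp] := posnP Q; last first.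
    exfalso; have P2 : (2 <= P)%N by rewrite /P; lia.
    have : (P + 2 * Q <= P * Q + 2)%N.
      by rewrite -(subnK P2) -(subnK Qp); move: (P - 2)%N (Q - 1)%N => p' q'; lia.
    by lia.
  have n31' : n3 = 1%N.
    apply/eqP; rewrite eqn_leq n3p andbT leqNgt; apply/negP => n32.
    by have : (n1 * 2 <= n1 * n3)%N; [rewrite leq_mul2l n32 orbT|rewrite /P /Q in H3 Q0; lia].
  have n11 : n1 = 1%N by rewrite n31' /P in H3 *; rewrite n31' /Q in Q0 H3; lia.
  apply: Or32; split=> //; try by rewrite /Q in Q0; lia.
  have d0 : dist2 n1 n3 = 0%N by rewrite n11 n31'.
  have d0' : dist2 n2 n4 = 0%N.
    by have [-> ->] : n2 = 0%N /\ n4 = 0%N by rewrite /Q in Q0; lia.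
  have K0 : (0 < K)%N by rewrite /K; lia.
  have P2 : P = 2%N by rewrite /P n11 n31'.
  rewrite d0 d0' P2 Q0 in H.
  suff : (R <= 1)%N by lia.
  by rewrite -(leq_pmul2l K0); lia.
have [Q0|Qp] := posnP Q.
  by apply: Or31; rewrite /Q in Q0; split; lia.
have n24 : n2 = 0%N \/ n4 = 0%N.
  have [->|n2p] := posnP n2; first by left.
  have [->|n4p] := posnP n4; first by right.
  have := mul2_le n2p n4p; rewrite -/Q => Q24.
  have : (1 * (2 * Q - 3) <= n1 * (2 * Q - 3))%N by rewrite leq_mul2r n1p orbT.
  have P1 : P = n1 by rewrite /P n30 addn0.
  have Q2 : (2 <= Q)%N by rewrite /Q; lia.
  have [t tE] : exists t, Q = (t + 2)%N by exists (Q - 2)%N; lia.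
  rewrite P1 n30 muln0 tE in H3 Q24 *; have -> : (2 * (t + 2) - 3 = 2 * t + 1)%N by lia.
  by lia.
apply: Or33; split=> //; apply/cond4E; rewrite ?ltnS //.
- by rewrite Qp /Q; lia.
- by move: k1; rewrite /k; lia.
have -> : (n1 + (n2 + n4) + s = k)%N by rewrite /k; lia.
have -> : (n1 ^ 2 + (n2 + n4) ^ 2 = dist2 n1 n3 + dist2 n2 n4)%N.
  by rewrite n30 dist2n0; case: n24 => ->; rewrite ?dist20n ?dist2n0 ?addn0 ?add0n !mulnn.
by have -> : (n1 + (n2 + n4) = P + Q)%N by rewrite /P /Q; lia.
Qed.

(** * Switching and vertex colourings *)

Section Hentry.
Variables (T : finType) (G : mixed_graph T).

Lemma hentryC x y : hentry G y x = (hentry G x y)^*.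
Proof.
rewrite /hentry (adj_sym G y x); have [xy|] := boolP (Defs.arc G x y).
  by rewrite (negPf (arc_asym xy)) conjCi.
have [_ _|_ _] := boolP (Defs.arc G y x); first by rewrite rmorphN /= conjCi opprK.
by case: ifP; rewrite ?conjC1 ?conjC0.
Qed.

Lemma hentry_diag x : hentry G x x = 0.
Proof. by rewrite /hentry arc_irr adj_irr. Qed.

Lemma hentry_adj x y : (hentry G x y != 0) = adj G x y.
Proof.
rewrite /hentry; have [xy|_] := boolP (Defs.arc G x y); first by rewrite neq0Ci (arc_adj xy).
have [yx|_] := boolP (Defs.arc G y x); first by rewrite oppr_eq0 neq0Ci adj_sym (arc_adj yx).
by case: ifP; rewrite ?oner_eq0 ?eqxx.
Qed.

Lemma hentry_unit x y : hentry G x y != 0 -> unit4 (hentry G x y).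
Proof.
rewrite /hentry; case: ifP => _; first by rewrite unit4_i.
case: ifP => _; first by rewrite unit4N ?unit4_i.
by case: ifP; rewrite ?unit4_1 ?eqxx.
Qed.

Lemma pos_inertia_ge k : (k <= pos_inertia G)%N <-> Pge (hentry G) [set: T] k.
Proof. exact: (sylvester hentryC). Qed.

End Hentry.

(** Switching equivalence on entries instead of enumerated matrices; the second alternative is the
    one with the transpose. *)
Definition switched (T1 T2 : finType) (h1 : T1 -> T1 -> algC) (h2 : T2 -> T2 -> algC)
    (f : T1 -> T2) (q : T1 -> algC) : Prop :=
  [/\ bijective f, forall x, unit4 (q x)
    & (forall x y, h2 (f x) (f y) = (q x)^* * h1 x y * q y) \/
      (forall x y, h2 (f y) (f x) = (q x)^* * h1 x y * q y)].

Lemma switching_equivalentP (T1 T2 : finType) (G1 : mixed_graph T1) (G2 : mixed_graph T2) :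
  switching_equivalent G1 G2 <-> exists f q, switched (hentry G1) (hentry G2) f q.
Proof.
have key (H1 H2 : 'M[algC]_#|T1|) (d : 'rV[algC]_#|T1|) : (forall s, unit4 (d 0 s)) ->
    H2 = invmx (diag_mx d) *m H1 *m diag_mx d <->
    forall s t, H2 s t = (d 0 s)^* * H1 s t * d 0 t.
  move=> ud; have uQ : diag_mx d \in unitmx.
    by rewrite unitmxE det_diag unitfE; apply/prodf_neq0 => s _; apply: unit4_neq0.
  have -> : (H2 = invmx (diag_mx d) *m H1 *m diag_mx d) <-> (diag_mx d *m H2 = H1 *m diag_mx d).
    by split=> [->|E]; rewrite -?mulmxA ?mulKVmx // -E mulKmx.
  have E s t : (diag_mx d *m H2) s t = d 0 s * H2 s t.
    by rewrite mul_diag_mx mxE.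
  have E' s t : (H1 *m diag_mx d) s t = H1 s t * d 0 t by rewrite mul_mx_diag mxE.
  split=> [/matrixP H s t|H].
    by have := H s t; rewrite E E' -mulrA => <-; rewrite mulrA [_^* * _]mulrC unit4_mulC // mul1r.
  by apply/matrixP => s t; rewrite E E' H !mulrA unit4_mulC // mul1r.
split=> [[f [d [bf ud H]]]|[f [q [bf uq H]]]].
  have {}ud s : unit4 (d 0 s) by rewrite unit4_mem.
  exists f, (fun x => d 0 (enum_rank x)); split=> //.
  case: H => /(key _ _ _ ud) H; [left|right] => x y;
    by have := H (enum_rank x) (enum_rank y); rewrite !mxE !enum_rankK.
pose d : 'rV[algC]_#|T1| := \row_s q (enum_val s).
have ud s : unit4 (d 0 s) by rewrite mxE.
exists f, d; split=> //; first by move=> j; rewrite -unit4_mem.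
by case: H => H; [left|right]; apply/(key _ _ _ ud) => s t; rewrite !mxE -H.
Qed.

Section Transport.
Variables (T1 T2 : finType) (h1 : T1 -> T1 -> algC) (h2 : T2 -> T2 -> algC).
Hypothesis hC1 : forall x y, h1 y x = (h1 x y)^*.

Lemma Pge_switched f q k : switched h1 h2 f q -> Pge h1 [set: T1] k -> Pge h2 [set: T2] k.
Proof.
move=> [[g fK gK] uq H] [us <- [us1 us2]].
have qq x : q x * (q x)^* = 1 by rewrite unit4_mulC.
suff [F [F1 F2]] : exists F : {ffun T1 -> algC^o} -> {ffun T2 -> algC^o},
    (forall u, hform h2 (F u) (F u) = hform h1 u u) /\
    (forall u w, hform h1 u w = 0 -> hform h2 (F u) (F w) = 0).
  exists (map F us); first by rewrite size_map.
  split=> [_ /mapP[u uus ->]|]; first by rewrite F1; have [_ up] := us1 _ uus; split=> // ?;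
    rewrite inE.
  by rewrite pairwise_map; apply: sub_pairwise us2 => u w /= /eqP/F2 ->.
have bij : {on xpredT, bijective f} by apply: onW_bij; exists g.
case: H => H.
  have E (u w : {ffun T1 -> algC^o}) : hform h2 [ffun y => q (g y) * u (g y)] [ffun y => q (g y)
    * w (g y)] = hform h1 u w.
    rewrite /hform (reindex f) //=; apply: eq_bigr => x _; rewrite (reindex f) //=.
    apply: eq_bigr => y _; rewrite !ffunE !fK H rmorphM /=.
    have -> : q x * u x * ((q x)^* * h1 x y * q y) * ((q y)^* * (w y)^*) =
      (q x * (q x)^*) * (q y * (q y)^*) * (u x * h1 x y * (w y)^*) by ring.
    by rewrite !qq !mul1r.
  by exists (fun u => [ffun y => q (g y) * u (g y)]); split=> [u|u w uw]; rewrite E.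
(* For the transpose the vectors are conjugated as well, which exchanges the arguments of the
   form. *)
have E (u w : {ffun T1 -> algC^o}) : hform h2 [ffun y => (q (g y))^* * (u (g y))^*] [ffun y =>
  (q (g y))^* * (w (g y))^*] = hform h1 w u.
  rewrite /hform exchange_big (reindex f) //=; apply: eq_bigr => x _; rewrite (reindex f) //=.
  apply: eq_bigr => y _; rewrite !ffunE !fK H rmorphM /= !conjCK.
  have -> : (q y)^* * (u y)^* * ((q x)^* * h1 x y * q y) * (q x * w x) =
    (q x * (q x)^*) * (q y * (q y)^*) * (w x * h1 x y * (u y)^*) by ring.
  by rewrite !qq !mul1r.
exists (fun u => [ffun y => (q (g y))^* * (u (g y))^*]); split=> [u|u w uw]; rewrite E //.
by rewrite (formC hC1) uw conjC0.
Qed.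

Lemma switched_sym f q : switched h1 h2 f q -> exists f' q', switched h2 h1 f' q'.
Proof.
move=> [[g fK gK] uq H]; exists g.
have qq x : q x * (q x)^* = 1 by rewrite unit4_mulC.
case: H => H.
  exists (fun y => (q (g y))^*); split=> [|y|]; [by exists f|by rewrite unit4C|left=> x y].
  have -> : h2 x y = (q (g x))^* * h1 (g x) (g y) * q (g y) by rewrite -H !gK.
  rewrite conjCK.
  have -> : q (g x) * ((q (g x))^* * h1 (g x) (g y) * q (g y)) * (q (g y))^* =
    (q (g x) * (q (g x))^*) * (q (g y) * (q (g y))^*) * h1 (g x) (g y) by ring.
  by rewrite !qq !mul1r.
exists (fun y => q (g y)); split=> [|y|]; [by exists f|by []|right=> x y].
have -> : h2 x y = (q (g y))^* * h1 (g y) (g x) * q (g x) by rewrite -H !gK.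
have -> : (q (g x))^* * ((q (g y))^* * h1 (g y) (g x) * q (g x)) * q (g y) =
  (q (g x) * (q (g x))^*) * (q (g y) * (q (g y))^*) * h1 (g y) (g x) by ring.
by rewrite !qq !mul1r.
Qed.

End Transport.

Lemma pos_inertia_switching (T1 T2 : finType) (G1 : mixed_graph T1) (G2 : mixed_graph T2) :
  switching_equivalent G1 G2 -> pos_inertia G1 = pos_inertia G2.
Proof.
move=> /switching_equivalentP[f [q S]]; have [f' [q' S']] := switched_sym S.
apply/eqP; rewrite eqn_leq; apply/andP; split; apply/pos_inertia_ge.
  by apply: (Pge_switched (@hentryC _ G1) S); apply/pos_inertia_ge.
by apply: (Pge_switched (@hentryC _ G2) S'); apply/pos_inertia_ge.
Qed.

Definition class_sizes (T : finType) (A : {set T}) (k : nat) (c : T -> nat) : seq nat :=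
  mkseq (fun j => #|[set x in A | c x == j]|) k.

(** Identifies a coloured set with the vertices of a complete multipartite graph by enumerating each
    colour class. *)
Lemma multipart_enum (T : finType) (A : {set T}) (k : nat) (c : T -> nat) :
  (forall x, x \in A -> (c x < k)%N) ->
  (forall j, (j < k)%N -> exists2 x, x \in A & c x = j) ->
  pos_parts (class_sizes A k c) /\
  exists g : multipart (class_sizes A k c) -> T,
    [/\ injective g, forall z, g z \in A /\ c (g z) = tag z
      & forall x, x \in A -> exists z, g z = x].
Proof.
move=> ck cs; split.
  apply/allP => n /mapP[j]; rewrite mem_iota add0n => /andP[_ jk] ->.
  by have [x xA cx] := cs j jk; apply/card_gt0P; exists x; rewrite inE xA cx eqxx.
set ns := class_sizes A k c; have sn : size ns = k by rewrite size_mkseq.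
pose cl (j : nat) := [set x in A | c x == j].
have nE (j : 'I_(size ns)) : nth 0%N ns j = #|cl j|.
  by rewrite nth_mkseq // -sn.
pose g (z : multipart ns) : T := enum_val (cast_ord (nE (tag z)) (tagged z)).
have gP z : g z \in cl (tag z) by apply: enum_valP.
exists g; split.
- move=> z z' E; have := gP z; rewrite E; have := gP z';
  rewrite !inE => /andP[_ /eqP ->] /andP[_ /eqP tz].
  case: z z' E tz => [j i] [j' i'] /= E /ord_inj jj'; case: _ / jj' i E => i.
  by rewrite /g /= => /enum_val_inj/cast_ord_inj ->.
- by move=> z; have := gP z; rewrite !inE => /andP[-> /eqP].
- move=> x xA; have cx : (c x < size ns)%N by rewrite sn ck.
  have xc : x \in cl (Ordinal cx) by rewrite inE xA eqxx.
  exists (Tagged (fun j : 'I_(size ns) => 'I_(nth 0%N ns j))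
    (cast_ord (esym (nE (Ordinal cx))) (enum_rank_in xc x))).
  by rewrite /g /= cast_ord_comp cast_ord_id enum_rankK_in.
Qed.

(** [Kmixed] expects the classes grouped by the way [v] sees them. Listing the colours group by
    group, the position in the list is the required permutation. *)
Lemma sort_colours k (t : 'I_k -> nat) (N := fun i => #|[set j | t j == i]|) :
  exists2 s : 'I_k -> 'I_k, bijective s & forall j,
    [/\ (s j < N 0)%N = (t j == 0)%N, (N 0 <= s j < N 0 + N 1)%N = (t j == 1)%N
      & (N 0 + N 1 <= s j < N 0 + N 1 + N 2)%N = (t j == 2)%N].
Proof.
pose s_ i := enum [set j | t j == i]; pose s3 := enum [set j | (2 < t j)%N].
pose l := s_ 0%N ++ s_ 1%N ++ s_ 2%N ++ s3.
have sz i : size (s_ i) = N i by rewrite -cardE.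
have lu : uniq l.
  rewrite !cat_uniq !enum_uniq /= !andbT -!all_predC.
  apply/and3P; split; apply/allP => j; rewrite /= ?mem_cat !mem_enum !inE;
    by case: (t j) => [|[|[|?]]].
have lin j : j \in l by rewrite !mem_cat !mem_enum !inE; case: (t j) => [|[|[|?]]].
have ls : (size l <= k)%N.
  by rewrite -[X in (_ <= X)%N]card_ord; apply: (leq_trans (uniq_leq_size lu (s2 := enum 'I_k) _));
     rewrite -?cardE // => j _; rewrite mem_enum.
have il j : (index j l < k)%N by apply: leq_trans ls; rewrite index_mem.
exists (fun j => Ordinal (il j)).
  apply: injF_bij => j j' /(congr1 val) /= E.
  by rewrite -(nth_index j (lin j)) E nth_index.
move=> j /=; rewrite !index_cat !mem_enum !inE.
have i_ i : (index j (s_ i) < N i)%N = (t j == i) by rewrite -sz index_mem mem_enum inE.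
rewrite !sz; move: (i_ 0%N) (i_ 1%N) (i_ 2%N).
move: (N 0%N) (N 1%N) (N 2%N) (index j (s_ 0%N)) (index j (s_ 1%N)) (index j (s_ 2%N)) (index j s3).
by move=> n0 n1 n2 j0 j1 j2 j3; case: (t j) => [|[|[|m]]] /= H0 H1 H2; split; lia.
Qed.

(** * The graphs (ii), (iii) and (iv) *)

(** Codes of the four ways in which [v] can see a class, in the order of the parameters of [Kmixed];
    [Ktype] gives the code of the class number [j]. *)
Definition Kweight (i : nat) : algC :=
  if i is 0%N then 'i else if i is 1%N then - 'i else if i is 2%N then 1 else 0.

Definition Ktype (a b c j : nat) : nat :=
  if (j < a)%N then 0%N else if (j < a + b)%N then 1%N
  else if (j < a + b + c)%N then 2%N else 3%N.

Section KmixedEntries.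
Variables (qs ns : seq nat) (a b c : nat).
Notation hK := (hentry (Kmixed qs ns a b c)).

Lemma Kmixed_vv : hK None None = 0. Proof. exact: hentry_diag. Qed.

Lemma Kmixed_vl x : hK None (Some (inl x)) = 1. Proof. by []. Qed.

Lemma Kmixed_vr x : hK None (Some (inr x)) = Kweight (Ktype a b c (tag x)).
Proof.
rewrite /hentry /= /Ktype; case: (ltnP (tag x) a) => //= _.
by case: ltnP => //= _; case: ltnP.
Qed.

Lemma Kmixed_ll x y : hK (Some (inl x)) (Some (inl y)) = (tag x != tag y)%:R.
Proof. by rewrite /hentry /=; case: eqP. Qed.

Lemma Kmixed_rr x y : hK (Some (inr x)) (Some (inr y)) = (tag x != tag y)%:R.
Proof. by rewrite /hentry /=; case: eqP. Qed.

Lemma Kmixed_lr x y : hK (Some (inl x)) (Some (inr y)) = 0. Proof. by []. Qed.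

End KmixedEntries.

(** Lets (ii) be treated together with (iii) and (iv). *)
Lemma Kgraph_Kmixed qs ns p : hentry (mixed_of_simple (Kgraph qs ns p)) =2 hentry (Kmixed qs ns
  0 0 p).
Proof. by move=> [[x|x]|] [[y|y]|]. Qed.

Lemma inj_surj_bij (T1 T2 : finType) (g : T1 -> T2) : injective g ->
  (forall y, exists x, g x = y) -> exists2 f, cancel f g & cancel g f.
Proof.
move=> gi gs; have [f fP] : exists f : T2 -> T1, forall y, g (f y) = y.
  exact: (@fin_all_exists T2 (fun=> T1) (fun y x => g x = y)).
by exists f => // x; apply: gi.
Qed.

Section KModel.
Variables (T : finType) (h : T -> T -> algC).
Hypothesis hC : forall x y, h y x = (h x y)^*.
Hypothesis hD : forall x, h x x = 0.
Variables (A B : {set T}) (v : T).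
Hypothesis cover : forall x, [|| x == v, x \in A | x \in B].
Hypotheses (vA : v \notin A) (vB : v \notin B) (dAB : forall x, x \in A -> x \notin B).
Hypothesis AB : forall x y, x \in A -> y \in B -> h x y = 0.
Variables (k : nat) (q : T -> algC) (c : T -> 'I_k) (r : 'I_k -> T) (b : 'I_k -> algC).
Hypothesis BA : blowup h A (@Kval k) q c r.
Hypothesis hb : forall x, x \in A -> h v x = b (c x) * (q x)^*.
Variables (k' : nat) (q' : T -> algC) (c' : T -> 'I_k') (r' : 'I_k' -> T).
Hypothesis BB : blowup h B (@Kval k') q' c' r'.
Hypothesis hb' : forall x, x \in B -> h v x = (q' x)^*.

(** Scaling all of [A] by [al] changes nothing inside [A] and multiplies the weights at [v]; [cj]
    passes to the converse. Together they bring the weights into the form that [Kmixed] allows. *)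
Lemma Kmodel (al : algC) (cj : bool) (t : 'I_k -> nat) (N := fun i => #|[set j | t j == i]|) :
  unit4 al ->
  (forall j, Kweight (t j) = if cj then (b j * al)^* else b j * al) ->
  (forall j, (t j <= 3)%N) ->
  exists s : 'I_k -> 'I_k,
    let qs := class_sizes B k' c' in
    let ns := class_sizes A k (fun x => s (c x)) in
    [/\ bijective s, forall j, Ktype (N 0%N) (N 1%N) (N 2%N) (s j) = t j,
        pos_parts qs, pos_parts ns &
        exists f Q, switched h (hentry (Kmixed qs ns (N 0%N) (N 1%N) (N 2%N))) f Q].
Proof.
move=> ual tE t3; have [uq hE rP] := BA; have [uq' hE' rP'] := BB.
have [s sb sP] := sort_colours t; have [s' sK s'K] := sb.
have stE j : Ktype (N 0%N) (N 1%N) (N 2%N) (s j) = t j.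
  have [] := sP j; rewrite -/(N 0%N) -/(N 1%N) -/(N 2%N) /Ktype;
    move: (N 0%N) (N 1%N) (N 2%N) (t3 j) => n0 n1 n2.
  case: (t j) => [|[|[|[|//]]]] _ /=; case: ltnP => //=; case: ltnP => //=; case: ltnP => //=; lia.
exists s => qs ns.
have [pq [gB [gBi gBP gBs]]] : pos_parts qs /\ exists g : multipart qs -> T,
    [/\ injective g, forall z, g z \in B /\ c' (g z) = tag z :> nat
      & forall x, x \in B -> exists z, g z = x].
  apply: (multipart_enum (c := c')) => [x _|j jk]; first exact: ltn_ord.
  by exists (r' (Ordinal jk)); rewrite ?(rP' _).2 ?(rP' _).1.
have [pn [gA [gAi gAP gAs]]] : pos_parts ns /\ exists g : multipart ns -> T,
    [/\ injective g, forall z, g z \in A /\ s (c (g z)) = tag z :> nat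
      & forall x, x \in A -> exists z, g z = x].
  apply: (multipart_enum (c := fun x => s (c x))) => [x _|j jk]; first exact: ltn_ord.
  by exists (r (s' (Ordinal jk))); rewrite ?(rP _).2 ?s'K ?(rP _).1.
split=> //.
pose g (z : Kvertex qs ns) : T :=
  match z with None => v | Some (inl y) => gB y | Some (inr y) => gA y end.
have gi : injective g.
  move=> [[y|y]|] [[y'|y']|] //= E.
  - by rewrite (gBi _ _ E).
  - by have := dAB (gAP y').1; rewrite -E (gBP y).1.
  - by move: vB; rewrite -E (gBP y).1.
  - by have := dAB (gAP y).1; rewrite E (gBP y').1.
  - by rewrite (gAi _ _ E).
  - by move: vA; rewrite -E (gAP y).1.
  - by move: vB; rewrite E (gBP y').1.
  - by move: vA; rewrite E (gAP y').1.
have gs x : exists z, g z = x.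
  case/or3P: (cover x) => [/eqP ->|/gAs[z <-]|/gBs[z <-]].
  - by exists None.
  - by exists (Some (inr z)).
  - by exists (Some (inl z)).
have [f fK gK] := inj_surj_bij gi gs.
pose Q x := if x == v then 1 else if x \in A then q x * al else q' x.
have uQ x : unit4 (Q x) by rewrite /Q; case: ifP => _; [exact: unit4_1|case: ifP => _ //;
  rewrite unit4M].
have Qv : Q v = 1 by rewrite /Q eqxx.
have QA x : x \in A -> Q x = q x * al.
  by move=> xA; rewrite /Q xA; case: eqP => // E; move: vA; rewrite -E xA.
have QB x : x \in B -> Q x = q' x.
  move=> xB; rewrite /Q; case: eqP => [E|_]; first by move: vB; rewrite -E xB.
  by case: ifP => // /dAB; rewrite xB.
pose F x y := (Q x)^* * h x y * Q y.
set hK := hentry _.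
(* Both sides are Hermitian, so each kind of pair has to be checked in one order only. *)
pose R z w := F (g z) (g w) = if cj then hK w z else hK z w.
have Rsym z w : R z w -> R w z.
  rewrite /R => E; have -> : F (g w) (g z) = (F (g z) (g w))^*.
    by rewrite /F !rmorphM /= conjCK -hC; ring.
  by rewrite E; case: (cj); rewrite /hK -hentryC.
have qq u : unit4 u -> u^* * u = 1 by move=> uu; rewrite mulrC unit4_mulC.
have Rvv : R None None by rewrite /R /F /= hD mulr0 mul0r /hK !Kmixed_vv if_same.
have Rvl y : R None (Some (inl y)).
  have [yB _] := gBP y; rewrite /R /F /= hb' // Qv conjC1 mul1r QB // qq //.
  by rewrite /hK hentryC Kmixed_vl conjC1 if_same.
have Rvr y : R None (Some (inr y)).
  have [yA cy] := gAP y; rewrite /R /F /= hb // Qv conjC1 mul1r QA //.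
  rewrite -mulrA [_^* * _]mulrA qq // mul1r /hK hentryC Kmixed_vr -cy stE tE.
  by case: (cj); rewrite ?conjCK.
have Rll y y' : R (Some (inl y)) (Some (inl y')).
  have [yB cy] := gBP y; have [yB' cy'] := gBP y'; rewrite /R /F /= hE' // !QB //.
  rewrite /hK !Kmixed_ll [tag y' == _]eq_sym if_same /Kval -!val_eqE /= cy cy'.
  rewrite val_eqE; set d := (_ != _)%:R.
  have -> : (q' (gB y))^* * (q' (gB y) * (q' (gB y'))^* * d) * q' (gB y') =
     ((q' (gB y))^* * q' (gB y)) * ((q' (gB y'))^* * q' (gB y')) * d by ring.
  by rewrite !qq // !mul1r.
have Rrr y y' : R (Some (inr y)) (Some (inr y')).
  have [yA cy] := gAP y; have [yA' cy'] := gAP y'; rewrite /R /F /= hE // !QA //.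
  rewrite /hK !Kmixed_rr [tag y' == _]eq_sym if_same /Kval.
  have -> : (c (gA y) != c (gA y')) = (tag y != tag y').
    by rewrite -(inj_eq (can_inj sK)) -val_eqE /= cy cy'.
  set d := (_ != _)%:R; rewrite rmorphM /=.
  have -> : (q (gA y))^* * al^* * (q (gA y) * (q (gA y'))^* * d) * (q (gA y') * al) =
     ((q (gA y))^* * q (gA y)) * ((q (gA y'))^* * q (gA y')) * (al^* * al) * d by ring.
  by rewrite !qq // !mul1r.
have Rlr y y' : R (Some (inl y)) (Some (inr y')).
  have [yB _] := gBP y; have [yA' _] := gAP y'; rewrite /R /F /= hC AB // conjC0 mulr0 mul0r.
  by rewrite /hK [hentry _ (Some (inr _)) _]hentryC Kmixed_lr conjC0 if_same.
have RR z w : R z w.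
  case: z w => [[y|y]|] [[y'|y']|];
    by [apply: Rll|apply: Rlr|apply: Rrr|apply: Rvv|apply: Rvl|apply: Rvr
   |apply/Rsym/Rlr|apply/Rsym/Rvl|apply/Rsym/Rvr].
exists f, Q; split=> //; first by exists g.
have {}RR x y : F x y = if cj then hK (f y) (f x) else hK (f x) (f y).
  by have := RR (f x) (f y); rewrite /R !fK.
by case: (cj) RR => RR; [right|left] => x y; rewrite -RR.
Qed.

End KModel.

(** * From the two sides to the cases of the theorem *)

Section Cases.
Local Open Scope nat_scope.
Variables (T : finType) (G : mixed_graph T).

Definition case_i : Prop :=
  (exists (ms ms' : seq nat)
           (G1 : mixed_graph (multipart ms)) (G2 : mixed_graph (multipart ms'))
           (u1 : multipart ms) (u2 : multipart ms'),
      ((2 <= size ms)%N /\ (2 <= size ms')%N /\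
       pos_parts ms /\ pos_parts ms' /\
       same_graph G1 (complete_multipartite ms) /\
       same_graph G2 (complete_multipartite ms')) /\
      (~ star G1 /\ ~ star G2) /\
      (positive G1 \/
         exists t1 t2 t3 : nat, (0 < t1)%N /\ (0 < t2)%N /\ (0 < t3)%N /\
           switching_equivalent G1 (C3 t1 t2 t3)) /\
      (positive G2 \/
         exists t1 t2 t3 : nat, (0 < t1)%N /\ (0 < t2)%N /\ (0 < t3)%N /\
           switching_equivalent G2 (C3 t1 t2 t3)) /\
      switching_equivalent G (coalescence u1 u2 G1 G2)).

Definition case_ii : Prop :=
  (exists (qs ns : seq nat) (p : nat),
      let r := size qs in
      let k := size ns in
      let n1 := nth 0%N ns 0 in
      (pos_parts qs /\ pos_parts ns) /\
      ((2 <= r)%N /\ (2 <= k)%N /\ (1 <= p <= k)%N) /\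
      ((p = 1%N /\ ((n1 = 1%N /\ (2 <= k - p)%N) \/ (2 <= n1)%N)) \/
       ((2 <= p)%N /\ (k - p <= 1)%N) \/
       ((2 <= p)%N /\ (2 <= k - p)%N /\
        (1 <= 1 / r%:R + 1 / p%:R + 1 / (k - p - 1)%:R :> rat)%R)) /\
      switching_equivalent G (mixed_of_simple (Kgraph qs ns p))).

Definition case_iii : Prop :=
  (exists (qs ns : seq nat) (a b s : nat),
      let r := size qs in
      let k := size ns in
      (pos_parts qs /\ pos_parts ns) /\
      ((2 <= r)%N /\ (2 <= k)%N /\ (1 <= b <= a)%N /\ k = (a + b + s)%N) /\
      (a = 1%N /\ b = 1%N /\ r = 2%N) /\
      switching_equivalent G (Kmixed qs ns a b 0)).

Definition case_iv : Prop :=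
  (exists (qs ns : seq nat) (a c s : nat),
      let r := size qs in
      let k := size ns in
      (pos_parts qs /\ pos_parts ns) /\
      ((2 <= r)%N /\ (2 <= k)%N /\ (1 <= c <= a)%N /\ k = (a + c + s)%N) /\
      ((a = 1%N /\ c = 1%N /\ (s = 0%N \/ s = 1%N)) \/
       (a = 1%N /\ c = 1%N /\ s = 2%N /\ (r = 3%N \/ r = 4%N)) \/
       (a = 1%N /\ c = 1%N /\ s = 3%N /\ r = 3%N) \/
       (a = 1%N /\ c = 1%N /\ (2 <= s)%N /\ r = 2%N) \/
       (a = 2%N /\ c = 2%N /\ s = 0%N /\ (2 <= r <= 4)%N) \/
       (a = 2%N /\ c = 2%N /\ s = 1%N /\ r = 2%N) \/
       (a = 3%N /\ s = 0%N /\ r = 2%N /\ c = 2%N) \/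
       (a = 4%N /\ c = 2%N /\ r = 2%N /\ s = 0%N) \/
       ((2 <= a)%N /\ c = 1%N /\
        (((a * s)%:R - 1) / (a + s)%:R <= 1 / (r - 1)%:R :> rat)%R)) /\
      switching_equivalent G (Kmixed qs ns a 0 c)).

End Cases.

Lemma cnt_mul k (b : 'I_k -> algC) u w : unit4 u -> cnt (fun j => b j * u^*) w = cnt b (w * u).
Proof.
move=> uu; apply: eq_card => j; rewrite !inE -(inj_eq (mulIf (unit4_neq0 uu))).
by rewrite -mulrA [_^* * _]mulrC unit4_mulC // mulr1.
Qed.

Lemma fval_mul k (b : 'I_k -> algC) u : unit4 u -> fval (fun j => b j * u^*) = fval b.
Proof.
move=> uu; have nu : `|u^*| = 1 :> algC.
  by apply/eqP; rewrite -(@pexpr_eq1 _ _ 2) // normCK conjCK mulrC unit4_mulC.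
rewrite /fval -mulr_suml normrM nu mulr1; congr (_ - _).
by apply: eq_bigr => j _; rewrite normrM nu mulr1.
Qed.

(** Multiplying all weights by the conjugate of a most frequent unit makes 1 a most frequent one, as
    [cond_cases] requires. *)
Lemma max_cnt k (b : 'I_k -> algC) :
  exists2 u, unit4 u & forall w, unit4 w -> (cnt b w <= cnt b u)%N.
Proof.
pose F (i : 'I_4) := cnt b ('i ^+ i); pose m := [arg max_(i > ord0 | xpredT i) F i]%N.
have mP i : (F i <= F m)%N by rewrite /m; case: arg_maxnP => // j _; apply.
have i2 := sqrCi algC; exists ('i ^+ m).
  by rewrite /unit4 -exprM mulnC exprM (exprM _ 2 2) i2 sqrrN !expr1n.
move=> w; case/unit4P => ->.
- by have := mP (inord 0); rewrite /F inordK.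
- by have := mP (inord 2); rewrite /F inordK // i2.
- by have := mP (inord 1); rewrite /F inordK.
- by have := mP (inord 3); rewrite /F inordK // exprS i2 mulrN1.
Qed.

Section FromShape.
Variables (T : finType) (G : mixed_graph T).
Let h := hentry G.
Variables (A B : {set T}) (v : T).
Hypothesis cover : forall x, [|| x == v, x \in A | x \in B].
Hypotheses (vA : v \notin A) (vB : v \notin B) (dAB : forall x, x \in A -> x \notin B).
Hypothesis AB : forall x y, x \in A -> y \in B -> h x y = 0.
Hypothesis nopend : forall x, ~ pendant G x.

Section Data.
Variables (k : nat) (q : T -> algC) (c : T -> 'I_k) (r : 'I_k -> T) (b : 'I_k -> algC).
Hypothesis KA : Kside h A v q c r b.
Variables (k' : nat) (q' : T -> algC) (c' : T -> 'I_k') (r' : 'I_k' -> T).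
Hypothesis BB : blowup h B (@Kval k') q' c' r'.
Hypothesis hb' : forall x, x \in B -> h v x = (q' x)^*.
Variables (u : algC) (uu : unit4 u).
Let be j := b j * u^*.

(** In each outcome of [cond_cases] the nonzero weights are 1 and at most one further value [w];
    [t1] and [tw] are the codes these two receive. *)
Lemma Kmodel2 (w al : algC) (cj : bool) (t1 tw : nat)
    (NN := fun i => if i == t1 then cnt be 1 else if i == tw then cnt be w else 0%N) :
  (forall j, [\/ be j = 0, be j = 1 | be j = w]) -> w != 1 -> w != 0 ->
  t1 != tw -> (t1 < 3)%N -> (tw < 3)%N -> unit4 al ->
  Kweight t1 = (if cj then al^* else al) -> Kweight tw = (if cj then (w * al)^* else w * al) ->
  exists s : 'I_k -> 'I_k,
    let qs := class_sizes B k' c' in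
    let ns := class_sizes A k (fun x => s (c x)) in
    [/\ bijective s,
        forall j, Ktype (NN 0%N) (NN 1%N) (NN 2%N) (s j) =
          if be j == 1 then t1 else if be j == w then tw else 3%N,
        pos_parts qs, pos_parts ns &
        exists f Q, switched h (hentry (Kmixed qs ns (NN 0%N) (NN 1%N) (NN 2%N))) f Q].
Proof.
move=> bP w1 w0 t1w t13 tw3 ual E1 Ew; have [_ BA hb _ _] := KA.
pose t j := if be j == 1 then t1 else if be j == w then tw else 3%N.
have tP i : (i < 3)%N -> #|[set j | t j == i]| = NN i.
  move=> i3; rewrite /NN; case: eqP => [->|/eqP it1].
    apply: eq_card => j; rewrite !inE /t; have [//|_] := eqVneq (be j) 1; first by rewrite eqxx.
    by case: ifP => _; lia.
  case: eqP => [->|/eqP itw].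
    apply: eq_card => j; rewrite !inE /t; have [->|_] := eqVneq (be j) 1.
      by rewrite (negPf t1w) eq_sym (negPf w1).
    by case: ifP => _; lia.
  apply/eqP; rewrite cards_eq0; apply/eqP/setP => j; rewrite !inE /t.
  by case: ifP => _; [|case: ifP => _]; lia.
have ual' : unit4 (u^* * al) by rewrite unit4M ?unit4C.
have KE j : Kweight (t j) = if cj then (b j * (u^* * al))^* else b j * (u^* * al).
  rewrite mulrA -/(be j) /t; case: (bP j) => E; rewrite E.
  - rewrite eq_sym oner_eq0 eq_sym (negPf w0) mul0r conjC0 /=; by case: (cj).
  - by rewrite eqxx mul1r.
  - by rewrite (negPf w1) eqxx.
have t3 j : (t j <= 3)%N by rewrite /t; case: ifP => _; [|case: ifP => _ //]; apply: ltnW.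
have := Kmodel (@hentryC _ G) (@hentry_diag _ G) cover vA vB dAB AB BA hb BB hb' ual' KE t3.
by rewrite !tP.
Qed.

End Data.

Lemma Kshape_cases : Kshape h A B v -> [\/ case_ii G, case_iii G | case_iv G].
Proof.
move=> [k [q [c [r [b [k' [q' [c' [r' [KA k1' BB hb' f0]]]]]]]]]].
have [k1 BA hb bu [j0 bj0]] := KA; have [uq hE rP] := BA.
have [u uu umax] := max_cnt b; pose be j := b j * u^*.
have beu j : be j != 0 -> unit4 (be j).
  by rewrite mulf_eq0 negb_or => /andP[/bu ub _]; rewrite unit4M ?unit4C.
have [i1 iN iNi] := i_neq.
have sweq qs ns a1 b1 c1 f Q : switched h (hentry (Kmixed qs ns a1 b1 c1)) f Q ->
    switching_equivalent G (Kmixed qs ns a1 b1 c1).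
  by move=> S; apply/switching_equivalentP; exists f, Q.
have cmax w : unit4 w -> (cnt be w <= cnt be 1)%N.
  by move=> uw; rewrite !cnt_mul // mul1r; apply: umax; rewrite unit4M.
have n1p : (0 < cnt be 1)%N.
  have : (0 < cnt be (be j0))%N by rewrite cnt_gt0; apply/existsP; exists j0.
  move=> p; apply: leq_trans p (cmax _ _); apply: beu; apply: mulf_neq0 => //.
  by rewrite conjC_eq0 unit4_neq0.
have kE := nonzeros_le beu; rewrite /nonzeros in kE.
have ineq : (0 <= fval be + k'%:R / k'.-1%:R) by rewrite fval_mul.
rewrite (fval_ge beu k1 k1') /nonzeros /sqsum in ineq.
have c0 w j : cnt be w = 0%N -> be j <> w.
  move=> cw bw; have := cnt_gt0 be w; rewrite cw ltnn => /esym/negbT/existsPn/(_ j).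
  by rewrite bw eqxx.
have size_A (s : 'I_k -> 'I_k) : size (class_sizes A k (fun x => s (c x))) = k by rewrite
  size_mkseq.
have size_B : size (class_sizes B k' c') = k' by rewrite size_mkseq.
have N1 : -1 != 0 :> algC by rewrite oppr_eq0 oner_eq0.
have i0 : 'i != 0 :> algC by rewrite neq0Ci.
have ii : 'i * 'i = -1 :> algC by rewrite -expr2 sqrCi.
have N11 : -1 != 1 :> algC by rewrite lt_eqF // (lt_trans (ltrN10 _)) ?ltr01.
have be4 j : [\/ be j = 0, be j = 1 | [\/ be j = -1, be j = 'i | be j = - 'i]].
  have [->|/beu] := eqVneq (be j) 0; first exact: Or31.
  by case/unit4P => ->; [apply: Or32|apply: Or33; apply: Or31|apply: Or33;
    apply: Or32|apply: Or33; apply: Or33].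
have := @cond_cases (cnt be 1) (cnt be 'i) (cnt be (-1)) (cnt be (- 'i)) (cnt be 0) k'.
rewrite kE => /(_ k1' k1 n1p (cmax _ unit4_i) (cmax _ (unit4N unit4_1)) (cmax _ (unit4N
  unit4_i)) ineq).
case=> [[n2 n3 n4]|[n2 n4 n1 n3 k2]|[n3 n24p n24 c4]].
- apply: Or31.
  have bP j : [\/ be j = 0, be j = 1 | be j = 'i].
    case: (be4 j) => [->|->|[E|E|E]]; [exact: Or31|exact: Or32|by case: (c0 _ _ n3 E)
      |by case: (c0 _ _ n2 E)|by case: (c0 _ _ n4 E)].
  (* Here [w] is a dummy value: its count is 0. *)
  have [s [sb sT pq pn [f [Q S]]]] := Kmodel2 KA BB hb' uu (w := 'i) (al := 1) (cj := false)
     (t1 := 2) (tw := 0) bP i1 i0 isT isT isT unit4_1 erefl (esym (mulr1 _)).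
  rewrite /= n2 in S sT; set p := cnt be 1 in n1p S sT kE ineq.
  exists (class_sizes B k' c'), (class_sizes A k (fun x => s (c x))), p; cbv zeta;
    rewrite size_A size_B.
  have kE' : (p + cnt be 0 = k)%N by move: kE; rewrite n2 n3 n4 !addn0.
  split=> //; split; first by rewrite k1 k1' n1p -kE' leq_addr.
  split; last first.
    apply/switching_equivalentP; exists f, Q; case: S => bf uQ [S|S]; split=> //;
      [left|right] => x y;
    by rewrite Kgraph_Kmixed.
  have [p1|p2] : p = 1%N \/ (2 <= p)%N.
    by move: n1p; case: (p) => [|[|m]] // _; [left|right].
    left; split=> //; set n1 := nth _ _ _.
    have [k3|k2] : (2 <= k - p)%N \/ k = 2%N by rewrite p1; move: k1; clear; lia.
      have : (0 < n1)%N by rewrite /n1; apply: (allP pn); apply: mem_nth; rewrite size_A ltnW.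
      by case: (n1) => [|[|n]] // _; [left|right].
    (* With two classes of which [v] sees only one, and that one a single vertex, each vertex of the
       other class would be pendant. *)
    right; rewrite ltnNge; apply/negP => n1le.
    have [j1 bj1] : exists j, be j = 1.
      by have := n1p; rewrite /p cnt_gt0 => /existsP[j /eqP]; exists j.
    have [j2 bj2] : exists j, be j = 0.
      have : (0 < cnt be 0)%N by move: kE'; rewrite p1 [in RHS]k2 add1n => -[->].
      by rewrite cnt_gt0 => /existsP[j /eqP]; exists j.
    have j12 : j1 != j2 by apply/eqP => E; have := bj1; rewrite E bj2 => /eqP;
      rewrite eq_sym oner_eq0.
    have two j : j != j2 -> j = j1.
      move: j12; rewrite -!val_eqE /= => j12 jj2; apply: val_inj => /=.
      have lt2 (i : 'I_k) : (i < 2)%N by apply: leq_trans (ltn_ord i) _; rewrite k2.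
      move: (lt2 j) (lt2 j1) (lt2 j2) j12 jj2.
      by move: (nat_of_ord j) (nat_of_ord j1) (nat_of_ord j2) => a1 a2 a3; clear; lia.
    have sj1 : s j1 = 0%N :> nat.
      by have := sT j1; rewrite -/(be j1) bj1 eqxx p1; case: (nat_of_ord (s j1)).
    have [y1A cy1] := rP j1; have [yA cy] := rP j2.
    have cl1 x : x \in A -> c x = j1 -> x = r j1.
      move=> xA cx; have := n1le; rewrite /n1 nth_mkseq; last exact: ltnW.
      move/card_le1_eqP => H; apply: H; rewrite !inE ?xA ?y1A ?cx ?cy1 ?sj1 //.
    apply: (nopend (x := r j2)); rewrite /pendant /degree; apply/eqP/card1P; exists (r j1) => x.
    rewrite [LHS](_ : _ = (h (r j2) x != 0)); last by rewrite hentry_adj.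
    rewrite [RHS]inE.
    have bj2' : b j2 = 0.
      by move/eqP: bj2; rewrite mulf_eq0 conjC_eq0 (negPf (unit4_neq0 uu)) orbF => /eqP.
    case/or3P: (cover x) => [/eqP ->|xA|xB].
    + rewrite [h _ _]hentryC -/h hb // cy bj2' mul0r conjC0 eqxx; apply/esym/negbTE.
      by apply: contraNneq vA => ->.
    + rewrite hE // /Kval cy; apply/idP/eqP => [|->].
        have [->|nx] := eqVneq j2 (c x); first by rewrite mulr0 eqxx.
        by move=> _; apply: cl1 => //; apply: two; rewrite eq_sym.
      by rewrite cy1 [j2 == _]eq_sym j12 mulr1 mulf_neq0 ?conjC_eq0 ?unit4_neq0.
    + rewrite AB // eqxx; apply/esym/negbTE; apply: contraTneq xB => ->.
      exact: dAB.
  right; have [k3|k3] := leqP (k - p) 1; first by left.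
  have kp : (k - p = cnt be 0)%N by rewrite -[X in (X - _)%N]kE' addKn.
  right; rewrite kp in k3 *; do 2![split=> //].
  rewrite rat_cond3 ?subn_gt0 ?(ltnW k1') //.
  rewrite -cond2E //.
  move: ineq; rewrite n2 n3 n4 !addn0 dist2n0 mulnn.
  by rewrite kE'.
- apply: Or32.
  have bP j : [\/ be j = 0, be j = 1 | be j = -1].
    case: (be4 j) => [->|->|[E|E|E]]; [exact: Or31|exact: Or32|exact: Or33
      |by case: (c0 _ _ n2 E)|by case: (c0 _ _ n4 E)].
  (* Multiplication by the imaginary unit turns the weights 1 and -1 into those with codes 0 and
     1. *)
  have [s [sb sT pq pn [f [Q S]]]] := Kmodel2 KA BB hb' uu (w := -1) (al := 'i) (cj := false)
     (t1 := 0) (tw := 1) bP N11 N1 isT isT isT unit4_i erefl (esym (mulN1r _)).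
  rewrite /= n1 n3 in S.
  exists (class_sizes B k' c'), (class_sizes A k (fun x => s (c x))), 1%N, 1%N, (cnt be 0).
  cbv zeta; rewrite size_A size_B; split=> //; split; first by rewrite k1' k1;
    do 3![split=> //]; rewrite -[LHS]kE n1 n2 n3 n4 !addn0.
  by split=> //; apply: sweq S.
- apply: Or33.
  have main w al cj : w = 'i \/ w = - 'i -> (forall j, [\/ be j = 0, be j = 1 | be j = w]) ->
      unit4 al -> 'i = (if cj then al^* else al) -> 1 = (if cj then (w * al)^* else w * al) ->
      (cnt be 'i + cnt be (- 'i) = cnt be w)%N -> case_iv G.
    move=> wi bP ual E1 E2 cw.
    have w1 : w != 1 by case: wi => ->; rewrite // eqr_oppLR.
    have w0 : w != 0 by case: wi => ->; rewrite ?oppr_eq0.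
    have uw : unit4 w by case: wi => ->; rewrite ?unit4N ?unit4_i.
    have [s [sb sT pq pn [f [Q S]]]] := Kmodel2 KA BB hb' uu (w := w) (al := al) (cj := cj)
     (t1 := 0) (tw := 2) bP w1 w0 isT isT isT ual E1 E2.
    rewrite /= in S.
    exists (class_sizes B k' c'), (class_sizes A k (fun x => s (c x))), (cnt be 1), (cnt be w),
      (cnt be 0).
    cbv zeta; rewrite size_A size_B; split=> //; split; last by rewrite cw in c4; split;
      [exact: c4|apply: sweq S].
    rewrite k1' k1 (cmax w uw) -cw n24p /=; do 3![split=> //].
    by rewrite -[LHS]kE n3 addn0 addnA.
  (* Multiplication by i takes (1, -i) to (i, 1). Multiplication by -i takes (1, i) to (-i, 1), and
     the converse then corrects the sign. *)
  case: n24 => [n2|n4].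
  + apply: (main (- 'i) 'i false); rewrite ?n2 ?unit4_i ?mulNr ?ii ?opprK //; first by right.
    by move=> j; case: (be4 j) => [->|->|[E|E|E]]; [exact: Or31|exact: Or32|case: (c0 _ _ n3 E)
      |case: (c0 _ _ n2 E)|exact: Or33].
  + apply: (main 'i (- 'i) true);
    rewrite ?n4 ?addn0 ?unit4N ?unit4_i ?mulrN ?ii ?opprK ?rmorphN /= ?conjC1 ?conjCi ?opprK //.
      by left.
    by move=> j; case: (be4 j) => [->|->|[E|E|E]]; [exact: Or31|exact: Or32|case: (c0 _ _ n3 E)
      |exact: Or33|case: (c0 _ _ n4 E)].
Qed.

End FromShape.

Lemma card_ord_lt k a : (a <= k)%N -> #|[set j : 'I_k | (j < a)%N]| = a.
Proof.
move=> ak; have wi : injective (widen_ord ak) by move=> i j /(congr1 val) /= E; apply: val_inj.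
rewrite -[RHS]card_ord -(card_imset _ wi).
apply: eq_card => j; rewrite inE; apply/idP/imsetP => [ja|[i _ ->] /=]; last exact: ltn_ord.
by exists (Ordinal ja) => //; apply: val_inj.
Qed.

Lemma card_ord_interval k lo hi : (lo <= hi)%N -> (hi <= k)%N ->
  #|[set j : 'I_k | (lo <= j < hi)%N]| = (hi - lo)%N.
Proof.
move=> lh hk; have lk := leq_trans lh hk.
rewrite -[X in (X - _)%N](card_ord_lt hk) -[X in (_ - X)%N](card_ord_lt lk) -cardsDS; last first.
  by apply/subsetP => j; rewrite !inE => /leq_trans; apply.
by apply: eq_card => j; rewrite !inE -leqNgt.
Qed.

Lemma Kweight_unit i : Kweight i != 0 -> unit4 (Kweight i).
Proof. by case: i => [|[|[|i]]] /=; rewrite ?unit4N ?unit4_i ?unit4_1 ?eqxx. Qed.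

Lemma Kweight_eq i : (i <= 3)%N ->
  [/\ (Kweight i == 'i) = (i == 0)%N, (Kweight i == - 'i) = (i == 1)%N,
      (Kweight i == 1) = (i == 2)%N & (Kweight i == -1) = false].
Proof.
have [i1 iN iNi] := i_neq; have i0 : 'i != 0 :> algC by rewrite neq0Ci.
have N1 : -1 != 1 :> algC by rewrite lt_eqF // (lt_trans (ltrN10 _)) ?ltr01.
case: i => [|[|[|[|//]]]] _ /=.
- by rewrite eqxx (negPf iNi) (negPf i1) (negPf iN).
- by rewrite eqxx eq_sym (negPf iNi) eqr_oppLR (negPf iN) eqr_opp (negPf i1).
- by rewrite eqxx [1 == 'i]eq_sym (negPf i1) [1 == - 'i]eq_sym eqr_oppLR (negPf iN) [1 ==
  -1]eq_sym (negPf N1).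
- by rewrite [0 == 'i]eq_sym (negPf i0) [0 == - 'i]eq_sym oppr_eq0 (negPf i0) [0 == 1]eq_sym
  oner_eq0
    [0 == -1]eq_sym oppr_eq0 oner_eq0.
Qed.

(** * Inertia of the graphs (ii), (iii) and (iv) *)

Section Inertia.
Variables (qs ns : seq nat) (a b c : nat).
Hypotheses (pq : pos_parts qs) (pn : pos_parts ns).
Hypotheses (r1 : (1 < size qs)%N) (k1 : (1 < size ns)%N).
Hypothesis abc : (a + b + c <= size ns)%N.
Notation hK := (hentry (Kmixed qs ns a b c)).
Notation k := (size ns).
Notation r := (size qs).

Let wt (j : 'I_k) : algC := Kweight (Ktype a b c j).

Let Kt3 j : (Ktype a b c j <= 3)%N.
Proof. by rewrite /Ktype; do 3![case: ifP => // _]. Qed.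

Lemma cnt_Kweight : [/\ cnt wt 'i = a, cnt wt (- 'i) = b, cnt wt 1 = c & cnt wt (-1) = 0%N].
Proof.
split.
- rewrite -[RHS](@card_ord_lt k); last by lia.
  apply: eq_card => j; rewrite !inE; have [-> _ _ _] := Kweight_eq (Kt3 j); rewrite /Ktype.
  by do 3![case: ltnP => //].
- rewrite -[RHS](addKn a b) -(@card_ord_interval k); [|lia|lia].
  apply: eq_card => j; rewrite !inE; have [_ -> _ _] := Kweight_eq (Kt3 j); rewrite /Ktype.
  by do 3![case: ltnP => //]; lia.
- rewrite -[RHS](addKn (a + b) c) -(@card_ord_interval k); [|lia|lia].
  apply: eq_card => j; rewrite !inE; have [_ _ -> _] := Kweight_eq (Kt3 j); rewrite /Ktype.
  by do 3![case: ltnP => //]; lia.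
- apply/eqP; rewrite cards_eq0; apply/eqP/setP => j; rewrite !inE.
  by have [_ _ _ ->] := Kweight_eq (Kt3 j).
Qed.

(** The inequality is the nonnegativity required by [cut_codim_le], which gives the upper bound; one
    edge on each side of [v] gives the lower bound. *)
Lemma pos_inertia_Kmixed :
  ((a + b + c) * k.-1 * r.-1 <= (dist2 a b + c ^ 2) * r.-1 + r * k.-1)%N ->
  pos_inertia (Kmixed qs ns a b c) = 2%N.
Proof.
have [ci cNi c1 cN1] := cnt_Kweight; move=> ineq.
have wu j : wt j != 0 -> unit4 (wt j) by apply: Kweight_unit.
have f0 : 0 <= fval wt + r%:R / r.-1%:R.
  rewrite (fval_ge wu k1 r1) /nonzeros /sqsum ci cNi c1 cN1 dist2n0 addn0 mulnn.
  by rewrite -addnA addnC [(c ^ 2 + _)%N]addnC.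
pose A := [set z : Kvertex qs ns | if z is Some (inr _) then true else false].
pose B := [set z : Kvertex qs ns | if z is Some (inl _) then true else false].
pose v : Kvertex qs ns := None.
pose cA (z : Kvertex qs ns) : 'I_k := if z is Some (inr y) then tag y else Ordinal (ltnW k1).
pose cB (z : Kvertex qs ns) : 'I_r := if z is Some (inl y) then tag y else Ordinal (ltnW r1).
have posn (j : 'I_k) : (0 < nth 0%N ns j)%N by apply: (allP pn); apply: mem_nth.
have posq (j : 'I_r) : (0 < nth 0%N qs j)%N by apply: (allP pq); apply: mem_nth.
pose rA (j : 'I_k) : Kvertex qs ns :=
  Some (inr (Tagged (fun j : 'I_k => 'I_(nth 0%N ns j)) (Ordinal (posn j)))).
pose rB (j : 'I_r) : Kvertex qs ns :=
  Some (inl (Tagged (fun j : 'I_r => 'I_(nth 0%N qs j)) (Ordinal (posq j)))).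
have BA : blowup hK A (@Kval k) (fun=> 1) cA rA.
  split=> [x|x y|j]; [exact: unit4_1| |by rewrite inE].
  case: x y => [[x|x]|] [[y|y]|]; rewrite !inE // => _ _.
  by rewrite Kmixed_rr conjC1 !mul1r.
have BB : blowup hK B (@Kval r) (fun=> 1) cB rB.
  split=> [x|x y|j]; [exact: unit4_1| |by rewrite inE].
  case: x y => [[x|x]|] [[y|y]|]; rewrite !inE // => _ _.
  by rewrite Kmixed_ll conjC1 !mul1r.
have hA x : x \in A -> hK v x = wt (cA x) * 1^*.
  by case: x => [[x|x]|]; rewrite inE // => _; rewrite Kmixed_vr conjC1 mulr1.
have hB x : x \in B -> hK v x = (fun=> 1) (cB x) * 1^*.
  by case: x => [[x|x]|]; rewrite inE // => _; rewrite Kmixed_vl conjC1 mulr1.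
have hC := @hentryC _ (Kmixed qs ns a b c).
have hD := @hentry_diag _ (Kmixed qs ns a b c).
have hU := @hentry_unit _ (Kmixed qs ns a b c).
have AB x y : x \in A -> y \in B -> hK x y = 0.
  by case: x y => [[x|x]|] [[y|y]|]; rewrite !inE // => _ _; rewrite hC Kmixed_lr conjC0.
have [yA pA fA] := proj_on_pos hC k1 BA hA.
have [yB pB fB] := proj_on_pos hC r1 BB (b := fun=> 1) hB.
have vA : v \notin A by rewrite inE.
have vB : v \notin B by rewrite inE.
have cd : codim_le hK (v |: (A :|: B)) 2.
  apply: (cut_codim_le hC hD AB pA pB vA vB); [|exact: codim_le_pos BA|exact: codim_le_pos BB].
  by rewrite fA fB (fval_const r1 unit4_1).
have cT : v |: (A :|: B) = [set: Kvertex qs ns].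
  by apply/setP => -[[x|x]|]; rewrite !inE.
rewrite cT in cd; apply/eqP; rewrite eqn_leq; apply/andP; split.
  rewrite leqNgt; apply/negP => /pos_inertia_ge; exact: codim_le_Pge cd.
apply/pos_inertia_ge.
pose o0 n (n1 : (1 < n)%N) : 'I_n := Ordinal (ltnW n1);
  pose o1 n (n1 : (1 < n)%N) : 'I_n := Ordinal n1.
have eA : hK (rA (o0 _ k1)) (rA (o1 _ k1)) != 0 by rewrite Kmixed_rr oner_eq0.
have eB : hK (rB (o0 _ r1)) (rB (o1 _ r1)) != 0 by rewrite Kmixed_ll oner_eq0.
have inA j : rA j \in A by rewrite inE.
have inB j : rB j \in B by rewrite inE.
by eexists; last exact: (orthopos_edges hC hD hU AB (inA _) (inA _) eA (inB _) (inB _) eB).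
Qed.

End Inertia.

Section CasesInertia.
Variables (T : finType) (G : mixed_graph T).

Lemma pos_inertia_ext (T' : finType) (G1 G2 : mixed_graph T') :
  hentry G1 =2 hentry G2 -> pos_inertia G1 = pos_inertia G2.
Proof.
move=> E; rewrite /pos_inertia; congr (count _ (eigenvalues _)).
by apply/matrixP => s t; rewrite !mxE E.
Qed.

Lemma case_ii_inertia : case_ii G -> pos_inertia G = 2%N.
Proof.
move=> [qs [ns [p]]]; cbv zeta => -[[pq pn] [[r1 [k1 /andP[p0 pk]]] [H /pos_inertia_switching ->]]].
rewrite (pos_inertia_ext (@Kgraph_Kmixed qs ns p)).
apply: pos_inertia_Kmixed => //; rewrite /= add0n /dist2 add0n.
move: (size qs) (size ns) r1 k1 pk H => r k r1 k1 pk H.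
case: H => [[-> _]|[[p2 kp]|[p2 [kp]]]].
- case: r k r1 k1 {pk} => [|[|r]] // [|[|k]] // _ _ /=; nia.
(* Since [k - 1 <= p], the summand with p^2 suffices alone. *)
- apply: leq_trans (leq_addr _ _); rewrite leq_mul2r -mulnn leq_mul2l; apply/orP; right.
  by apply/orP; right; lia.
- rewrite rat_cond3; [|lia|lia|lia]; have -> : k = (p + (k - p))%N by lia.
  by rewrite addKn cond2E //; lia.
Qed.

Lemma case_iii_inertia : case_iii G -> pos_inertia G = 2%N.
Proof.
move=> [qs [ns [a [b [s]]]]]; cbv zeta => -[[pq pn] [[r1 [k1 [ab kE]]] [[a1 [b1 r2]]
  /pos_inertia_switching ->]]].
by apply: pos_inertia_Kmixed => //; rewrite ?r2 ?a1 ?b1 /= ?kE ?a1 ?b1; lia.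
Qed.

Lemma case_iv_inertia : case_iv G -> pos_inertia G = 2%N.
Proof.
move=> [qs [ns [a [c [s]]]]]; cbv zeta => -[[pq pn] [[r1 [k1 [ca kE]]] [H /pos_inertia_switching
  ->]]].
apply: pos_inertia_Kmixed => //; rewrite ?addn0 ?kE; first by lia.
by rewrite dist2n0 mulnn; apply/cond4E => //; rewrite -kE.
Qed.

End CasesInertia.

(** * The coalescences (i) *)

Lemma blowup_inj (T1 T2 : finType) (h1 : T1 -> T1 -> algC) (h2 : T2 -> T2 -> algC)
    (S : {set T2}) (f : T1 -> T2) (g : T2 -> T1) k (m : 'I_k -> 'I_k -> algC) q c r :
  (forall x, f x \in S) -> cancel f g -> (forall z, z \in S -> f (g z) = z) ->
  (forall x y, h2 (f x) (f y) = h1 x y) ->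
  blowup h1 [set: T1] m q c r ->
  blowup h2 S m (fun z => q (g z)) (fun z => c (g z)) (fun j => f (r j)).
Proof.
move=> fS fK gK hE [uq h1E rP]; split=> [z|z w zS wS|j]; first exact: uq.
  by rewrite -{1}(gK z) // -{1}(gK w) // hE h1E ?inE.
by rewrite fK; have [_ ->] := rP j.
Qed.

Lemma prod_next (T : finType) (F : T -> algC) (s : seq T) : uniq s ->
  \prod_(x <- s) F (next s x) = \prod_(x <- s) F x.
Proof.
move=> us; rewrite -(big_map (next s) xpredT F); apply: perm_big.
have inj : {in s &, injective (next s)}.
  by move=> x y _ _ E; rewrite -(prev_next us x) E prev_next.
apply: uniq_perm; rewrite ?map_inj_in_uniq // => y; apply/mapP/idP => [[x xs ->]|ys].
  by rewrite mem_next.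
by exists (prev s y); rewrite ?mem_prev // next_prev.
Qed.

Lemma C3_hentry t1 t2 t3 (x y : multipart [:: t1; t2; t3]) :
  hentry (C3 t1 t2 t3) x y = C3val (tag x) (tag y).
Proof.
rewrite /hentry /C3val /=; move: (tag x) (tag y).
by move=> [[|[|[|//]]] ?] [[|[|[|//]]] ?].
Qed.

Section Multipartite.
Variables (ms : seq nat) (G : mixed_graph (multipart ms)).
Hypotheses (ms2 : (1 < size ms)%N) (pm : pos_parts ms).
Hypothesis sG : same_graph G (complete_multipartite ms).
Notation h := (hentry G).

Let posm (j : 'I_(size ms)) : (0 < nth 0%N ms j)%N.
Proof. by apply: (allP pm); apply: mem_nth. Qed.

Definition part_rep (j : 'I_(size ms)) : multipart ms :=
  Tagged (fun j : 'I_(size ms) => 'I_(nth 0%N ms j)) (Ordinal (posm j)).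

Lemma hentry_tag x y : (h x y != 0) = (tag x != tag y).
Proof. by rewrite hentry_adj; apply: sG. Qed.

Lemma other_part (x : multipart ms) : exists y : multipart ms, tag x != tag y.
Proof.
have [E|N] := eqVneq (tag x) (Ordinal ms2); last by exists (part_rep (Ordinal ms2)).
by exists (part_rep (Ordinal (ltnW ms2))); rewrite E.
Qed.

(** Triangles and 4-cycles through [x0] suffice. A vertex outside the part of [x0] is switched by
    its entry at [x0]; one inside that part reaches [x0] along a walk through the fixed neighbour
    [y0], whence the 4-cycles. *)
Lemma positive_blowup : positive G ->
  exists q, blowup h [set: multipart ms] (@Kval (size ms)) q (@tag _ _) part_rep.
Proof.
move=> pos; pose x0 := part_rep (Ordinal ms2); have [y0 xy0] := other_part x0.
have hC := @hentryC _ G.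
have hx0y0 : h y0 x0 != 0 by rewrite hentry_tag eq_sym.
pose q (y : multipart ms) : algC := if tag y != tag x0 then h y x0 else if y == x0 then 1 else h
  y y0 * h y0 x0.
have hu (x y : multipart ms) : tag x != tag y -> unit4 (h x y) by move=> xy; apply: hentry_unit;
  rewrite hentry_tag.
have uq (y : multipart ms) : unit4 (q y).
  rewrite /q; case: ifP => [yx|/negbFE/eqP yx]; first exact: hu.
  by case: ifP => _; rewrite ?unit4_1 // unit4M ?hu // ?yx // eq_sym.
have adjG x y : adj G x y = (tag x != tag y) by apply: sG.
have neqt (x y : multipart ms) : tag x != tag y -> x != y by apply: contraNneq => ->.
have half (x y : multipart ms) : tag x != tag y -> tag x != tag x0 -> h x y = q x * (q y)^*.
  move=> xy xx0; have qx : q x = h x x0 by rewrite /q xx0.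
  have hV (a b : multipart ms) : tag a != tag b -> h b a = (h a b)^-1 by move=> ab;
    rewrite hC unit4_conj ?hu.
  rewrite qx; have [yx0|yx0] := eqVneq (tag y) (tag x0); last first.
    have qy : q y = h y x0 by rewrite /q yx0.
    have : cycle_value G [:: x; y; x0] = 1.
      apply: pos; rewrite /mixed_cycle /ucycleb /= !adjG xy yx0 [tag x0 == _]eq_sym xx0 /=.
      by rewrite !inE !negb_or neqt // neqt // neqt.
    rewrite /cycle_value !big_cons big_nil /= !eqxx.
    rewrite [y == x]eq_sym (negPf (neqt _ _ xy)) [x0 == x]eq_sym (negPf (neqt _ _ xx0)).
    rewrite [x0 == y]eq_sym (negPf (neqt _ _ yx0)) mulr1 => E.
    rewrite qy (unit4_conj (hu _ _ yx0)); rewrite (hV x x0 xx0) in E.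
    have n1 := unit4_neq0 (hu _ _ xx0); have n2 := unit4_neq0 (hu _ _ yx0).
    by apply: (mulIf n2); apply: (mulIf (invr_neq0 n1)); rewrite -[LHS]mulrA E mulfVK ?mulfV.
  have [->|nyx0] := eqVneq y x0; first by rewrite /q !eqxx conjC1 mulr1.
  have qy : q y = h y y0 * h y0 x0 by rewrite /q yx0 eqxx (negPf nyx0).
  have yy0 : tag y != tag y0 by rewrite yx0.
  have [xE|nxy0] := eqVneq x y0.
    by rewrite qy xE rmorphM /= mulrCA unit4_mulC ?mulr1 -?hC // hu // eq_sym.
  have : cycle_value G [:: x; y; y0; x0] = 1.
    apply: pos; rewrite /mixed_cycle /ucycleb /= !adjG xy yy0 [tag y0 == _]eq_sym xy0.
    rewrite [tag x0 == _]eq_sym xx0 /= !inE !negb_or (neqt _ _ xy) nxy0 (neqt _ _ xx0) (neqt _ _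
      yy0) nyx0.
    by rewrite eq_sym neqt.
  rewrite /cycle_value !big_cons big_nil /= !eqxx.
  rewrite [y == x]eq_sym (negPf (neqt _ _ xy)) [x0 == x]eq_sym (negPf (neqt _ _ xx0)).
  rewrite [y0 == x]eq_sym (negPf nxy0) [y0 == y]eq_sym (negPf (neqt _ _ yy0)).
  rewrite [x0 == y]eq_sym (negPf nyx0) (negPf (neqt _ _ xy0)) mulr1 => E.
  have y0x0 : tag y0 != tag x0 by rewrite eq_sym.
  rewrite qy rmorphM /= (unit4_conj (hu _ _ yy0)) (unit4_conj (hu _ _ y0x0)).
  rewrite (hV x x0 xx0) in E.
  have n1 := unit4_neq0 (hu _ _ xx0); have n2 := unit4_neq0 (hu _ _ yy0).
  have n3 := unit4_neq0 (hu _ _ y0x0).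
  apply: (mulIf n2); apply: (mulIf n3); apply: (mulIf (invr_neq0 n1)).
  by rewrite -2![LHS]mulrA E; field; rewrite n1 n2 n3.
exists q; split=> // x y _ _; rewrite /Kval; have [E|xy] := eqVneq (tag x) (tag y).
  by rewrite mulr0; apply/eqP; rewrite -[_ == _]negbK hentry_tag E eqxx.
rewrite mulr1; have [xx0|xx0] := eqVneq (tag x) (tag x0); last exact: half.
rewrite hC (half y x); [|by rewrite eq_sym|by rewrite -xx0 eq_sym].
by rewrite rmorphM /= conjCK mulrC.
Qed.

(** If every edge met [u], the other vertices would form a single part and the graph would be a star
    centred at [u]. Edges avoiding the shared vertex give orthogonal positive vectors in a
    coalescence. *)
Lemma nonstar_edge u : ~ star G -> exists x y, [/\ x != u, y != u & h x y != 0].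
Proof.
move=> nst; have [/existsP[x /existsP[y /and3P[xu yu xy]]]|/existsPn nE] :=
  boolP [exists x, exists y, [&& x != u, y != u & h x y != 0]]; first by exists x, y.
case: nst; pose c (x : multipart ms) : nat := (x != u).
have [w uw] := other_part u.
have wu : w != u by apply: contraNneq uw => ->.
have nadj (x y : multipart ms) : x != u -> y != u -> tag x = tag y.
  move=> xu yu; apply/eqP; have /existsPn/(_ y) := nE x.
  by rewrite xu yu /= hentry_tag negbK.
have cE (x y : multipart ms) : (tag x != tag y) = (c x != c y).
  rewrite /c; have [->|xu] := eqVneq x u; have [->|yu] := eqVneq y u; rewrite ?eqxx //=.
  - by rewrite (nadj y w yu wu).
  - by rewrite (nadj x w xu wu) eq_sym.
  - by rewrite (nadj x y xu yu) eqxx.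
have c2 x : x \in [set: multipart ms] -> (c x < 2)%N by rewrite /c; case: eqP.
have cs j : (j < 2)%N -> exists2 x, x \in [set: multipart ms] & c x = j.
  by case: j => [|[|//]] _; [exists u|exists w]; rewrite ?inE /c ?eqxx ?wu.
have [pc] := multipart_enum c2 cs.
have E : class_sizes [set: multipart ms] 2 c = [:: 1%N;
  #|[set x in [set: multipart ms] | c x == 1%N]|].
  rewrite /class_sizes /mkseq /=; congr [:: _; _].
  by rewrite -[RHS](cards1 u); apply: eq_card => x; rewrite !inE /c; case: (eqVneq x u).
move: pc; rewrite E => /and3P[_ m0 _] [g [gi gP gs]].
exists #|[set x in [set: multipart ms] | c x == 1%N]|.
have [f fK gK] := inj_surj_bij gi (fun y => gs y (in_setT y)).
exists f; split=> //; first by exists g.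
move=> x y; rewrite sG /= cE -{1}(fK x) -{1}(fK y) !(gP _).2.
by rewrite val_eqE.
Qed.

End Multipartite.

Section Coal.
Variables (T1 T2 : finType) (u1 : T1) (u2 : T2) (G1 : mixed_graph T1) (G2 : mixed_graph T2).
Notation CV := (coal_vertex u1 u2).
Notation H := (hentry (coalescence u1 u2 G1 G2)).

Definition inj_left (x : T1) : CV := if insub x is Some x' then Some (inl x') else None.
Definition inj_right (y : T2) : CV := if insub y is Some y' then Some (inr y') else None.

Lemma coal_leftK x : coal_left (inj_left x) = Some x.
Proof. by rewrite /inj_left; case: insubP => [x' _ <-|/negPn/eqP ->]. Qed.

Lemma coal_rightK y : coal_right (inj_right y) = Some y.
Proof. by rewrite /inj_right; case: insubP => [x' _ <-|/negPn/eqP ->]. Qed.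

Lemma inj_leftK (z : CV) x : coal_left z = Some x -> inj_left x = z.
Proof.
case: z => [[x'|//]|] /= [<-]; rewrite /inj_left.
  by rewrite valK.
by case: insubP => // x' /negP; rewrite eqxx.
Qed.

Lemma inj_rightK (z : CV) y : coal_right z = Some y -> inj_right y = z.
Proof.
case: z => [[//|y']|] /= [<-]; rewrite /inj_right.
  by rewrite valK.
by case: insubP => // y' /negP; rewrite eqxx.
Qed.

(** Two vertices of the left part both belong to the right part only when both are the shared
    vertex, where [r2] fails by irreflexivity. *)
Lemma coal_rel_left (r1 : rel T1) (r2 : rel T2) (z w : CV) x y : irreflexive r2 ->
  coal_left z = Some x -> coal_left w = Some y -> coal_rel r1 r2 z w = r1 x y.
Proof.
move=> ir; rewrite /coal_rel => zx wy; rewrite zx wy /=.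
by case: z zx => [[?|?]|] //=; case: w wy => [[?|?]|] //=; rewrite ?ir ?orbF.
Qed.

Lemma coal_rel_right (r1 : rel T1) (r2 : rel T2) (z w : CV) x y : irreflexive r1 ->
  coal_right z = Some x -> coal_right w = Some y -> coal_rel r1 r2 z w = r2 x y.
Proof.
move=> ir; rewrite /coal_rel => zx wy; rewrite zx wy /=.
by case: z zx => [[?|?]|] //=; case: w wy => [[?|?]|] //=; rewrite ?ir.
Qed.

Lemma coal_hentry_left (z w : CV) x y : coal_left z = Some x -> coal_left w = Some y -> H z w =
  hentry G1 x y.
Proof.
move=> zx wy; rewrite /hentry /= !(coal_rel_left _ _ zx wy) ?(coal_rel_left _ _ wy zx) //;
  by [apply: arc_irr|apply: adj_irr].
Qed.

Lemma coal_hentry_right (z w : CV) x y : coal_right z = Some x -> coal_right w = Some y -> H z w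
  = hentry G2 x y.
Proof.
move=> zx wy; rewrite /hentry /= !(coal_rel_right _ _ zx wy) ?(coal_rel_right _ _ wy zx) //;
  by [apply: arc_irr|apply: adj_irr].
Qed.

End Coal.

Lemma C3_switching_blowup (T : finType) (G : mixed_graph T) t1 t2 t3 :
  (0 < t1)%N -> (0 < t2)%N -> (0 < t3)%N -> switching_equivalent G (C3 t1 t2 t3) ->
  exists q c r, @blowup T (hentry G) [set: T] 3 C3val q c r.
Proof.
move=> p1 p2 p3 /switching_equivalentP[f [q [[g fK gK] uq H]]].
pose ts := [:: t1; t2; t3].
have pos (j : 'I_3) : (0 < nth 0%N ts j)%N by case: j => [[|[|[|//]]] ?].
pose rp (j : 'I_3) : multipart ts := Tagged (fun j : 'I_(size ts) => 'I_(nth 0%N ts j)) (Ordinal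
  (pos j)).
have qq x y a : q x * (q y)^* * ((q x)^* * a * q y) = a.
  have -> : q x * (q y)^* * ((q x)^* * a * q y) = (q x * (q x)^*) * (q y * (q y)^*) * a by ring.
  by rewrite !unit4_mulC // !mul1r.
case: H => H.
  exists q, (fun x => tag (f x)), (fun j => g (rp j)); split=> // [x y _ _|j].
    by rewrite -C3_hentry H qq.
  by rewrite inE gK.
(* The reflection of the three colours modulo 3 reverses the directed triangle and so undoes the
   transpose. *)
pose s (i : 'I_3) : 'I_3 := inord ((3 - i) %% 3).
have sC i j : C3val (s i) (s j) = C3val j i.
  rewrite /s /C3val.
  by case: i j => [[|[|[|//]]] ?] [[|[|[|//]]] ?]; rewrite /= !inordK.
have sK i : s (s i) = i.
  by apply: val_inj; rewrite /s; case: i => [[|[|[|//]]] ?]; rewrite /= !inordK //= inordK.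
exists q, (fun x => s (tag (f x))), (fun j => g (rp (s j))); split=> // [x y _ _|j].
  by rewrite sC -C3_hentry H qq.
by rewrite inE gK /= sK.
Qed.

Section CaseI.
Variables (ms ms' : seq nat) (G1 : mixed_graph (multipart ms)) (G2 : mixed_graph (multipart ms')).
Variables (u1 : multipart ms) (u2 : multipart ms').

Definition positive_or_C3 (T : finType) (G : mixed_graph T) : Prop :=
  positive G \/ exists t1 t2 t3 : nat, (0 < t1)%N /\ (0 < t2)%N /\ (0 < t3)%N /\
    switching_equivalent G (C3 t1 t2 t3).

Lemma positive_or_C3_codim (T2 : finType) (h2 : T2 -> T2 -> algC) (S : {set T2})
    (f : multipart ms -> T2) (g : T2 -> multipart ms) :
  (1 < size ms)%N -> pos_parts ms -> same_graph G1 (complete_multipartite ms) ->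
  positive_or_C3 G1 ->
  (forall x, f x \in S) -> cancel f g -> (forall z, z \in S -> f (g z) = z) ->
  (forall x y, h2 (f x) (f y) = hentry G1 x y) -> codim_le h2 S 1.
Proof.
move=> m2 pm sG H fS fK gK hE; case: H => [pos|[t1 [t2 [t3 [p1 [p2 [p3 sw]]]]]]].
  have [q B] := positive_blowup m2 pm sG pos.
  exact: codim_le_pos (blowup_inj fS fK gK hE B).
have [q [c [r B]]] := C3_switching_blowup p1 p2 p3 sw.
exact: codim_le_C3 (blowup_inj fS fK gK hE B).
Qed.

End CaseI.

(** The two parts overlap in the shared vertex only, so [codim_le_union] adds their codimensions 1
    and 1; edges of both parts away from that vertex give two positive directions. *)
Lemma case_i_inertia (T : finType) (G : mixed_graph T) : case_i G -> pos_inertia G = 2%N.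
Proof.
move=> [ms [ms' [G1 [G2 [u1 [u2 [[m2 [m2' [pm [pm' [s1 s2]]]]] [[ns1 ns2] [H1 [H2]]]]]]]]]].
move=> /pos_inertia_switching ->.
set GC := coalescence _ _ _ _; pose CV := coal_vertex u1 u2.
have hC := @hentryC _ GC; have hD := @hentry_diag _ GC; have hU := @hentry_unit _ GC.
pose L : {set CV} := [set z | coal_left z != None].
pose R : {set CV} := [set z | coal_right z != None].
have cL : codim_le (hentry GC) L 1.
  apply: (positive_or_C3_codim (G1 := G1) (f := @inj_left _ _ u1 u2) (g := fun z => odflt u1
    (coal_left z))) => //.
  - by move=> x; rewrite inE coal_leftK.
  - by move=> x; rewrite coal_leftK.
  - by move=> z; rewrite inE; case E: (coal_left z) => [x|//] _ /=; apply: inj_leftK.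
  - by move=> x y; apply: coal_hentry_left; rewrite coal_leftK.
have cR : codim_le (hentry GC) R 1.
  apply: (positive_or_C3_codim (G1 := G2) (f := @inj_right _ _ u1 u2) (g := fun z => odflt u2
    (coal_right z))) => //.
  - by move=> x; rewrite inE coal_rightK.
  - by move=> x; rewrite coal_rightK.
  - by move=> z; rewrite inE; case E: (coal_right z) => [x|//] _ /=; apply: inj_rightK.
  - by move=> x y; apply: coal_hentry_right; rewrite coal_rightK.
have cd : codim_le (hentry GC) (L :|: R) (1 + 1).
  apply: (codim_le_union hC) cL cR => [] [[x|x]|] [[y|y]|]; rewrite !inE //= => _ _.
have cT : L :|: R = [set: CV] by apply/setP => -[[x|x]|]; rewrite !inE.
rewrite cT in cd; apply/eqP; rewrite eqn_leq; apply/andP; split.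
  rewrite leqNgt; apply/negP => /pos_inertia_ge; exact: codim_le_Pge cd.
apply/pos_inertia_ge.
have [x1 [y1 [x1u y1u e1]]] := nonstar_edge m2 pm s1 u1 ns1.
have [x2 [y2 [x2u y2u e2]]] := nonstar_edge m2' pm' s2 u2 ns2.
pose A : {set CV} := [set z | if z is Some (inl _) then true else false].
pose B : {set CV} := [set z | if z is Some (inr _) then true else false].
have AB x y : x \in A -> y \in B -> hentry GC x y = 0.
  by case: x y => [[x|x]|] [[y|y]|]; rewrite !inE.
have inA x : x != u1 -> @inj_left _ _ u1 u2 x \in A.
  by move=> xu; rewrite inE /inj_left; case: insubP => //; rewrite xu.
have inB x : x != u2 -> @inj_right _ _ u1 u2 x \in B.
  by move=> xu; rewrite inE /inj_right; case: insubP => //; rewrite xu.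
have eA : hentry GC (@inj_left _ _ u1 u2 x1) (@inj_left _ _ u1 u2 y1) != 0.
  by rewrite (coal_hentry_left _ _ (coal_leftK _ _ _) (coal_leftK _ _ _)).
have eB : hentry GC (@inj_right _ _ u1 u2 x2) (@inj_right _ _ u1 u2 y2) != 0.
  by rewrite (coal_hentry_right _ _ (coal_rightK _ _ _) (coal_rightK _ _ _)).
by eexists; last exact: (orthopos_edges hC hD hU AB (inA _ x1u) (inA _ y1u) eA (inB _ x2u) (inB
  _ y2u) eB).
Qed.

(** * From two good sides to a coalescence *)

Section FromGood.
Variables (T : finType) (G : mixed_graph T).
Notation h := (hentry G).
Hypothesis nopend : forall x, ~ pendant G x.

(** Along a cycle each switching factor meets its own conjugate, so the product of the entries is
    1. *)
Lemma positive_of_blowup (T1 : finType) (f : T1 -> T) (S : {set T}) k q c r :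
  (forall x, f x \in S) -> @blowup T h S k (@Kval k) q c r -> positive (pullback f G).
Proof.
move=> fS [uq hE _] s /andP[_ /andP[cs us]]; rewrite /cycle_value.
transitivity (\prod_(x <- s) (q (f x) * (q (f (next s x)))^*)).
  rewrite !big_seq; apply: eq_bigr => x xs.
  have : adj (pullback f G) x (next s x) by exact: (next_cycle cs xs).
  rewrite -hentry_adj -[hentry (pullback f G) x _]/(h (f x) (f (next s x))) hE // /Kval.
  by case: (_ == c _); rewrite /= ?mulr0 ?eqxx ?mulr1.
rewrite big_split /= (prod_next (fun x => (q (f x))^*)) // -big_split /=.
by rewrite big1 // => x _; rewrite unit4_mulC.
Qed.

Lemma side_model (A B : {set T}) v : cut_data h A B v ->
  (forall x, [|| x == v, x \in A | x \in B]) -> (forall x, x \in A -> x \notin B) ->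
  good h A v ->
  exists ms (g : multipart ms -> T), [/\ injective g, forall z, g z \in v |: A,
    forall x, x \in v |: A -> exists z, g z = x, (1 < size ms)%N & pos_parts ms] /\
    [/\ same_graph (pullback g G) (complete_multipartite ms), ~ star (pullback g G) &
        positive_or_C3 (pullback g G)].
Proof.
move=> D cover dAB gA; have [AB vA vB nA nB vnA vnB] := D.
have [a1 a1A _] := vnA; have [a2 a2A a12] := nA _ a1A.
have a1S : a1 \in v |: A by rewrite !inE a1A orbT.
have a2S : a2 \in v |: A by rewrite !inE a2A orbT.
have build k (c : T -> 'I_k) (r : 'I_k -> T) :
    (forall j, r j \in v |: A /\ c (r j) = j) ->
    (forall x y, x \in v |: A -> y \in v |: A -> (h x y != 0) = (c x != c y)) ->
    let ms := class_sizes (v |: A) k c in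
    exists g : multipart ms -> T, [/\ injective g, forall z, g z \in v |: A,
    forall x, x \in v |: A -> exists z, g z = x, (1 < size ms)%N & pos_parts ms] /\
    [/\ same_graph (pullback g G) (complete_multipartite ms), ~ star (pullback g G) &
     forall z, c (g z) = tag z :> nat].
  move=> rP adjE ms.
  have [pm [g [gi gP gs]]] : pos_parts ms /\ exists g : multipart ms -> T,
    [/\ injective g, forall z, g z \in v |: A /\ c (g z) = tag z :> nat
      & forall x, x \in v |: A -> exists z, g z = x].
    apply: (multipart_enum (c := c)) => [x _|j jk]; first exact: ltn_ord.
    by exists (r (Ordinal jk)); rewrite ?(rP _).2 ?(rP _).1.
  have k1 : (1 < k)%N by apply: (@ord_neq_gt1 _ (c a1) (c a2)); rewrite -adjE.
  exists g; split; [split=> //|split].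
  - by move=> z; have [] := gP z.
  - by rewrite size_mkseq.
  - move=> x y; rewrite /= -hentry_adj adjE ?(gP _).1 // -val_eqE /= (gP x).2 (gP y).2.
    by rewrite val_eqE.
  - move=> [m [f [m0 [f' fK f'K] sf]]].
    have fadj x y : (h (g x) (g y) != 0) = (tag (f x) != tag (f y)) by rewrite hentry_adj;
      apply: sf.
    have uniq0 x y : tag (f x) = 0%N :> nat -> tag (f y) = 0%N :> nat -> x = y.
      move=> x0 y0; apply: (can_inj fK); case: (f x) (f y) x0 y0 => [[i i2] a] [[j j2] b] /= i0 j0.
      move: i2 a j2 b; rewrite i0 j0 => i2 a j2 b; rewrite (bool_irrelevance i2 j2) in a *.
      by congr existT; apply: val_inj; case: a b => [[|?] ?] [[|?] ?].
    (* A leaf of the star lying in [A] has all its neighbours in [v |: A], so it would be pendant in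
       [G]. An edge inside [A] supplies such a leaf. *)
    have key z z' : g z \in A -> tag (f z') = 0%N :> nat -> tag (f z) != 0%N :> nat -> False.
      move=> zA z'0 z0; apply: (nopend (x := g z)); rewrite /pendant /degree.
      apply/eqP/card1P; exists (g z') => x; rewrite [RHS]inE.
      rewrite [LHS](_ : _ = (h (g z) x != 0)); last by rewrite hentry_adj.
      have [xB|xB] := boolP (x \in B).
        rewrite AB // eqxx; apply/esym/negbTE; apply: contraTneq xB => ->.
        by have := (gP z').1; rewrite !inE => /orP[/eqP ->|/dAB].
      have [w <-] : exists w, g w = x.
        by apply: gs; rewrite !inE; have := cover x; rewrite (negPf xB) orbF.
      rewrite fadj (inj_eq gi); apply/idP/eqP => [|->]; last by rewrite -val_eqE /= z'0.
      move=> zw; apply: uniq0 => //; move: zw z0; rewrite -val_eqE /=.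
      by have := ltn_ord (tag (f z)); have := ltn_ord (tag (f w)); rewrite /=; clear; lia.
    have [z1 E1] := gs _ a1S; have [z2 E2] := gs _ a2S.
    have z12 : tag (f z1) != tag (f z2) by rewrite -fadj E1 E2.
    have [t1|t1] := eqVneq (tag (f z1) : nat) 0%N.
      by apply: (key z2 z1); rewrite ?E2 //; move: z12; rewrite -val_eqE /= t1 eq_sym.
    apply: (key z1 z2) => //; first by rewrite E1.
    move: z12 t1; rewrite -val_eqE /=.
    by have := ltn_ord (tag (f z1)); have := ltn_ord (tag (f z2)); rewrite /=; clear; lia.
  - by move=> z; have [] := gP z.
case: gA => [[k [q [c [r [_ B1]]]]]|[q [c [r B1]]]]; have [uq hE rP] := B1.
  have [|g [[gi gS gs m2 pm] [sG nst gc]]] := build k c r rP.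
    move=> x y xS yS; rewrite hE // /Kval; case: (c x == c y); rewrite /= ?mulr0 ?eqxx // mulr1.
    by rewrite mulf_neq0 ?conjC_eq0 ?unit4_neq0.
  by eexists; exists g; split; split=> //; left; apply: positive_of_blowup B1.
have [|g [[gi gS gs m2 pm] [sG nst gc]]] := build 3 c r rP.
  move=> x y xS yS; rewrite hE // /C3val.
  have : q x * (q y)^* != 0 by rewrite mulf_neq0 ?conjC_eq0 ?unit4_neq0.
  have i0 : 'i != 0 :> algC by rewrite neq0Ci.
  case: (c x) (c y) => [[|[|[|//]]] ?] [[|[|[|//]]] ?] /= N; rewrite ?mulr0 ?eqxx //;
  by rewrite mulf_neq0 ?oppr_eq0.
eexists; exists g; split; split=> //; right.
pose t (j : nat) := #|[set x in v |: A | (c x : nat) == j]|.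
have tp j : (j < 3)%N -> (0 < t j)%N.
  move=> j3; apply/card_gt0P; exists (r (Ordinal j3)).
  by rewrite inE (rP _).1 (rP _).2 /=.
exists (t 0%N), (t 1%N), (t 2%N); rewrite !tp //; do 3![split=> //].
apply/switching_equivalentP; exists id, (fun z => q (g z)); split=> //; first by exists id.
left=> x y; rewrite C3_hentry -[hentry (pullback g G) x y]/(h (g x) (g y)) hE //.
have cE z : c (g z) = tag z by apply: val_inj; apply: gc.
have -> : (q (g x))^* * (q (g x) * (q (g y))^* * C3val (c (g x)) (c (g y))) * q (g y) =
  (q (g x) * (q (g x))^*) * (q (g y) * (q (g y))^*) * C3val (c (g x)) (c (g y)) by ring.
by rewrite !unit4_mulC // !mul1r !cE.
Qed.

Lemma good_case_i (A B : {set T}) v : cut_data h A B v ->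
  (forall x, [|| x == v, x \in A | x \in B]) -> (forall x, x \in A -> x \notin B) ->
  good h A v -> good h B v -> case_i G.
Proof.
move=> D cover dAB gA gB; have [AB vA vB _ _ _ _] := D.
have D' := cut_data_sym (@hentryC _ G) D.
have cover' x : [|| x == v, x \in B | x \in A] by have := cover x;
  rewrite orbCA orbC -orbA orbCA orbC.
have dBA x : x \in B -> x \notin A by move=> xB; apply/negP => /dAB; rewrite xB.
have [ms [g1 [[g1i g1S g1s m2 pm] [s1 n1 p1]]]] := side_model D cover dAB gA.
have [ms' [g2 [[g2i g2S g2s m2' pm'] [s2 n2 p2]]]] := side_model D' cover' dBA gB.
have [u1 u1E] := g1s v (setU11 _ _); have [u2 u2E] := g2s v (setU11 _ _).
exists ms, ms', (pullback g1 G), (pullback g2 G), u1, u2.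
do 4![split=> //]; apply/switching_equivalentP.
pose f (z : coal_vertex u1 u2) : T :=
  match z with None => v | Some (inl x) => g1 (val x) | Some (inr y) => g2 (val y) end.
have g1A x : x != u1 -> g1 x \in A.
  move=> xu; have := g1S x; rewrite !inE => /orP[/eqP E|//].
  by rewrite -u1E in E; rewrite (g1i _ _ E) eqxx in xu.
have g2B x : x != u2 -> g2 x \in B.
  move=> xu; have := g2S x; rewrite !inE => /orP[/eqP E|//].
  by rewrite -u2E in E; rewrite (g2i _ _ E) eqxx in xu.
have fi : injective f.
  move=> [[x|x]|] [[y|y]|] //= E.
  - by congr (Some (inl _)); apply: val_inj; apply: g1i.
  - by have := dAB _ (g1A _ (valP x)); rewrite E g2B ?(valP y).
  - by move: vA; rewrite -E g1A ?(valP x).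
  - by have := dAB _ (g1A _ (valP y)); rewrite -E g2B ?(valP x).
  - by congr (Some (inr _)); apply: val_inj; apply: g2i.
  - by move: vB; rewrite -E g2B ?(valP x).
  - by move: vA; rewrite E g1A ?(valP y).
  - by move: vB; rewrite E g2B ?(valP y).
have fs x : exists z, f z = x.
  case/or3P: (cover x) => [/eqP ->|xA|xB]; first by exists None.
    have [z zE] : exists z, g1 z = x by apply: g1s; rewrite !inE xA orbT.
    have zu : z != u1 by apply: contraTneq xA => zu; rewrite -zE zu u1E.
    by exists (Some (inl (exist _ z zu))).
  have [z zE] : exists z, g2 z = x by apply: g2s; rewrite !inE xB orbT.
  have zu : z != u2 by apply: contraTneq xB => zu; rewrite -zE zu u2E.
  by exists (Some (inr (exist _ z zu))).
have fE z w : hentry (coalescence u1 u2 (pullback g1 G) (pullback g2 G)) z w = h (f z) (f w).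
  have L (z' w' : coal_vertex u1 u2) x y : coal_left z' = Some x -> coal_left w' = Some y ->
    g1 x = f z' -> g1 y = f w' ->
    hentry (coalescence u1 u2 (pullback g1 G) (pullback g2 G)) z' w' = h (f z') (f w').
    by move=> zx wy <- <-; rewrite (coal_hentry_left _ _ zx wy).
  have R (z' w' : coal_vertex u1 u2) x y : coal_right z' = Some x -> coal_right w' = Some y ->
    g2 x = f z' -> g2 y = f w' ->
    hentry (coalescence u1 u2 (pullback g1 G) (pullback g2 G)) z' w' = h (f z') (f w').
    by move=> zx wy <- <-; rewrite (coal_hentry_right _ _ zx wy).
  case: z w => [[x|x]|] [[y|y]|]; try by [apply: L|apply: R].
    by rewrite /= AB ?g1A ?g2B ?(valP x) ?(valP y).
  by rewrite hentryC [h _ _]hentryC /= AB ?g1A ?g2B ?(valP x) ?(valP y).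
have [f' f'K fK] := inj_surj_bij fi fs.
exists f', (fun=> 1); split; [by exists f|by move=> x; apply: unit4_1|left=> x y].
by rewrite fE !f'K conjC1 mul1r mulr1.
Qed.

End FromGood.

(** * The two sides of the cut vertex *)

(** [A] is the component of one separated vertex after deleting [v], and [B] is everything else,
    possibly several components at this stage. A vertex whose only neighbour is [v] would be
    pendant, and a side without a neighbour of [v] would be closed under adjacency, against
    connectedness. *)
Lemma cut_vertex_data (T : finType) (G : mixed_graph T) v :
  connected G -> cut_vertex G v -> (forall x, ~ pendant G x) ->
  exists A B : {set T}, [/\ cut_data (hentry G) A B v,
    forall x, [|| x == v, x \in A | x \in B] & forall x, x \in A -> x \notin B].
Proof.
move=> con [x0 [y0 [x0v y0v _ nc]]] nopend.
pose C := [set x | connect (adj_del G v) x0 x].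
pose A := C :\ v; pose B := ~: C :\ v.
have vA : v \notin A by rewrite !inE eqxx.
have vB : v \notin B by rewrite !inE eqxx.
have AB x y : x \in A -> y \in B -> hentry G x y = 0.
  rewrite !inE => /andP[xv xC] /andP[yv yC]; apply/eqP; rewrite -[_ == _]negbK hentry_adj.
  apply: contra yC => xy; apply: connect_trans xC (connect1 _).
  by rewrite /adj_del /= xv yv.
have cover x : [|| x == v, x \in A | x \in B] by rewrite !inE; case: (x == v); case: connect.
have dAB x : x \in A -> x \notin B by rewrite !inE => /andP[-> ->].
have nbr x : x != v -> exists2 y, y != v & hentry G x y != 0.
  move=> xv; have [/existsP[y /andP[yv xy]]|/existsPn nE] :=
    boolP [exists y, (y != v) && (hentry G x y != 0)]; first by exists y.
  have only y : adj G x y -> y = v.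
    by move=> xy; apply/eqP; have := nE y; rewrite hentry_adj xy andbT negbK.
  have xv' : adj G x v.
    have /connectP[[|y p] /= ] := con x v; first by move=> _ E; rewrite E eqxx in xv.
    by move=> /andP[xy _] _; rewrite -(only y xy).
  case: (nopend x); rewrite /pendant /degree; apply/eqP/card1P; exists v => y.
  by rewrite [RHS]inE; apply/idP/eqP => [/only //|->].
have noiso (S S' : {set T}) : (forall x, [|| x == v, x \in S | x \in S']) -> v \notin S ->
    (forall x y, x \in S -> y \in S' -> hentry G x y = 0) ->
    forall x, x \in S -> exists2 y, y \in S & hentry G x y != 0.
  move=> cov vS SS' x xS; have [|y yv xy] := nbr x; first by apply: contraNneq vS => <-.
  exists y => //; have := cov y; rewrite (negPf yv) /= => /orP[//|yS'].
  by rewrite SS' ?eqxx in xy.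
have vn (S S' : {set T}) s0 : (forall x, [|| x == v, x \in S | x \in S']) -> v \notin S ->
    (forall x y, x \in S -> y \in S' -> hentry G x y = 0) -> s0 \in S ->
    exists2 x, x \in S & hentry G v x != 0.
  move=> cov vS SS' s0S.
  have [/existsP[x /andP[xS vx]]|/existsPn nE] := boolP [exists x, (x \in S) && (hentry G v x !=
    0)].
    by exists x.
  have cl : forall x y, adj G x y -> x \in S -> y \in S.
    move=> x y; rewrite -hentry_adj => xy xS; case/or3P: (cov y) => [/eqP yv|//|yS'].
      by have := nE x; rewrite xS /= hentryC conjC_eq0 -yv xy.
    by rewrite SS' ?eqxx in xy.
  have clS : closed (adj G) (mem S).
    by apply: intro_closed cl => x y; rewrite (sym_connect_sym (@adj_sym _ G)).
  by have := closed_connect clS (con s0 v); rewrite /= s0S (negPf vS).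
have BA x y : x \in B -> y \in A -> hentry G x y = 0.
  by move=> xB yA; rewrite hentryC AB // conjC0.
have cover' x : [|| x == v, x \in B | x \in A] by have := cover x; rewrite [(x \in A) || _]orbC.
have x0A : x0 \in A by rewrite !inE x0v connect0.
have y0B : y0 \in B by rewrite !inE y0v nc.
exists A, B; split=> //; split=> //.
- exact: noiso cover vA AB.
- exact: noiso cover' vB BA.
- exact: vn cover vA AB x0A.
- exact: vn cover' vB BA y0B.
Qed.

Local Close Scope ring_scope.

Theorem theorem1p2 (T : finType) (G : mixed_graph T) (v : T) :
  connected G -> cut_vertex G v -> (forall x, ~ pendant G x) ->
  (pos_inertia G = 2%N <->
   (* (i) *)
   (exists (ms ms' : seq nat)
           (G1 : mixed_graph (multipart ms)) (G2 : mixed_graph (multipart ms'))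
           (u1 : multipart ms) (u2 : multipart ms'),
      ((2 <= size ms)%N /\ (2 <= size ms')%N /\
       pos_parts ms /\ pos_parts ms' /\
       same_graph G1 (complete_multipartite ms) /\
       same_graph G2 (complete_multipartite ms')) /\
      (~ star G1 /\ ~ star G2) /\
      (positive G1 \/
         exists t1 t2 t3 : nat, (0 < t1)%N /\ (0 < t2)%N /\ (0 < t3)%N /\
           switching_equivalent G1 (C3 t1 t2 t3)) /\
      (positive G2 \/
         exists t1 t2 t3 : nat, (0 < t1)%N /\ (0 < t2)%N /\ (0 < t3)%N /\
           switching_equivalent G2 (C3 t1 t2 t3)) /\
      switching_equivalent G (coalescence u1 u2 G1 G2))
   \/
   (* (ii) *)
   (exists (qs ns : seq nat) (p : nat),
      let r := size qs in
      let k := size ns in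
      let n1 := nth 0%N ns 0 in
      (pos_parts qs /\ pos_parts ns) /\
      ((2 <= r)%N /\ (2 <= k)%N /\ (1 <= p <= k)%N) /\
      ((p = 1%N /\ ((n1 = 1%N /\ (2 <= k - p)%N) \/ (2 <= n1)%N)) \/
       ((2 <= p)%N /\ (k - p <= 1)%N) \/
       ((2 <= p)%N /\ (2 <= k - p)%N /\
        (1 <= 1 / r%:R + 1 / p%:R + 1 / (k - p - 1)%:R :> rat)%R)) /\
      switching_equivalent G (mixed_of_simple (Kgraph qs ns p)))
   \/
   (* (iii) *)
   (exists (qs ns : seq nat) (a b s : nat),
      let r := size qs in
      let k := size ns in
      (pos_parts qs /\ pos_parts ns) /\
      ((2 <= r)%N /\ (2 <= k)%N /\ (1 <= b <= a)%N /\ k = (a + b + s)%N) /\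
      (a = 1%N /\ b = 1%N /\ r = 2%N) /\
      switching_equivalent G (Kmixed qs ns a b 0))
   \/
   (* (iv) *)
   (exists (qs ns : seq nat) (a c s : nat),
      let r := size qs in
      let k := size ns in
      (pos_parts qs /\ pos_parts ns) /\
      ((2 <= r)%N /\ (2 <= k)%N /\ (1 <= c <= a)%N /\ k = (a + c + s)%N) /\
      ((a = 1%N /\ c = 1%N /\ (s = 0%N \/ s = 1%N)) \/
       (a = 1%N /\ c = 1%N /\ s = 2%N /\ (r = 3%N \/ r = 4%N)) \/
       (a = 1%N /\ c = 1%N /\ s = 3%N /\ r = 3%N) \/
       (a = 1%N /\ c = 1%N /\ (2 <= s)%N /\ r = 2%N) \/
       (a = 2%N /\ c = 2%N /\ s = 0%N /\ (2 <= r <= 4)%N) \/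
       (a = 2%N /\ c = 2%N /\ s = 1%N /\ r = 2%N) \/
       (a = 3%N /\ s = 0%N /\ r = 2%N /\ c = 2%N) \/
       (a = 4%N /\ c = 2%N /\ r = 2%N /\ s = 0%N) \/
       ((2 <= a)%N /\ c = 1%N /\
        (((a * s)%:R - 1) / (a + s)%:R <= 1 / (r - 1)%:R :> rat)%R)) /\
      switching_equivalent G (Kmixed qs ns a 0 c))).
Proof.
move=> con cut nopend; have [A [B [D cover dAB]]] := cut_vertex_data con cut nopend.
split=> [p2|].
  have P3 : ~ Pge (hentry G) [set: T] 3 by move/pos_inertia_ge; rewrite p2.
  have hC := @hentryC _ G.
  have D' := cut_data_sym hC D; have [AB vA vB _ _ _ _] := D; have [BA _ _ _ _ _ _] := D'.
  have cover' x : [|| x == v, x \in B | x \in A] by rewrite [(x \in B) || _]orbC.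
  have dBA x : x \in B -> x \notin A by move=> xB; apply/negP => /dAB; rewrite xB.
  case: (cut_structure hC (@hentry_diag _ G) (@hentry_unit _ G) P3 D) => [[gA gB]|K|K].
  - by left; apply: good_case_i D cover dAB gA gB.
  - by right; case: (Kshape_cases cover vA vB dAB AB nopend K); [left|right; left|right; right].
  - by right; case: (Kshape_cases cover' vB vA dBA BA nopend K); [left|right; left|right; right].
case=> [/case_i_inertia //|[/case_ii_inertia //|[/case_iii_inertia //|/case_iv_inertia //]]].
Qed.
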